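(* Let $N$ be an even positive integer, $m$ any integer, and $0<a\leq 1$. For any $\alpha,\beta>0$ with $\alpha\beta^N=\pi^{N+1}$, \begin{align*} &\alpha^{-\left(\frac{2Nm-1}{N+1}\right)}\bigg(\left(a-\tfrac{1}{2}\right)\zeta(2Nm)+\sum_{j=1}^{m}\frac{B_{2j+1}(a)}{(2j+1)!}\zeta(2N(m-j))(2^N\alpha)^{2j}+\sum_{n=1}^{\infty}\frac{n^{-2Nm}\exp\left(-a(2n)^{N}\alpha\right)}{1-\exp\left(-(2n)^{N}\alpha\right)}\bigg)\\ &=\beta^{-\left(\frac{2Nm-1}{N+1}\right)}\frac{2^{2Nm-1}}{N}\Bigg\{\pi^{-\left(\frac{1-2Nm}{N}\right)}\Gamma\left(\frac{1-2Nm}{N}\right)\zeta\left(\frac{1-2Nm}{N},a\right)\\ &\quad-2(-1)^{\frac{N}{2}+m}2^{\frac{1-2Nm}{N}}\sum_{j=0}^{\frac{N}{2}-1}(-1)^j\Bigg[\sum_{n=1}^{\infty}\frac{\cos(2\pi na)}{n^{2m+1-\frac{1}{N}}}\mathrm{Im}\Bigg(\frac{e^{\frac{i\pi(2j+1)}{2N}}}{\exp\left((2n)^{\frac{1}{N}}\beta e^{\frac{i\pi(2j+1)}{2N}}\right)-1}\Bigg)\\ &\qquad+(-1)^{j+\frac{N}{2}+1}\sum_{n=1}^{\infty}\frac{\sin(2\pi na)}{n^{2m+1-\frac{1}{N}}}\mathrm{Re}\Bigg(\frac{e^{\frac{i\pi(2j+1)}{2N}}}{\exp\left((2n)^{\frac{1}{N}}\beta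 e^{\frac{i\pi(2j+1)}{2N}}\right)-1}\Bigg)\Bigg]\Bigg\}\\ &\quad+(-1)^{\frac{N}{2}+1}2^{2Nm-1}\sum_{j=0}^{m}\frac{B_{2j}(a)B_{(2m+1-2j)N}}{(2j)!((2m+1-2j)N)!}\alpha^{\frac{2j}{N+1}}\beta^{N+\frac{2N^2(m-j)-N}{N+1}}. \end{align*}
   Context: $\zeta(s)$ is the Riemann zeta function and $\zeta(s,a)$ the Hurwitz zeta function. $B_j(a)$ are Bernoulli polynomials ($\sum_{j\ge0}B_j(a)z^j/j!=ze^{az}/(e^z-1)$) and $B_j=B_j(1)$. Sums over $j$ run through integers; sums with upper limit smaller than the lower limit are $0$ (e.g. when $m\le 0$). *)

(* Defs.v *)
From Stdlib Require Import Reals ZArith List.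
From Coquelicot Require Import Coquelicot.
Open Scope R_scope.

(* Sum over the integers lo <= j <= hi ; it is 0 when hi < lo. *)
Definition zsum (lo hi : Z) (f : Z -> R) : R :=
  fold_right Rplus 0 (map (fun k : nat => f (lo + Z.of_nat k)%Z)
                          (seq 0 (Z.to_nat (hi - lo + 1)))).

Definition nsum (n : nat) (f : nat -> R) : R :=
  fold_right Rplus 0 (map f (seq 0 n)).

Definition series1 (f : nat -> R) : R := Series (fun k => f (S k)).

Definition binomR (n k : nat) : R :=
  INR (fact n) / (INR (fact k) * INR (fact (n - k))).

(* Bernoulli polynomials B_0(x), ..., B_n(x), via the identity
   sum_{k=0}^{n} C(n+1,k) B_k(x) = (n+1) x^n, which is equivalent to the
   generating function  z e^{xz}/(e^z-1) = sum_j B_j(x) z^j / j!. *)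
Fixpoint bern_list (n : nat) (x : R) : list R :=
  match n with
  | O => 1 :: nil
  | S n' =>
      let l := bern_list n' x in
      l ++ (x ^ n - / INR (S n) * nsum n (fun k => binomR (S n) k * nth k l 0)) :: nil
  end.

Definition bernpoly (n : nat) (x : R) : R := nth n (bern_list n x) 0.

Definition bernnum (n : nat) : R := bernpoly n 1.

(* Hurwitz zeta, analytically continued (real s <> 1, a > 0), defined by
   the Euler--Maclaurin limit
   zeta(s,a) = lim_{M->oo} [ sum_{n=0}^{M-1} (n+a)^{-s} + (M+a)^{1-s}/(s-1)
        + (M+a)^{-s}/2 + sum_{k=1}^{K} B_{2k}/(2k)! * s(s+1)...(s+2k-2) (M+a)^{1-s-2k} ]
   with K large enough that s + 2K > 0 (the Euler-Maclaurin remainder then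
   tends to 0). For s > 1 this is the usual series sum_{n>=0} (n+a)^{-s}. *)
Definition rising (s : R) (k : nat) : R := fold_right Rmult 1 (map (fun i => s + INR i) (seq 0 k)).

Definition hurwitz_EM (s a : R) (K M : nat) : R :=
  nsum M (fun n => Rpower (INR n + a) (- s))
  + Rpower (INR M + a) (1 - s) / (s - 1)
  + Rpower (INR M + a) (- s) / 2
  + nsum K (fun k => bernnum (2 * S k) / INR (fact (2 * S k))
                     * rising s (2 * S k - 1)
                     * Rpower (INR M + a) (1 - s - 2 * INR (S k))).

Definition hurwitz_zeta (s a : R) : R :=
  real (Lim_seq (hurwitz_EM s a (Z.to_nat (up (Rabs s)) + 1))).

Definition riemann_zeta (s : R) : R := hurwitz_zeta s 1.

(* Gamma function: Euler integral for x > 0, extended to the other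
   non-integer reals by Gamma(x) = Gamma(x+k) / (x (x+1) ... (x+k-1)). *)
Definition Gamma_pos (x : R) : R :=
  RInt_gen (fun t => Rpower t (x - 1) * exp (- t)) (at_right 0) (Rbar_locally p_infty).

Definition Gamma (x : R) : R :=
  let k := Z.to_nat (up (- x)) in
  Gamma_pos (x + INR k) / rising x k.

Definition Cexp (z : C) : C :=
  (exp (Re z) * cos (Im z), exp (Re z) * sin (Im z)).

(* Main.v *)
(* With c = 2^N alpha the series on the left is, up to zeta values coming from
   the Laurent polynomial of e^(-ay)/(1-e^(-y)) at 0, the sum over n of
   ker(c n^N) with ker(y) = y^(-2m) R(y), where R is the Laurent remainder of
   order 2m.  For m >= 1 the Fourier expansion of R in a,
   R(y) = +- y^(2m) sum_b 2 Re (e^(iba)/(y+ib)) / b^(2m), b = 2 pi k,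
   permits exchanging the sums over n and b.  The inner sums over n are
   evaluated by splitting 1/(y^2+b^2), y = c n^N, into partial fractions in n^2
   and applying the expansion of coth to each of them.  This leaves a linear
   term in (b/c)^(1/N), the exponentially small terms of the theorem and, for
   the sine part, half the term at n = 0.  The linear terms add up to the integral
   of ker(x^N) over x > 0, which is a Mellin transform, equal to
   Gamma(s) zeta(s,a)/N by the Euler-Maclaurin definition of zeta(s,a).
   The terms of the identity for m are the second derivatives in a of those for
   m+1; comparing second differences carries the identity from m >= 1 down to
   all m <= 0. *)

Require Import Defs.
From Stdlib Require Import Reals ZArith List Arith Lra Lia Classical.
From Coquelicot Require Import Coquelicot.
Open Scope R_scope.
Set Bullet Behavior "Strict Subproofs".

(** The exchange of the sums over [n] and [b] rests on the bound [4 / (b^(2 m) (1 + y))] for a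
    Fourier term. It is summable over [b] once [m >= 1], and it is summable over [y = c n^N] and
    integrable over [y = x^N] because [N >= 2]. For [m <= 0] this domination is lost, which forces
    the descent. There the second derivative is replaced by the backward difference at [a], [a - h],
    [a - 2 h]: backward because [a = 1] is allowed, and a difference so that nothing is
    differentiated under a sum or an integral. Every error is [O(h^3)], so the defect of the
    identity for [m] is [O(h)] and therefore 0. An even [N] makes [x^N] a power of [x^2], so that
    the partial fractions lead to coth sums. The half term at [n = 0], summed over [b], is
    [B_(2m+1)(a) / (2 (2m+1)!)]; it cancels the contribution of [zeta(0) = -1/2] on the left, from
    [j = m] or, if [m = 0], from the term with [a - 1/2]. The even Laurent coefficients produce zeta
    values at positive even integers, which become the Bernoulli sum on the right. *)

(** * Finite sums *)

Lemma fold_right_Rplus_snoc (l : list R) (x : R) :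
  fold_right Rplus 0 (l ++ x :: nil) = fold_right Rplus 0 l + x.
Proof. induction l as [|y l IH]; simpl; [|rewrite IH]; ring. Qed.

Lemma nsum_S (n : nat) (f : nat -> R) : nsum (S n) f = nsum n f + f n.
Proof.
  unfold nsum. rewrite seq_S, map_app. simpl.
  now rewrite fold_right_Rplus_snoc.
Qed.

Lemma nsum_0 (f : nat -> R) : nsum 0 f = 0.
Proof. reflexivity. Qed.

Lemma nsum_ext (n : nat) (f g : nat -> R) :
  (forall i, (i < n)%nat -> f i = g i) -> nsum n f = nsum n g.
Proof.
  induction n as [|n IH]; intros H; [reflexivity|].
  rewrite !nsum_S, IH, (H n) by (intros; try apply H; lia). reflexivity.
Qed.

Lemma nsum_plus (n : nat) (f g : nat -> R) :
  nsum n (fun i => f i + g i) = nsum n f + nsum n g.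
Proof. induction n as [|n IH]; [rewrite !nsum_0|rewrite !nsum_S, IH]; ring. Qed.

Lemma nsum_scal (n : nat) (c : R) (f : nat -> R) :
  nsum n (fun i => c * f i) = c * nsum n f.
Proof. induction n as [|n IH]; [rewrite !nsum_0|rewrite !nsum_S, IH]; ring. Qed.

Lemma nsum_minus (n : nat) (f g : nat -> R) :
  nsum n (fun i => f i - g i) = nsum n f - nsum n g.
Proof. induction n as [|n IH]; [rewrite !nsum_0|rewrite !nsum_S, IH]; ring. Qed.

Lemma nsum_zero (n : nat) (f : nat -> R) :
  (forall i, (i < n)%nat -> f i = 0) -> nsum n f = 0.
Proof.
  intros H. rewrite (nsum_ext n f (fun i => 0 * 0)) by (intros; rewrite H; auto; ring).
  rewrite nsum_scal. ring.
Qed.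

Lemma nsum_single (n k : nat) (f : nat -> R) :
  (k < n)%nat -> (forall i, (i < n)%nat -> i <> k -> f i = 0) -> nsum n f = f k.
Proof.
  induction n as [|n IH]; intros Hk H; [lia|]. rewrite nsum_S.
  destruct (Nat.eq_dec k n) as [->|Hn].
  - rewrite nsum_zero; [ring|]. intros i Hi. apply H; lia.
  - rewrite IH, (H n) by (try intros; try apply H; lia). ring.
Qed.

Lemma nsum_const (n : nat) (c : R) : nsum n (fun _ => c) = INR n * c.
Proof.
  induction n as [|n IH]; [rewrite nsum_0; simpl; ring|].
  rewrite nsum_S, IH, S_INR. ring.
Qed.

Lemma nsum_le (n : nat) (f g : nat -> R) :
  (forall i, (i < n)%nat -> f i <= g i) -> nsum n f <= nsum n g.
Proof.
  induction n as [|n IH]; intros H; [rewrite !nsum_0; lra|].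
  rewrite !nsum_S. apply Rplus_le_compat; [apply IH; intros|]; apply H; lia.
Qed.

Lemma nsum_Rabs (n : nat) (f : nat -> R) : Rabs (nsum n f) <= nsum n (fun i => Rabs (f i)).
Proof.
  induction n as [|n IH]; [rewrite !nsum_0, Rabs_R0; lra|].
  rewrite !nsum_S. eapply Rle_trans; [apply Rabs_triang|]. lra.
Qed.

Lemma nsum_first (n : nat) (f : nat -> R) :
  nsum (S n) f = f 0%nat + nsum n (fun i => f (S i)).
Proof.
  induction n as [|n IH]; [rewrite nsum_S, !nsum_0; ring|].
  rewrite nsum_S, IH, nsum_S. ring.
Qed.

Lemma nsum_add (p q : nat) (f : nat -> R) :
  nsum (p + q) f = nsum p f + nsum q (fun i => f (p + i)%nat).
Proof.
  induction q as [|q IH]; [rewrite Nat.add_0_r, nsum_0; ring|].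
  rewrite Nat.add_succ_r, !nsum_S, IH. ring.
Qed.

Lemma nsum_rev (n : nat) (f : nat -> R) : nsum n f = nsum n (fun i => f (n - 1 - i)%nat).
Proof.
  induction n as [|n IH]; [reflexivity|].
  rewrite (nsum_first n (fun i => f (S n - 1 - i)%nat)), nsum_S, IH, Rplus_comm.
  f_equal; [f_equal; lia|]. apply nsum_ext; intros. f_equal; lia.
Qed.

Lemma nsum_swap (p q : nat) (f : nat -> nat -> R) :
  nsum p (fun i => nsum q (f i)) = nsum q (fun j => nsum p (fun i => f i j)).
Proof.
  induction p as [|p IH].
  - symmetry. apply nsum_zero. reflexivity.
  - rewrite nsum_S, IH, <- nsum_plus. apply nsum_ext; intros. now rewrite nsum_S.
Qed.

Lemma nsum_telescope (n : nat) (f : nat -> R) :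
  nsum n (fun i => f (S i) - f i) = f n - f 0%nat.
Proof. induction n as [|n IH]; [rewrite nsum_0|rewrite nsum_S, IH]; ring. Qed.

Lemma is_derive_nsum (n : nat) (f df : nat -> R -> R) (x : R) :
  (forall i, (i < n)%nat -> is_derive (f i) x (df i x)) ->
  is_derive (fun y => nsum n (fun i => f i y)) x (nsum n (fun i => df i x)).
Proof.
  induction n as [|n IH]; intros H.
  - apply is_derive_ext with (fun _ => 0); [reflexivity|].
    apply (is_derive_const (V := R_NormedModule)).
  - rewrite nsum_S.
    apply is_derive_ext with (fun y => nsum n (fun i => f i y) + f n y).
    + intros; now rewrite nsum_S.
    + apply (is_derive_plus (V := R_NormedModule)); [apply IH; intros|]; apply H; lia.
Qed.

(** * Series indexed from 1 *)

(** Convergence is part of this relation, whereas [series1] is total and assigns a number to a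
    divergent series as well. All arguments use [sums]; [sums_series1] returns to the form of the
    theorem. *)
Definition sums (u : nat -> R) (l : R) : Prop :=
  is_lim_seq (fun K => nsum K (fun k => u (S k))) l.

Lemma nsum_sum_n (n : nat) (f : nat -> R) : nsum (S n) f = sum_n f n.
Proof.
  induction n as [|n IH].
  - rewrite nsum_S, nsum_0, sum_O. apply Rplus_0_l.
  - rewrite nsum_S, IH, sum_Sn. reflexivity.
Qed.

Lemma sums_is_series (u : nat -> R) (l : R) :
  sums u l <-> is_series (fun k => u (S k)) l.
Proof.
  unfold sums. rewrite is_lim_seq_incr_1.
  split; intros H.
  - apply (is_lim_seq_ext _ (sum_n (fun k => u (S k))) l) in H; [exact H|].
    intros n. apply nsum_sum_n.
  - apply (is_lim_seq_ext (sum_n (fun k => u (S k)))); [|exact H].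
    intros n. symmetry. apply nsum_sum_n.
Qed.

Lemma sums_series1 (u : nat -> R) (l : R) : sums u l -> series1 u = l.
Proof. intros H. apply is_series_unique. now apply sums_is_series. Qed.

Lemma sums_unique (u : nat -> R) (l l' : R) : sums u l -> sums u l' -> l = l'.
Proof. intros H H'. rewrite <- (sums_series1 _ _ H). now apply sums_series1. Qed.

Lemma sums_ext (u v : nat -> R) (l : R) :
  (forall n, (1 <= n)%nat -> u n = v n) -> sums u l -> sums v l.
Proof.
  intros H. apply is_lim_seq_ext. intros n. apply nsum_ext. intros; apply H; lia.
Qed.

Lemma sums_eq (u : nat -> R) (l l' : R) : l = l' -> sums u l -> sums u l'.
Proof. now intros ->. Qed.

Lemma sums_plus (u v : nat -> R) (l l' : R) :
  sums u l -> sums v l' -> sums (fun n => u n + v n) (l + l').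
Proof.
  intros H H'. eapply is_lim_seq_ext; [|exact (is_lim_seq_plus' _ _ _ _ H H')].
  intros n. now rewrite nsum_plus.
Qed.

Lemma sums_scal (c : R) (u : nat -> R) (l : R) :
  sums u l -> sums (fun n => c * u n) (c * l).
Proof.
  intros H. eapply is_lim_seq_ext; [|exact (is_lim_seq_scal_l _ c _ H)].
  intros n. now rewrite nsum_scal.
Qed.

Lemma sums_minus (u v : nat -> R) (l l' : R) :
  sums u l -> sums v l' -> sums (fun n => u n - v n) (l - l').
Proof.
  intros H H'. eapply is_lim_seq_ext; [|exact (is_lim_seq_minus' _ _ _ _ H H')].
  intros n. now rewrite nsum_minus.
Qed.

Lemma sums_zero : sums (fun _ => 0) 0.
Proof.
  apply is_lim_seq_ext with (fun _ => 0); [|apply is_lim_seq_const].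
  intros n. symmetry. now apply nsum_zero.
Qed.

Lemma sums_nsum (p : nat) (u : nat -> nat -> R) (l : nat -> R) :
  (forall i, (i < p)%nat -> sums (u i) (l i)) ->
  sums (fun n => nsum p (fun i => u i n)) (nsum p l).
Proof.
  induction p as [|p IH]; intros H.
  - eapply sums_ext; [|apply sums_zero]. reflexivity.
  - rewrite nsum_S. eapply sums_ext; [intros n _; symmetry; apply nsum_S|].
    apply sums_plus; [apply IH; intros|]; apply H; lia.
Qed.

Lemma sums_le (u v : nat -> R) (l l' : R) :
  (forall n, (1 <= n)%nat -> u n <= v n) -> sums u l -> sums v l' -> l <= l'.
Proof.
  intros H H1 H2. apply (is_lim_seq_le _ _ _ _ (fun n => nsum_le n _ _
    (fun i _ => H (S i) ltac:(lia))) H1 H2).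
Qed.

Lemma sums_dom (u v : nat -> R) (s : R) :
  (forall n, (1 <= n)%nat -> Rabs (u n) <= v n) -> sums v s ->
  exists l, sums u l /\ Rabs l <= s.
Proof.
  intros H Hv.
  destruct (ex_series_le (K := R_AbsRing) (V := R_CompleteNormedModule)
    (fun k => u (S k)) (fun k => v (S k))) as [l Hl].
  - intros n. apply H. lia.
  - exists s. now apply sums_is_series.
  - assert (Hu : sums u l) by now apply sums_is_series.
    exists l. split; [exact Hu|].
    apply Rabs_le. split.
    + apply (sums_le (fun n => -1 * v n) u (-s) l); auto.
      * intros n Hn. specialize (H n Hn). apply Rabs_le_between in H. lra.
      * replace (- s) with (-1 * s) by ring. now apply sums_scal.
    + apply (sums_le u v); auto.
      intros n Hn. specialize (H n Hn). apply Rabs_le_between in H. lra.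
Qed.

Lemma sums_Rabs_le (u v : nat -> R) (l s : R) :
  (forall n, (1 <= n)%nat -> Rabs (u n) <= v n) -> sums u l -> sums v s -> Rabs l <= s.
Proof.
  intros H Hu Hv. destruct (sums_dom u v s H Hv) as [l' [H1 H2]].
  now rewrite (sums_unique _ _ _ Hu H1).
Qed.

Lemma INR_pos (n : nat) : (1 <= n)%nat -> 1 <= INR n.
Proof. intros H. apply (le_INR 1 n H). Qed.

(** Comparison with the telescoping series of [2 (1/n - 1/(n+1))]. This is the common majorant of
    the absolutely convergent series below. *)
Lemma sums_inv_sqr : exists s, sums (fun n => / INR n ^ 2) s.
Proof.
  destruct (sums_dom (fun n => / INR n ^ 2) (fun n => 2 * (/ INR n - / INR (S n))) 2)
    as [l [Hl _]].
  - intros n Hn. apply INR_pos in Hn. rewrite S_INR.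
    rewrite Rabs_right by (apply Rle_ge, Rlt_le, Rinv_0_lt_compat, pow_lt; lra).
    replace (2 * (/ INR n - / (INR n + 1))) with (2 / (INR n * (INR n + 1))) by (field; lra).
    apply (Rmult_le_reg_r (INR n ^ 2 * (INR n + 1))); [apply Rmult_lt_0_compat; [apply pow_lt|]; lra|].
    replace (/ INR n ^ 2 * (INR n ^ 2 * (INR n + 1))) with (INR n + 1) by (field; lra).
    replace (2 / (INR n * (INR n + 1)) * (INR n ^ 2 * (INR n + 1))) with (2 * INR n) by (field; lra).
    lra.
  - apply sums_eq with (2 * (1 - 0)); [ring|].
    apply (sums_scal 2 (fun n => / INR n - / INR (S n))).
    apply is_lim_seq_ext with (fun n => 1 - / (INR n + 1)).
    + intros n. rewrite (nsum_ext n _ (fun k => (fun i => - / INR (S i)) (S k) - (fun i => - / INR (S i)) k)).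
      * rewrite (nsum_telescope n (fun i => - / INR (S i))), S_INR. simpl. lra.
      * intros; cbv beta. ring.
    + apply is_lim_seq_minus'; [apply is_lim_seq_const|].
      replace (Finite 0) with (Rbar_inv p_infty) by reflexivity.
      apply is_lim_seq_inv; [|discriminate].
      apply (is_lim_seq_ext (fun n => INR (S n))); [intros; now rewrite S_INR|].
      apply -> (is_lim_seq_incr_1 INR). apply is_lim_seq_INR.
  - now exists l.
Qed.

Lemma sums_dom_inv_sqr (u : nat -> R) (C : R) :
  (forall n, (1 <= n)%nat -> Rabs (u n) <= C * / INR n ^ 2) -> exists l, sums u l.
Proof.
  intros H. destruct sums_inv_sqr as [s Hs].
  destruct (sums_dom u _ (C * s) H) as [l [Hl _]]; [now apply sums_scal|now exists l].
Qed.

Lemma nsum_sums_rest (u : nat -> R) (l : R) (K : nat) :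
  sums u l -> sums (fun n => u (K + n)%nat) (l - nsum K (fun k => u (S k))).
Proof.
  intros H.
  apply (is_lim_seq_ext (fun n => nsum (K + n) (fun k => u (S k)) - nsum K (fun k => u (S k)))).
  - intros n. rewrite nsum_add.
    rewrite (nsum_ext n (fun i => u (S (K + i))) (fun k => u (K + S k)%nat)); [ring|].
    intros. f_equal. lia.
  - apply is_lim_seq_minus'; [|apply is_lim_seq_const].
    apply (is_lim_seq_ext (fun n => nsum (n + K) (fun k => u (S k)))); [intros; f_equal; lia|].
    now apply (is_lim_seq_incr_n (fun n => nsum n (fun k => u (S k)))).
Qed.

(** Finitely many columns can be summed in either order, and the remaining columns contribute at
    most the tail of [B] times [sA], which tends to 0. *)
Lemma sums_exchange (u : nat -> nat -> R) (A B S' T : nat -> R) (sA sB : R) :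
  (forall n k, (1 <= n)%nat -> (1 <= k)%nat -> Rabs (u n k) <= A n * B k) ->
  sums A sA -> sums B sB ->
  (forall n, (1 <= n)%nat -> sums (u n) (S' n)) ->
  (forall k, (1 <= k)%nat -> sums (fun n => u n k) (T k)) ->
  exists l, sums S' l /\ sums T l.
Proof.
  intros Hu HA HB HS HT.
  destruct (sums_dom S' (fun n => sB * A n) (sB * sA)) as [l [Hl _]].
  - intros n Hn. apply (sums_Rabs_le (u n) (fun k => A n * B k)); auto.
    rewrite Rmult_comm. now apply sums_scal.
  - now apply sums_scal.
  - exists l. split; [exact Hl|].
    assert (Hb : forall K, Rabs (l - nsum K (fun k => T (S k)))
                   <= (sB - nsum K (fun k => B (S k))) * sA).
    { intros K.
      assert (H1 : sums (fun n => nsum K (fun k => u n (S k))) (nsum K (fun k => T (S k)))).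
      { apply (sums_nsum K (fun k n => u n (S k))). intros; apply HT; lia. }
      apply (sums_Rabs_le (fun n => S' n - nsum K (fun k => u n (S k)))
               (fun n => (sB - nsum K (fun k => B (S k))) * A n)).
      - intros n Hn.
        apply (sums_Rabs_le (fun k => u n (K + k)%nat) (fun k => A n * B (K + k)%nat)).
        + intros k Hk. apply Hu; lia.
        + apply (nsum_sums_rest (u n)). now apply HS.
        + rewrite Rmult_comm. apply sums_scal. now apply nsum_sums_rest.
      - now apply sums_minus.
      - now apply sums_scal. }
    assert (H0 : is_lim_seq (fun K => (sB - nsum K (fun k => B (S k))) * sA) 0).
    { replace 0 with ((sB - sB) * sA) by ring.
      apply is_lim_seq_mult'; [|apply is_lim_seq_const].
      apply is_lim_seq_minus'; [apply is_lim_seq_const|exact HB]. }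
    apply is_lim_seq_ext with (fun K => l - (l - nsum K (fun k => T (S k)))); [intros; ring|].
    replace (Finite l) with (Finite (l - 0)) by (f_equal; ring).
    apply is_lim_seq_minus'; [apply is_lim_seq_const|].
    apply is_lim_seq_abs_0.
    apply (is_lim_seq_le_le (fun _ => 0) _ (fun K => (sB - nsum K (fun k => B (S k))) * sA)); auto.
    + intros K. split; [apply Rabs_pos|apply Hb].
    + apply is_lim_seq_const.
Qed.

(** Side conditions of [is_derive_ext] are equalities in the carrier of a normed module; this
    restates them in [R], where [ring] applies. *)
Ltac eqR := match goal with |- @eq _ ?a ?b => change (@eq R a b) end.

(** * Bernoulli polynomials *)

(* Dividing by [n!] makes the derivative of each polynomial the previous one. *)
Definition bern (n : nat) (x : R) : R := bernpoly n x / INR (fact n).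

Lemma length_bern_list (n : nat) (x : R) : length (bern_list n x) = S n.
Proof.
  induction n as [|n IH]; [reflexivity|].
  cbn [bern_list]. rewrite length_app, IH. simpl. lia.
Qed.

Lemma nth_bern_list (n k : nat) (x : R) :
  (k <= n)%nat -> nth k (bern_list n x) 0 = bernpoly k x.
Proof.
  induction n as [|n IH]; intros H; [now replace k with 0%nat by lia|].
  destruct (Nat.eq_dec k (S n)) as [->|Hk]; [reflexivity|].
  cbn [bern_list]. rewrite app_nth1 by (rewrite length_bern_list; lia).
  apply IH. lia.
Qed.

Lemma bernpoly_rec (n : nat) (x : R) :
  bernpoly n x = x ^ n - / INR (S n) * nsum n (fun k => binomR (S n) k * bernpoly k x).
Proof.
  destruct n as [|n].
  - unfold bernpoly. simpl. rewrite nsum_0. field.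
  - unfold bernpoly at 1. cbn [bern_list].
    rewrite app_nth2 by (rewrite length_bern_list; lia).
    rewrite length_bern_list, Nat.sub_diag. cbn [nth].
    f_equal. f_equal. apply nsum_ext. intros. rewrite nth_bern_list by lia. reflexivity.
Qed.

Lemma INR_fact_pos (n : nat) : 0 < INR (fact n).
Proof. apply INR_fact_lt_0. Qed.

Lemma bern_rec (n : nat) (x : R) :
  bern n x = x ^ n / INR (fact n) - nsum n (fun k => bern k x / INR (fact (S n - k))).
Proof.
  unfold bern at 1. rewrite bernpoly_rec.
  assert (Hn := INR_fact_pos n).
  assert (HS : INR (S n) <> 0) by (apply not_0_INR; lia).
  unfold Rminus, Rdiv. rewrite Rmult_plus_distr_r. f_equal.
  rewrite Ropp_mult_distr_l_reverse. f_equal.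
  rewrite Rmult_comm, <- Rmult_assoc, <- nsum_scal.
  apply nsum_ext. intros k Hk. unfold binomR, bern.
  assert (Hk' := INR_fact_pos k). assert (Hd := INR_fact_pos (S n - k)).
  rewrite fact_simpl, mult_INR. field. lra.
Qed.

Lemma bern_0 (x : R) : bern 0 x = 1.
Proof. unfold bern, bernpoly. simpl. field. Qed.

Lemma bern_1 (x : R) : bern 1 x = x - 1 / 2.
Proof. rewrite bern_rec, nsum_S, nsum_0, bern_0. simpl. field. Qed.

Lemma bern_2 (x : R) : bern 2 x = x ^ 2 / 2 - x / 2 + 1 / 12.
Proof. rewrite bern_rec, !nsum_S, nsum_0, bern_0, bern_1. simpl. field. Qed.

Lemma is_derive_bern (n : nat) (x : R) : is_derive (bern (S n)) x (bern n x).
Proof.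
  revert x. induction n as [n IH] using lt_wf_ind. intros x.
  apply is_derive_ext with (fun t => t ^ S n / INR (fact (S n)) -
    (bern 0 t / INR (fact (S (S n))) + nsum n (fun k => bern (S k) t / INR (fact (S n - k))))).
  { intros t. rewrite (bern_rec (S n) t), nsum_first. reflexivity. }
  replace (bern n x) with
    (INR (S n) * 1 * x ^ n / INR (fact (S n)) -
     (0 + nsum n (fun k => bern k x / INR (fact (S n - k))))).
  - apply (is_derive_minus (V := R_NormedModule)).
    + apply is_derive_ext with (fun t => / INR (fact (S n)) * t ^ S n); [intros; apply Rmult_comm|].
      replace (INR (S n) * 1 * x ^ n / INR (fact (S n)))
        with (/ INR (fact (S n)) * (INR (S n) * 1 * x ^ n)) by apply Rmult_comm.
      apply (is_derive_scal (fun t => t ^ S n)).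
      apply (is_derive_pow (fun t => t) (S n) x 1), (is_derive_id (K := R_AbsRing)).
    + apply (is_derive_plus (V := R_NormedModule)).
      * apply is_derive_ext with (fun _ => 1 / INR (fact (S (S n)))); [intros; now rewrite bern_0|].
        apply (is_derive_const (V := R_NormedModule)).
      * apply (is_derive_nsum n (fun k t => bern (S k) t / INR (fact (S n - k)))
                 (fun k t => bern k t / INR (fact (S n - k)))).
        intros k Hk. unfold Rdiv.
        apply is_derive_ext with (fun t => / INR (fact (S n - k)) * bern (S k) t);
          [intros; apply Rmult_comm|].
        rewrite (Rmult_comm (bern k x)). apply (is_derive_scal (bern (S k))). now apply IH.
  - rewrite (bern_rec n x), fact_simpl, mult_INR.
    assert (Hn := INR_fact_pos n). assert (INR (S n) <> 0) by (apply not_0_INR; lia).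
    field. lra.
Qed.

(** When the recurrences at 1 and at 0 are subtracted, the induction hypothesis leaves only the term
    [k = 1] of the sum, and this term cancels [1 / n!]. *)
Lemma bern_1_0 (n : nat) : bern n 1 - bern n 0 = if Nat.eqb n 1 then 1 else 0.
Proof.
  induction n as [n IH] using lt_wf_ind.
  destruct n as [|[|n]]; [rewrite !bern_0; simpl; ring|rewrite !bern_1; simpl; field|].
  cbn [Nat.eqb].
  rewrite (bern_rec _ 1), (bern_rec _ 0), pow1, pow_ne_zero by lia.
  set (m := S (S n)) in *.
  replace (1 / INR (fact m) - nsum m (fun k => bern k 1 / INR (fact (S m - k))) -
    (0 / INR (fact m) - nsum m (fun k => bern k 0 / INR (fact (S m - k)))))
    with (1 / INR (fact m) - (nsum m (fun k => bern k 1 / INR (fact (S m - k)))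
           - nsum m (fun k => bern k 0 / INR (fact (S m - k))))) by (unfold Rdiv; ring).
  rewrite <- nsum_minus.
  rewrite (nsum_ext m _ (fun k => (if Nat.eqb k 1 then 1 else 0) / INR (fact (S m - k)))).
  2:{ intros k Hk. rewrite <- (IH k Hk). unfold Rdiv. ring. }
  unfold m. rewrite 2!nsum_first.
  rewrite nsum_zero by (intros; simpl; unfold Rdiv; ring).
  replace (S (S (S n)) - 1)%nat with (S (S n)) by lia. cbn [Nat.eqb].
  unfold Rdiv. ring.
Qed.

Lemma zero_derivative_const (f : R -> R) (x y : R) :
  (forall t, is_derive f t 0) -> f x = f y.
Proof.
  intros H. destruct (MVT_gen f y x (fun _ => 0)) as [c [_ Hc]].
  - intros; apply H.
  - intros t _. apply derivable_continuous_pt. exists 0. now apply is_derive_Reals.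
  - lra.
Qed.

(** The defect [D] of the reflection formula has derivative minus the defect of the previous order,
    so by induction [D (S n)] is constant. The next defect takes equal values at 0 and 1 by
    [bern_1_0]; by the mean value theorem its derivative, minus that constant, vanishes
    somewhere. *)
Lemma bern_reflect (n : nat) (x : R) : bern n (1 - x) = (-1) ^ n * bern n x.
Proof.
  assert (Hd : forall n t, is_derive (fun t => bern (S n) (1 - t) - (-1) ^ S n * bern (S n) t) t
            (- (bern n (1 - t) - (-1) ^ n * bern n t))).
  { intros k t.
    replace (- (bern k (1 - t) - (-1) ^ k * bern k t))
      with ((-1) * bern k (1 - t) - (-1) ^ S k * bern k t) by (simpl; ring).
    apply (is_derive_minus (V := R_NormedModule)).
    - apply (is_derive_comp (bern (S k)) (fun t => 1 - t)); [apply is_derive_bern|].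
      auto_derive; auto; ring.
    - apply (is_derive_scal (bern (S k))), is_derive_bern. }
  revert x. induction n as [|n IH]; intros x; [rewrite !bern_0; simpl; ring|].
  set (D := fun n t => bern n (1 - t) - (-1) ^ n * bern n t).
  assert (HD0 : forall t, is_derive (D (S n)) t 0).
  { intros t. replace 0 with (- (bern n (1 - t) - (-1) ^ n * bern n t)) by (rewrite IH; ring).
    apply Hd. }
  assert (Hc : forall t, D (S n) t = D (S n) 0) by (intros; now apply zero_derivative_const).
  destruct (MVT_gen (D (S (S n))) 0 1 (fun t => - D (S n) t)) as [c [_ E]].
  - intros t _. apply Hd.
  - intros t _. apply derivable_continuous_pt. exists (- D (S n) t). apply is_derive_Reals, Hd.
  - rewrite Hc in E. unfold D at 1 2 in E.
    rewrite Rminus_diag, Rminus_0_r in E.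
    assert (H1 := bern_1_0 (S (S n))). simpl Nat.eqb in H1.
    replace (bern (S (S n)) 1) with (bern (S (S n)) 0) in E by lra.
    specialize (Hc x). unfold D in Hc at 1. lra.
Qed.

Lemma bern_odd_1 (n : nat) : bern (2 * n + 3) 1 = 0.
Proof.
  assert (H := bern_reflect (2 * n + 3) 0). rewrite Rminus_0_r in H.
  assert (H1 := bern_1_0 (2 * n + 3)).
  replace (2 * n + 3)%nat with (S (S (S (2 * n)))) in * by lia. cbn [Nat.eqb] in H1.
  replace ((-1) ^ S (S (S (2 * n)))) with (-1) in H; [lra|].
  simpl pow at 1. replace (n + (n + 0))%nat with (2 * n)%nat by lia. rewrite pow_1_even. ring.
Qed.

(** * The kernel [exp (- a y) / (1 - exp (- y))] and its Laurent remainders *)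

Definition geom_kernel (y a : R) : R := exp (- (a * y)) / (1 - exp (- y)).

(** The generating function of the Bernoulli polynomials at [- y] is [y * geom_kernel y a], which
    explains the sign [(-1)^j]. After division by [y], [laurent_rem L] is the kernel without its
    Laurent terms of degrees [-1] to [L - 2]; order 0 is the bare kernel. *)
Definition bern_sum (L : nat) (y a : R) : R := nsum L (fun j => (-1) ^ j * bern j a * y ^ j).

Definition laurent_rem (L : nat) (y a : R) : R := geom_kernel y a - bern_sum L y a / y.

Lemma one_minus_exp_pos (y : R) : 0 < y -> 0 < 1 - exp (- y).
Proof. intros H. assert (exp (- y) < exp 0) by (apply exp_increasing; lra). rewrite exp_0 in *. lra. Qed.

Lemma inv_one_minus_exp_le (y : R) : 0 < y -> / (1 - exp (- y)) <= 1 + / y.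
Proof.
  intros Hy. assert (H := one_minus_exp_pos y Hy).
  assert (He := exp_ineq1_le y).
  assert (Hm : exp (- y) * exp y = 1) by (rewrite <- exp_plus, Rplus_opp_l; apply exp_0).
  assert (exp (- y) * (1 + y) <= 1) by (rewrite <- Hm; apply Rmult_le_compat_l; [left; apply exp_pos|lra]).
  apply (Rmult_le_reg_l (1 - exp (- y))); [lra|]. rewrite Rinv_r by lra.
  replace ((1 - exp (- y)) * (1 + / y)) with (((1 + y) - exp (- y) * (1 + y)) / y) by (field; lra).
  apply (Rmult_le_reg_r y); [lra|]. unfold Rdiv. rewrite Rmult_assoc, Rinv_l by lra. lra.
Qed.

Lemma geom_kernel_pos (y a : R) : 0 < y -> 0 < geom_kernel y a.
Proof. intros. apply Rdiv_lt_0_compat; [apply exp_pos|now apply one_minus_exp_pos]. Qed.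

Lemma geom_kernel_le (y a : R) : 0 < y -> geom_kernel y a <= exp (- (a * y)) * (1 + / y).
Proof.
  intros Hy. apply Rmult_le_compat_l; [left; apply exp_pos|]. now apply inv_one_minus_exp_le.
Qed.

Lemma is_derive_geom_kernel (y a : R) :
  is_derive (geom_kernel y) a (- y * geom_kernel y a).
Proof. unfold geom_kernel. auto_derive; auto. unfold Rdiv; ring. Qed.

Lemma is_derive_bern_sum (L : nat) (y a : R) :
  is_derive (bern_sum L y) a (- y * bern_sum (pred L) y a).
Proof.
  destruct L as [|L]; simpl pred.
  - unfold bern_sum. rewrite nsum_0. apply is_derive_ext with (fun _ => 0); [reflexivity|].
    replace (- y * 0) with 0 by ring. apply (is_derive_const (V := R_NormedModule)).
  - apply is_derive_ext with (fun t => 1 + nsum L (fun j => (-1) ^ S j * bern (S j) t * y ^ S j)).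
    { intros t. unfold bern_sum. rewrite nsum_first, bern_0. simpl. ring. }
    unfold bern_sum. rewrite <- nsum_scal.
    rewrite <- (Rplus_0_l (nsum _ _)).
    apply (is_derive_plus (V := R_NormedModule)); [apply (is_derive_const (V := R_NormedModule))|].
    apply (is_derive_nsum L (fun j t => (-1) ^ S j * bern (S j) t * y ^ S j)
      (fun j t => - y * ((-1) ^ j * bern j t * y ^ j))).
    intros j _.
    apply is_derive_ext with (fun t => ((-1) ^ S j * y ^ S j) * bern (S j) t); [intros; eqR; ring|].
    replace (- y * ((-1) ^ j * bern j a * y ^ j)) with (((-1) ^ S j * y ^ S j) * bern j a)
      by (simpl; ring).
    apply (is_derive_scal (bern (S j))), is_derive_bern.
Qed.

(** [pred 0 = 0] is the right convention here: the bare kernel is an eigenfunction of the derivative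
    in [a], while every positive order drops by one. *)
Lemma is_derive_laurent_rem (L : nat) (y a : R) :
  is_derive (laurent_rem L y) a (- y * laurent_rem (pred L) y a).
Proof.
  unfold laurent_rem.
  replace (- y * (geom_kernel y a - bern_sum (pred L) y a / y))
    with (- y * geom_kernel y a - / y * (- y * bern_sum (pred L) y a)) by (unfold Rdiv; ring).
  apply (is_derive_minus (V := R_NormedModule)); [apply is_derive_geom_kernel|].
  apply is_derive_ext with (fun t => / y * bern_sum L y t); [intros; apply Rmult_comm|].
  apply (is_derive_scal (bern_sum L y)), is_derive_bern_sum.
Qed.

Lemma laurent_rem_continuity (L : nat) (y a : R) : continuity_pt (laurent_rem L y) a.
Proof.
  apply derivable_continuous_pt. exists (- y * laurent_rem (pred L) y a).
  apply is_derive_Reals, is_derive_laurent_rem.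
Qed.

Lemma bern_sum_1_0 (L : nat) (y : R) : bern_sum (S (S L)) y 1 - bern_sum (S (S L)) y 0 = - y.
Proof.
  unfold bern_sum. rewrite <- nsum_minus, 2!nsum_first, !bern_0, !bern_1.
  rewrite nsum_zero; [simpl; field|].
  intros i _. assert (H := bern_1_0 (S (S i))). cbn [Nat.eqb] in H.
  replace (bern (S (S i)) 1) with (bern (S (S i)) 0) by lra. ring.
Qed.

(** From [a = 0] to [a = 1] the kernel drops by 1, and so does the subtracted part as soon as it
    contains the term with [bern 1], the only Bernoulli polynomial with a jump. *)
Lemma laurent_rem_period (L : nat) (y : R) :
  0 < y -> laurent_rem (S (S L)) y 1 = laurent_rem (S (S L)) y 0.
Proof.
  intros Hy. assert (H := bern_sum_1_0 L y). assert (H1 := one_minus_exp_pos y Hy).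
  unfold laurent_rem, geom_kernel. replace (bern_sum (S (S L)) y 1) with (bern_sum (S (S L)) y 0 - y) by lra.
  rewrite Rmult_1_l, Rmult_0_l, Ropp_0, exp_0. field. lra.
Qed.

(* The remainder of order [L >= 1] has mean zero in [a] over [0,1], as it is up to
   a factor the derivative of a periodic function; so it vanishes somewhere, and
   is bounded by its derivative, which is [- y] times the previous remainder. *)
Lemma laurent_rem_bound (L : nat) (y a : R) :
  0 < y -> 0 <= a <= 1 -> Rabs (laurent_rem L y a) <= y ^ L * (1 + / y).
Proof.
  intros Hy. revert a. induction L as [|L IH]; intros a Ha.
  - unfold laurent_rem, bern_sum. unfold Rdiv. rewrite Rmult_0_l, Rminus_0_r.
    rewrite Rabs_right by (left; now apply geom_kernel_pos).
    eapply Rle_trans; [now apply geom_kernel_le|].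
    simpl. apply Rmult_le_compat_r; [assert (0 < / y) by (now apply Rinv_0_lt_compat); lra|].
    rewrite <- exp_0. destruct (Req_dec (a * y) 0) as [->|Hn]; [rewrite Ropp_0; lra|].
    left. apply exp_increasing. assert (0 <= a * y) by (apply Rmult_le_pos; lra). lra.
  - destruct (MVT_gen (laurent_rem (S (S L)) y) 0 1 (fun t => - y * laurent_rem (S L) y t))
      as [c [Hc E]].
    + intros t _. apply is_derive_laurent_rem.
    + intros t _. apply laurent_rem_continuity.
    + rewrite laurent_rem_period, Rminus_diag in E by exact Hy.
      rewrite Rmin_left, Rmax_right in Hc by lra.
      assert (Hz : laurent_rem (S L) y c = 0).
      { assert (E' : - y * laurent_rem (S L) y c = 0) by lra.
        apply Rmult_integral in E'. lra. }
      destruct (MVT_gen (laurent_rem (S L) y) c a (fun t => - y * laurent_rem L y t))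
        as [d [Hd E2]].
      * intros t _. apply is_derive_laurent_rem.
      * intros t _. apply laurent_rem_continuity.
      * rewrite Hz, Rminus_0_r in E2. rewrite E2.
        assert (Hd' : 0 <= d <= 1).
        { revert Hd. unfold Rmin, Rmax. destruct (Rle_dec c a); lra. }
        specialize (IH d Hd').
        rewrite !Rabs_mult, Rabs_Ropp, (Rabs_right y) by lra.
        assert (Hca : Rabs (a - c) <= 1) by (apply Rabs_le; lra).
        replace (y ^ S L * (1 + / y)) with (y * (y ^ L * (1 + / y)) * 1) by (simpl; ring).
        apply Rmult_le_compat; try apply Rabs_pos; [|apply Rmult_le_compat_l; lra|exact Hca].
        apply Rmult_le_pos; [lra|apply Rabs_pos].
Qed.

(** * Trigonometric series *)

Definition freq (k : nat) : R := 2 * PI * INR k.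

Lemma freq_pos (k : nat) : (1 <= k)%nat -> 0 < freq k.
Proof.
  intros H. apply INR_pos in H. assert (H1 := PI_RGT_0).
  apply Rmult_lt_0_compat; lra.
Qed.

Lemma INR_le_freq (k : nat) : INR k <= freq k.
Proof.
  assert (H := PI2_1). assert (H0 := pos_INR k).
  rewrite <- (Rmult_1_l (INR k)) at 1. apply Rmult_le_compat_r; lra.
Qed.

Lemma inv_freq_pow_le (p k : nat) : (1 <= k)%nat -> (2 <= p)%nat -> / freq k ^ p <= / INR k ^ 2.
Proof.
  intros Hk Hp. assert (H1 := INR_pos k Hk). assert (H2 := INR_le_freq k).
  apply Rinv_le_contravar; [apply pow_lt; lra|].
  apply Rle_trans with (INR k ^ p); [apply Rle_pow; lra || lia|].
  apply pow_incr. lra.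
Qed.

Lemma is_derive_continuity_pt (f : R -> R) (x l : R) : is_derive f x l -> continuity_pt f x.
Proof. intros H. apply derivable_continuous_pt. exists l. now apply is_derive_Reals. Qed.

Lemma dirichlet_kernel (K : nat) (t : R) :
  2 * sin (PI * t) * nsum K (fun k => cos (freq (S k) * t)) =
  sin ((2 * INR K + 1) * PI * t) - sin (PI * t).
Proof.
  induction K as [|K IH].
  - rewrite nsum_0. simpl INR. replace ((2 * 0 + 1) * PI * t) with (PI * t) by ring. ring.
  - rewrite nsum_S, Rmult_plus_distr_l, IH.
    unfold freq. rewrite S_INR.
    replace ((2 * (INR K + 1) + 1) * PI * t) with (2 * PI * (INR K + 1) * t + PI * t) by ring.
    replace ((2 * INR K + 1) * PI * t) with (2 * PI * (INR K + 1) * t - PI * t) by ring.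
    rewrite sin_plus, sin_minus. ring.
Qed.

(* The derivative of the partial sums of [sum cos (b t) / b^2] is, up to [O(1/K)],
   that of [(t - 1/2)^2 / 4]: the difference has derivative
   [- sin (l t) / (2 sin (pi t))] with [l = (2 K + 1) pi], which an
   integration by parts turns into [O(1/l)]. *)
Lemma sawtooth_partial_sum (K : nat) (a t : R) :
  0 < a -> a <= t <= 1 / 2 ->
  Rabs (nsum K (fun k => - sin (freq (S k) * t) / freq (S k)) - (t - 1 / 2) / 2)
  <= (1 / sin (PI * a) + PI / sin (PI * a) ^ 2) / ((2 * INR K + 1) * PI).
Proof.
  intros Ha Ht.
  set (l := (2 * INR K + 1) * PI).
  assert (HPI := PI_RGT_0). assert (HK := pos_INR K).
  assert (Hl : 0 < l) by (apply Rmult_lt_0_compat; lra).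
  set (sg := sin (PI * a)).
  assert (Hsg : 0 < sg).
  { apply sin_gt_0; [apply Rmult_lt_0_compat; lra|].
    rewrite <- (Rmult_1_r PI) at 2. apply Rmult_lt_compat_l; lra. }
  assert (Hs : forall u, a <= u <= 1 / 2 -> sg <= sin (PI * u)).
  { intros u Hu.
    assert (PI * a <= PI * u) by (apply Rmult_le_compat_l; lra).
    assert (PI * u <= PI * (1/2)) by (apply Rmult_le_compat_l; lra).
    assert (0 < PI * a) by (apply Rmult_lt_0_compat; lra).
    apply sin_incr_1; lra. }
  set (e := fun u => nsum K (fun k => - sin (freq (S k) * u) / freq (S k)) - (u - 1 / 2) / 2).
  set (h := fun u => cos (l * u) / (2 * l * sin (PI * u))).
  set (d := fun u => cos (l * u) * PI * cos (PI * u) / (2 * l * sin (PI * u) ^ 2)).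
  assert (Hd : forall u, a <= u <= 1 / 2 -> is_derive (fun u => e u - h u) u (d u)).
  { intros u Hu. specialize (Hs u Hu).
    assert (He : is_derive e u (- sin (l * u) / (2 * sin (PI * u)))).
    { replace (- sin (l * u) / (2 * sin (PI * u)))
        with (nsum K (fun k => -1 * cos (freq (S k) * u)) - 1 / 2).
      - apply (is_derive_minus (V := R_NormedModule)).
        + apply (is_derive_nsum K (fun k u => - sin (freq (S k) * u) / freq (S k))
            (fun k u => -1 * cos (freq (S k) * u))).
          intros k _. assert (0 < freq (S k)) by (apply freq_pos; lia).
          auto_derive; auto. field. lra.
        + auto_derive; auto; field.
      - rewrite nsum_scal. assert (HD := dirichlet_kernel K u). fold l in HD.
        apply (Rmult_eq_reg_l (2 * sin (PI * u))); [|lra].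
        replace (2 * sin (PI * u) * (- sin (l * u) / (2 * sin (PI * u)))) with (- sin (l * u)) by (field; lra).
        replace (sin (l * u)) with (2 * sin (PI * u) * nsum K (fun k => cos (freq (S k) * u)) + sin (PI * u)) by lra.
        field. }
    replace (d u) with (- sin (l * u) / (2 * sin (PI * u)) -
       (- sin (l * u) / (2 * sin (PI * u)) - d u)) by ring.
    apply (is_derive_minus (V := R_NormedModule)); [exact He|].
    unfold h. auto_derive.
    - repeat split; auto. apply Rgt_not_eq. apply Rmult_lt_0_compat; lra.
    - unfold d. field. repeat split; lra. }
  assert (Hhb : forall u, a <= u <= 1 / 2 -> Rabs (h u) <= / (2 * l * sg)).
  { intros u Hu. specialize (Hs u Hu). unfold h, Rdiv.
    rewrite Rabs_mult, <- (Rmult_1_l (/ (2 * l * sg))).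
    apply Rmult_le_compat; try apply Rabs_pos.
    - apply Rabs_le. apply COS_bound.
    - rewrite Rabs_right.
      + apply Rinv_le_contravar; [apply Rmult_lt_0_compat; lra|].
        apply Rmult_le_compat_l; lra.
      + apply Rle_ge, Rlt_le, Rinv_0_lt_compat, Rmult_lt_0_compat; lra. }
  assert (Hdb : forall u, a <= u <= 1 / 2 -> Rabs (d u) <= PI / (2 * l * sg ^ 2)).
  { intros u Hu. specialize (Hs u Hu). unfold d, Rdiv.
    rewrite !Rabs_mult, (Rabs_right PI) by lra.
    replace (PI * / (2 * l * sg ^ 2)) with (1 * PI * 1 * / (2 * l * sg ^ 2)) by ring.
    assert (0 < sg ^ 2) by (apply pow_lt; lra).
    assert (sg ^ 2 <= sin (PI * u) ^ 2) by (apply pow_incr; lra).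
    assert (X1 : Rabs (cos (l * u)) <= 1) by apply Rabs_le, COS_bound.
    assert (X2 : Rabs (cos (PI * u)) <= 1) by apply Rabs_le, COS_bound.
    assert (X3 : Rabs (/ (2 * l * sin (PI * u) ^ 2)) <= / (2 * l * sg ^ 2)).
    { rewrite Rabs_right.
      - apply Rinv_le_contravar; [apply Rmult_lt_0_compat; lra|].
        apply Rmult_le_compat_l; lra.
      - apply Rle_ge, Rlt_le, Rinv_0_lt_compat, Rmult_lt_0_compat; lra. }
    assert (Y1 := Rabs_pos (cos (l * u))). assert (Y2 := Rabs_pos (cos (PI * u))).
    assert (Y3 := Rabs_pos (/ (2 * l * sin (PI * u) ^ 2))).
    assert (Y4 : 0 <= Rabs (cos (l * u)) * PI) by (apply Rmult_le_pos; lra).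
    assert (Y5 : Rabs (cos (l * u)) * PI <= 1 * PI) by (apply Rmult_le_compat_r; lra).
    apply Rmult_le_compat; auto; [now apply Rmult_le_pos|].
    now apply Rmult_le_compat. }
  (* The mean value theorem is anchored at [1 / 2], where every sine is taken at a multiple of [PI]
     and the sawtooth vanishes too. *)
  assert (He0 : e (1 / 2) = 0).
  { unfold e. rewrite nsum_zero; [field|]. intros k _.
    replace (freq (S k) * (1 / 2)) with (IZR (Z.of_nat (S k)) * PI)
      by (unfold freq; rewrite INR_IZR_INZ; field).
    rewrite sin_eq_0_1 by (now exists (Z.of_nat (S k))). unfold Rdiv. ring. }
  destruct (MVT_gen (fun u => e u - h u) t (1 / 2) d) as [c [Hc E]].
  { intros u Hu. rewrite Rmin_left, Rmax_right in Hu by lra. apply Hd. lra. }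
  { intros u Hu. rewrite Rmin_left, Rmax_right in Hu by lra.
    eapply is_derive_continuity_pt. apply Hd. lra. }
  rewrite Rmin_left, Rmax_right in Hc by lra.
  change (Rabs (e t) <= (1 / sg + PI / sg ^ 2) / l).
  assert (Ee : e t = h t - h (1 / 2) - d c * (1 / 2 - t)) by lra.
  rewrite Ee.
  assert (B1 := Hhb t Ht). assert (B2 := Hhb (1/2) ltac:(lra)). assert (B3 := Hdb c ltac:(lra)).
  assert (B4 : Rabs (d c * (1 / 2 - t)) <= PI / (2 * l * sg ^ 2) * 1).
  { rewrite Rabs_mult. apply Rmult_le_compat; try apply Rabs_pos; auto.
    apply Rabs_le. lra. }
  assert (B5 : 0 <= PI / (2 * l * sg ^ 2)).
  { eapply Rle_trans; [|exact B3]. apply Rabs_pos. }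
  replace ((1 / sg + PI / sg ^ 2) / l) with (/ (2 * l * sg) + / (2 * l * sg) + 2 * (PI / (2 * l * sg ^ 2)))
    by (field; lra).
  eapply Rle_trans; [apply Rabs_triang|]. rewrite Rabs_Ropp.
  assert (Rabs (h t - h (1/2)) <= Rabs (h t) + Rabs (h (1/2))).
  { eapply Rle_trans; [apply Rabs_triang|]. rewrite Rabs_Ropp. lra. }
  lra.
Qed.

Definition cos_series (a : R) : R := series1 (fun k => cos (freq k * a) / freq k ^ 2).

Lemma Rabs_trig_div_le (x y : R) : Rabs x <= 1 -> 0 < y -> Rabs (x / y) <= / y.
Proof.
  intros Hx Hy. unfold Rdiv. rewrite Rabs_mult, (Rabs_right (/ y)).
  - rewrite <- (Rmult_1_l (/ y)) at 2. apply Rmult_le_compat_r; auto.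
    left. now apply Rinv_0_lt_compat.
  - left. now apply Rinv_0_lt_compat.
Qed.

Lemma sums_cos_pow (p : nat) (a : R) :
  (2 <= p)%nat -> exists l, sums (fun k => cos (freq k * a) / freq k ^ p) l.
Proof.
  intros Hp. apply (sums_dom_inv_sqr _ 1). intros n Hn. assert (H := freq_pos n Hn).
  eapply Rle_trans; [apply Rabs_trig_div_le; [apply Rabs_le, COS_bound|now apply pow_lt]|].
  rewrite Rmult_1_l. now apply inv_freq_pow_le.
Qed.

Lemma sums_sin_pow (p : nat) (a : R) :
  (2 <= p)%nat -> exists l, sums (fun k => sin (freq k * a) / freq k ^ p) l.
Proof.
  intros Hp. apply (sums_dom_inv_sqr _ 1). intros n Hn. assert (H := freq_pos n Hn).
  eapply Rle_trans; [apply Rabs_trig_div_le; [apply Rabs_le, SIN_bound|now apply pow_lt]|].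
  rewrite Rmult_1_l. now apply inv_freq_pow_le.
Qed.

Lemma sums_cos_series (a : R) : sums (fun k => cos (freq k * a) / freq k ^ 2) (cos_series a).
Proof.
  destruct (sums_cos_pow 2 a) as [l Hl]; [lia|].
  unfold cos_series. now rewrite (sums_series1 _ _ Hl).
Qed.

Lemma is_lim_seq_inv_linear (C : R) : is_lim_seq (fun K => C / ((2 * INR K + 1) * PI)) 0.
Proof.
  replace (Finite 0) with (Finite (C * 0)) by (f_equal; ring).
  apply is_lim_seq_scal_l with (lu := 0).
  replace (Finite 0) with (Rbar_inv p_infty) by reflexivity.
  apply is_lim_seq_inv; [|discriminate].
  apply (is_lim_seq_le_p_loc INR); [|apply is_lim_seq_INR].
  exists 0%nat. intros n _. assert (H := pos_INR n). assert (H1 := PI2_1).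
  apply Rle_trans with ((2 * INR n + 1) * 1); [lra|]. apply Rmult_le_compat_l; lra.
Qed.

(** The difference of the partial sum and the quadratic has derivative [O(1/K)] uniformly on
    [[a, 1/2]], so in the limit its values at [a] and [1/2] agree. The value at [1/2] is still
    unknown here. *)
Lemma cos_series_half (a : R) :
  0 < a <= 1 / 2 -> cos_series a = cos_series (1 / 2) + (a - 1 / 2) ^ 2 / 4.
Proof.
  intros Ha.
  set (F := fun K t => nsum K (fun k => cos (freq (S k) * t) / freq (S k) ^ 2)).
  set (C := 1 / sin (PI * a) + PI / sin (PI * a) ^ 2).
  assert (Hb : forall K, Rabs ((F K a - F K (1/2)) - (a - 1/2)^2 / 4) <= C / ((2 * INR K + 1) * PI)).
  { intros K.
    destruct (MVT_gen (fun t => F K t - (t - 1/2)^2/4) a (1/2)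
      (fun t => nsum K (fun k => - sin (freq (S k) * t) / freq (S k)) - (t - 1 / 2) / 2)) as [c [Hc E]].
    - intros t _. apply (is_derive_minus (V := R_NormedModule)).
      + apply (is_derive_nsum K (fun k t => cos (freq (S k) * t) / freq (S k) ^ 2)
                (fun k t => - sin (freq (S k) * t) / freq (S k))).
        intros k _. assert (0 < freq (S k)) by (apply freq_pos; lia).
        auto_derive; auto. field. lra.
      + auto_derive; auto. field.
    - intros t _. apply (is_derive_continuity_pt _ t
        (nsum K (fun k => - sin (freq (S k) * t) / freq (S k)) - (t - 1 / 2) / 2)).
      apply (is_derive_minus (V := R_NormedModule)).
      + apply (is_derive_nsum K (fun k t => cos (freq (S k) * t) / freq (S k) ^ 2)
                (fun k t => - sin (freq (S k) * t) / freq (S k))).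
        intros k _. assert (0 < freq (S k)) by (apply freq_pos; lia).
        auto_derive; auto. field. lra.
      + auto_derive; auto. field.
    - rewrite Rmin_left, Rmax_right in Hc by lra.
      assert (B := sawtooth_partial_sum K a c ltac:(lra) Hc).
      replace (F K a - F K (1/2) - (a - 1/2)^2/4) with
        (- ((F K (1/2) - (1/2 - 1/2)^2/4) - (F K a - (a - 1/2)^2/4))) by (cbn; field).
      rewrite E, Rabs_Ropp, Rabs_mult, <- (Rmult_1_r (C / _)).
      apply Rmult_le_compat; try apply Rabs_pos; [exact B|]. apply Rabs_le; lra. }
  assert (HL : is_lim_seq (fun K => (F K a - F K (1/2)) - (a - 1/2)^2 / 4)
                (cos_series a - cos_series (1/2) - (a - 1/2)^2/4)).
  { apply is_lim_seq_minus'; [|apply is_lim_seq_const].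
    apply is_lim_seq_minus'; apply sums_cos_series. }
  assert (H0 : is_lim_seq (fun K => (F K a - F K (1/2)) - (a - 1/2)^2 / 4) 0).
  { apply is_lim_seq_abs_0.
    apply (is_lim_seq_le_le (fun _ => 0) _ (fun K => C / ((2 * INR K + 1) * PI))).
    - intros K. split; [apply Rabs_pos|apply Hb].
    - apply is_lim_seq_const.
    - apply is_lim_seq_inv_linear. }
  assert (E := is_lim_seq_unique _ _ HL). rewrite (is_lim_seq_unique _ _ H0) in E.
  injection E as E. lra.
Qed.

Lemma cos_series_reflect (a : R) : cos_series (1 - a) = cos_series a.
Proof.
  apply sums_series1. eapply sums_ext; [|apply sums_cos_series].
  intros k _. f_equal.
  replace (freq k * (1 - a)) with (- (freq k * a) + 2 * INR k * PI) by (unfold freq; ring).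
  now rewrite cos_period, cos_neg.
Qed.

Lemma sums_even (u : nat -> R) (l : R) :
  (forall k, u (2 * k + 1)%nat = 0) -> sums u l -> sums (fun k => u (2 * k)%nat) l.
Proof.
  intros H Hu.
  apply (is_lim_seq_ext (fun n => nsum (2 * n) (fun k => u (S k)))).
  - induction n as [|n IH]; [reflexivity|].
    replace (2 * S n)%nat with (S (S (2 * n))) by lia.
    rewrite 2!nsum_S, IH, nsum_S. replace (S (2 * n)) with (2 * n + 1)%nat by lia.
    rewrite H. replace (2 * S n)%nat with (S (2 * n + 1)) by lia. ring.
  - apply (is_lim_seq_subseq (fun n => nsum n (fun k => u (S k))) l (fun n => (2 * n)%nat)); [|exact Hu].
    apply eventually_subseq. intros; lia.
Qed.

(** In the sum of the two series the odd frequencies cancel, because their arguments differ by an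
    odd multiple of [PI], and the even ones double. *)
Lemma cos_series_duplication (a : R) :
  cos_series (a / 2) + cos_series ((a + 1) / 2) = cos_series a / 2.
Proof.
  assert (H := sums_plus _ _ _ _ (sums_cos_series (a / 2)) (sums_cos_series ((a + 1) / 2))).
  apply sums_even in H.
  - apply (sums_unique _ _ _ H).
    replace (cos_series a / 2) with (/ 2 * cos_series a) by field.
    eapply sums_ext; [|apply sums_scal, sums_cos_series].
    intros k Hk. assert (H0 := freq_pos k Hk).
    assert (E : freq (2 * k) = 2 * freq k) by (unfold freq; rewrite mult_INR; simpl INR; ring).
    rewrite E.
    replace (2 * freq k * (a / 2)) with (freq k * a) by field.
    replace (2 * freq k * ((a + 1) / 2)) with (freq k * a + 2 * INR k * PI) by (unfold freq; field).
    rewrite cos_period. field. lra.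
  - intros k.
    replace (freq (2 * k + 1) * ((a + 1) / 2)) with (freq (2 * k + 1) * (a / 2) + PI + 2 * INR k * PI)
      by (unfold freq; rewrite plus_INR, mult_INR; simpl INR; field).
    rewrite cos_period, neg_cos. unfold Rdiv. ring.
Qed.

(** [cos_series_half] leaves one unknown, the value at [1/2]; duplication determines it. Duplication
    at 0 then gives the endpoint, and reflection covers [a > 1/2]. *)
Lemma sums_cos_sqr (a : R) :
  0 <= a <= 1 -> sums (fun k => cos (freq k * a) / freq k ^ 2) (bern 2 a / 2).
Proof.
  intros Ha.
  (* Duplication at [1/2] involves [1/4] and [3/4], which reflection identifies; with the quadratic
     formula at [1/4] it is a linear equation for the value at [1/2]. *)
  assert (E2 : cos_series (1/2) = - / 48).
  { assert (H := cos_series_duplication (1 / 2)).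
    replace ((1/2 + 1)/2) with (1 - 1/2/2) in H by field.
    rewrite cos_series_reflect, cos_series_half in H by lra. lra. }
  assert (Eh : forall a, 0 < a <= 1/2 -> cos_series a = bern 2 a / 2).
  { intros b Hb. rewrite cos_series_half, E2, bern_2 by lra. field. }
  assert (E0 : cos_series 0 = bern 2 0 / 2).
  { assert (H := cos_series_duplication 0).
    replace (0/2) with 0 in H by field. replace ((0+1)/2) with (1/2) in H by field.
    rewrite bern_2. lra. }
  assert (Hall : cos_series a = bern 2 a / 2).
  { assert (Hh : forall b, 0 <= b <= 1/2 -> cos_series b = bern 2 b / 2).
    { intros b Hb. destruct (Req_dec b 0) as [->|Hn]; [exact E0|]. apply Eh; lra. }
    destruct (Rle_dec a (1/2)); [apply Hh; lra|].
    rewrite <- cos_series_reflect, Hh, bern_reflect by lra. field. }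
  rewrite <- Hall. apply sums_cos_series.
Qed.

Lemma sums_CVU (g : nat -> R -> R) (A : nat -> R) (sA : R) :
  (forall k x, (1 <= k)%nat -> Rabs (g k x) <= A k) -> sums A sA ->
  CVU_dom (fun n x => nsum n (fun k => g (S k) x)) (fun _ => True).
Proof.
  intros Hg HA eps.
  apply is_lim_seq_spec in HA. destruct (HA eps) as [N HN].
  exists N. intros n Hn x _.
  destruct (sums_dom (fun k => g k x) A sA (fun k Hk => Hg k x Hk)) as [l [Hl _]];
    [now apply is_lim_seq_spec|].
  rewrite (is_lim_seq_unique _ _ Hl).
  specialize (HN n Hn).
  rewrite Rabs_minus_sym in HN |- *.
  eapply Rle_lt_trans; [|eapply Rle_lt_trans; [apply Rle_abs|exact HN]].
  apply (sums_Rabs_le (fun k => g (n + k)%nat x) (fun k => A (n + k)%nat)).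
  - intros k Hk. apply Hg. lia.
  - now apply (nsum_sums_rest (fun k => g k x)).
  - apply nsum_sums_rest. now apply is_lim_seq_spec.
Qed.

(** Termwise differentiation: the single majorant [A] makes both the series and the series of
    derivatives converge uniformly on the whole line. *)
Lemma is_derive_series1 (g dg : nat -> R -> R) (A : nat -> R) (sA : R) (x : R) :
  (forall k x, (1 <= k)%nat -> Rabs (g k x) <= A k) ->
  (forall k x, (1 <= k)%nat -> Rabs (dg k x) <= A k) -> sums A sA ->
  (forall k x, (1 <= k)%nat -> is_derive (g k) x (dg k x)) ->
  (forall k x, (1 <= k)%nat -> continuity_pt (dg k) x) ->
  is_derive (fun y => series1 (fun k => g k y)) x (series1 (fun k => dg k x)).
Proof.
  intros Hg Hdg HA Hd Hc.
  set (fn := fun n y => nsum n (fun k => g (S k) y)).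
  set (dfn := fun n y => nsum n (fun k => dg (S k) y)).
  assert (Hfn : forall n y, is_derive (fn n) y (dfn n y)).
  { intros n y. apply (is_derive_nsum n (fun k => g (S k)) (fun k => dg (S k))).
    intros; apply Hd; lia. }
  assert (HE : forall h : nat -> R -> R, (forall k x, (1 <= k)%nat -> Rabs (h k x) <= A k) ->
    forall y, real (Lim_seq (fun n => nsum n (fun k => h (S k) y))) = series1 (fun k => h k y)).
  { intros h Hh y. destruct (sums_dom (fun k => h k y) A sA (fun k Hk => Hh k y Hk) HA) as [l [Hl _]].
    rewrite (is_lim_seq_unique _ _ Hl). now rewrite (sums_series1 _ _ Hl). }
  assert (Hdfn : forall n y, Derive (fn n) y = dfn n y) by (intros; now apply is_derive_unique).
  apply (is_derive_ext (fun y => real (Lim_seq (fun n => fn n y)))).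
  { intros y. now apply HE. }
  rewrite <- (HE dg Hdg x).
  rewrite (Lim_seq_ext _ (fun n => Derive (fn n) x)) by (intros; now rewrite Hdfn).
  apply (CVU_Derive fn (fun _ => True)); auto.
  - apply open_true.
  - intros u v w _ _ _. exact I.
  - now apply (sums_CVU g A sA).
  - intros n y _. now exists (dfn n y).
  - intros n y _. apply (continuity_pt_ext (dfn n)); [intros; now rewrite Hdfn|].
    unfold dfn. induction n as [|n IH].
    + apply continuity_pt_const. now intros ? ?.
    + apply (continuity_pt_ext (fun y => nsum n (fun k => dg (S k) y) + dg (S n) y));
        [intros; now rewrite nsum_S|].
      apply continuity_pt_plus; [exact IH|apply Hc; lia].
  - intros eps. destruct (sums_CVU dg A sA Hdg HA eps) as [N HN]. exists N.
    intros n Hn y _. specialize (HN n Hn y I).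
    rewrite (Lim_seq_ext _ (fun n => dfn n y)) by (intros; now rewrite Hdfn).
    rewrite Hdfn. exact HN.
Qed.

(** * Complex-valued series *)

Definition csums (u : nat -> C) (l : C) : Prop :=
  sums (fun k => Re (u k)) (Re l) /\ sums (fun k => Im (u k)) (Im l).

Lemma csums_ext (u v : nat -> C) (l : C) :
  (forall n, (1 <= n)%nat -> u n = v n) -> csums u l -> csums v l.
Proof.
  intros H [H1 H2]. split; [eapply sums_ext; [|exact H1]|eapply sums_ext; [|exact H2]];
    intros n Hn; cbv beta; now rewrite H.
Qed.

Lemma csums_scal (c : C) (u : nat -> C) (l : C) :
  csums u l -> csums (fun n => c * u n)%C (c * l)%C.
Proof.
  intros [H1 H2]. split; simpl.
  - apply sums_minus; now apply sums_scal.
  - apply sums_plus; now apply sums_scal.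
Qed.

Lemma csums_minus (u v : nat -> C) (l l' : C) :
  csums u l -> csums v l' -> csums (fun n => u n - v n)%C (l - l')%C.
Proof. intros [H1 H2] [H3 H4]. split; simpl; now apply sums_minus. Qed.

Lemma csums_RtoC (u : nat -> R) (l : R) : sums u l -> csums (fun n => RtoC (u n)) (RtoC l).
Proof. intros H. split; [exact H|apply sums_zero]. Qed.

Lemma csums_unique (u : nat -> C) (l l' : C) : csums u l -> csums u l' -> l = l'.
Proof.
  intros [H1 H2] [H3 H4]. apply injective_projections.
  - exact (sums_unique _ _ _ H1 H3).
  - exact (sums_unique _ _ _ H2 H4).
Qed.

Lemma im_le_Cmod (z : C) : Rabs (Im z) <= Cmod z.
Proof. eapply Rle_trans; [apply Rmax_r|apply (Rmax_Cmod z)]. Qed.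

Lemma Cmod_sqr (z : C) : Cmod z ^ 2 = Re z ^ 2 + Im z ^ 2.
Proof.
  unfold Cmod. rewrite pow2_sqrt; [reflexivity|].
  apply Rplus_le_le_0_compat; apply pow2_ge_0.
Qed.

(* [|z^2 + b^2|^2 = (b^2 - |z|^2)^2 + 4 (Re z)^2 b^2]. *)
Lemma Cmod_sqr_plus_sqr (z : C) (b : R) :
  0 < Re z -> (Re z / Cmod z) * b ^ 2 <= Cmod (z * z + RtoC (b ^ 2)).
Proof.
  intros Hz.
  assert (H1 := Cmod_sqr z). assert (H2 := Cmod_sqr (z * z + RtoC (b ^ 2))%C).
  assert (Hr : Re z <= Cmod z) by (eapply Rle_trans; [apply Rle_abs|apply re_le_Cmod]).
  set (r := Cmod z) in *. set (X := Cmod (z * z + RtoC (b ^ 2))) in *.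
  assert (HX : 0 <= X) by apply Cmod_ge_0.
  set (x := Re z) in *.
  set (s := x / r).
  assert (Hs : 0 <= s <= 1).
  { split; [left; apply Rdiv_lt_0_compat; lra|].
    apply (Rmult_le_reg_r r); [lra|]. unfold s, Rdiv. rewrite Rmult_assoc, Rinv_l by lra. lra. }
  assert (Hxs : x = s * r) by (unfold s; field; lra).
  assert (E : X ^ 2 = (b ^ 2 - r ^ 2) ^ 2 + 4 * x ^ 2 * b ^ 2).
  { rewrite H2, H1. unfold x. destruct z as [u v]. simpl. ring. }
  apply Rsqr_incr_0_var; [|exact HX].
  unfold Rsqr. replace (X * X) with (X ^ 2) by ring. rewrite E, Hxs.
  (* the difference is a sum of squares once the weight [1 - s^2] is split off *)
  assert (Hq : 0 <= (1 - s * s) * (b ^ 2 - r ^ 2) ^ 2).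
  { apply Rmult_le_pos; [|apply pow2_ge_0]. nra. }
  assert (Hq2 : 0 <= s * s * (r ^ 2 + b ^ 2) ^ 2 - (s * b ^ 2) * (s * b ^ 2)).
  { nra. }
  lra.
Qed.

Lemma Cmod_Cexp (z : C) : Cmod (Cexp z) = exp (Re z).
Proof.
  assert (H : Cmod (Cexp z) ^ 2 = exp (Re z) ^ 2).
  { rewrite Cmod_sqr. simpl Re. simpl Im.
    assert (H := sin2_cos2 (Im z)). unfold Rsqr in H.
    replace ((exp (Re z) * cos (Im z)) ^ 2 + (exp (Re z) * sin (Im z)) ^ 2)
      with (exp (Re z) ^ 2 * (sin (Im z) * sin (Im z) + cos (Im z) * cos (Im z))) by ring.
    rewrite H. ring. }
  assert (H1 := Cmod_ge_0 (Cexp z)). assert (H2 := exp_pos (Re z)).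
  apply Rsqr_inj; unfold Rsqr; lra || nra.
Qed.

Lemma Cexp_neq_1 (z : C) : 0 < Re z -> (Cexp z - 1)%C <> 0.
Proof.
  intros Hz E.
  assert (E' : Cexp z = RtoC 1).
  { replace (Cexp z) with ((Cexp z - 1) + 1)%C by ring. rewrite E. ring. }
  assert (H := Cmod_Cexp z). rewrite E', Cmod_1 in H.
  assert (exp 0 < exp (Re z)) by (now apply exp_increasing). rewrite exp_0 in *. lra.
Qed.

Lemma C_neq_0_Re (z : C) : Re z <> 0 -> z <> 0.
Proof. intros H E. apply H. now rewrite E. Qed.

(** * Partial fractions of [exp (- a z) / (1 - exp (- z))] *)

Definition ode_coef (z : C) (k : nat) : C :=
  (2 / (RtoC (freq k ^ 2) * (z * z + RtoC (freq k ^ 2))))%C.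

(** For real [z = y] this is [fourier_term 1 y a k]; complex [z] is needed later, at multiples of
    the roots occurring in the partial fractions. [ode_dterm] is its derivative in [a]. *)
Definition ode_term (z : C) (a : R) (k : nat) : C :=
  (z * ode_coef z k * RtoC (cos (freq k * a)) + RtoC (freq k) * ode_coef z k * RtoC (sin (freq k * a)))%C.

Definition ode_dterm (z : C) (a : R) (k : nat) : C :=
  (RtoC (freq k) * (RtoC (freq k) * ode_coef z k * RtoC (cos (freq k * a))
                    - z * ode_coef z k * RtoC (sin (freq k * a))))%C.

Lemma sqr_plus_sqr_neq_0 (z : C) (b : R) :
  0 < Re z -> 0 < b -> (z * z + RtoC (b ^ 2))%C <> 0.
Proof.
  intros Hz Hb E. assert (H := Cmod_sqr_plus_sqr z b Hz). rewrite E, Cmod_0 in H.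
  assert (H1 : Re z <= Cmod z) by (eapply Rle_trans; [apply Rle_abs|apply re_le_Cmod]).
  assert (0 < Re z / Cmod z * b ^ 2); [|lra].
  apply Rmult_lt_0_compat; [apply Rdiv_lt_0_compat; lra|now apply pow_lt].
Qed.

Lemma RtoC_neq_0 (x : R) : x <> 0 -> RtoC x <> 0.
Proof. intros H E. apply H. now injection E. Qed.

Lemma Cmod_ode_coef (z : C) (k : nat) :
  0 < Re z -> (1 <= k)%nat -> Cmod (ode_coef z k) <= 2 * (Cmod z / Re z) / freq k ^ 4.
Proof.
  intros Hz Hk. assert (Hb := freq_pos k Hk).
  assert (H1 : Re z <= Cmod z) by (eapply Rle_trans; [apply Rle_abs|apply re_le_Cmod]).
  assert (H := Cmod_sqr_plus_sqr z (freq k) Hz).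
  assert (Hn := sqr_plus_sqr_neq_0 z (freq k) Hz Hb).
  assert (Hb2 : 0 < freq k ^ 2) by now apply pow_lt.
  assert (Hn2 : RtoC (freq k ^ 2) <> 0) by (apply RtoC_neq_0; lra).
  unfold ode_coef, Cdiv. rewrite Cmod_mult, Cmod_inv, Cmod_mult, !Cmod_R
    by now apply Cmult_neq_0.
  rewrite (Rabs_right 2), (Rabs_right (freq k ^ 2)) by lra.
  assert (0 < Re z / Cmod z * freq k ^ 2).
  { apply Rmult_lt_0_compat; [apply Rdiv_lt_0_compat; lra|auto]. }
  replace (2 * (Cmod z / Re z) / freq k ^ 4) with (2 * / (freq k ^ 2 * (Re z / Cmod z * freq k ^ 2)))
    by (field; lra).
  apply Rmult_le_compat_l; [lra|]. apply Rinv_le_contravar.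
  - now apply Rmult_lt_0_compat.
  - apply Rmult_le_compat_l; lra.
Qed.

Lemma Cmod_RtoC_le_1 (w : C) (x : R) : Rabs x <= 1 -> Cmod (w * RtoC x) <= Cmod w.
Proof.
  intros Hx. rewrite Cmod_mult, Cmod_R. rewrite <- (Rmult_1_r (Cmod w)) at 2.
  apply Rmult_le_compat_l; [apply Cmod_ge_0|exact Hx].
Qed.

Definition ode_bound (z : C) : R := 2 * (Cmod z / Re z) * (Cmod z + 1).

Lemma freq_ge_1 (k : nat) : (1 <= k)%nat -> 1 <= freq k.
Proof. intros Hk. assert (H := INR_pos k Hk). assert (H' := INR_le_freq k). lra. Qed.

Lemma ode_term_bounds (z : C) (a : R) (k : nat) :
  0 < Re z -> (1 <= k)%nat ->
  Cmod (ode_term z a k) <= ode_bound z * / INR k ^ 2 /\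
  Cmod (ode_dterm z a k) <= ode_bound z * / INR k ^ 2.
Proof.
  intros Hz Hk. assert (Hb := freq_ge_1 k Hk). assert (Hc := Cmod_ode_coef z k Hz Hk).
  assert (H1 : Re z <= Cmod z) by (eapply Rle_trans; [apply Rle_abs|apply re_le_Cmod]).
  set (D := 2 * (Cmod z / Re z)) in *.
  assert (HD : 0 < D) by (apply Rmult_lt_0_compat; [|apply Rdiv_lt_0_compat]; lra).
  assert (Hi : forall w v : C, Cmod w <= freq k * Cmod z * Cmod (ode_coef z k) ->
     Cmod v <= freq k * freq k * Cmod (ode_coef z k) ->
     Cmod w + Cmod v <= ode_bound z * / INR k ^ 2).
  { intros w v Hw Hv. apply Rle_trans with (ode_bound z * / freq k ^ 2).
    - unfold ode_bound. fold D.
      assert (Hw' : Cmod w <= freq k * Cmod z * (D / freq k ^ 4)).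
      { eapply Rle_trans; [exact Hw|]. apply Rmult_le_compat_l; [apply Rmult_le_pos; lra|exact Hc]. }
      assert (Hv' : Cmod v <= freq k * freq k * (D / freq k ^ 4)).
      { eapply Rle_trans; [exact Hv|]. apply Rmult_le_compat_l; [apply Rmult_le_pos; lra|exact Hc]. }
      replace (D * (Cmod z + 1) * / freq k ^ 2)
        with (freq k * freq k * Cmod z * (D / freq k ^ 4) + freq k * freq k * (D / freq k ^ 4)) by (field; lra).
      assert (0 <= D / freq k ^ 4) by (left; apply Rdiv_lt_0_compat; [lra|apply pow_lt; lra]).
      assert (freq k * Cmod z * (D / freq k ^ 4) <= freq k * freq k * Cmod z * (D / freq k ^ 4)); [|lra].
      apply Rmult_le_compat_r; [lra|]. apply Rmult_le_compat_r; [lra|]. nra.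
    - apply Rmult_le_compat_l; [|apply inv_freq_pow_le; lia].
      unfold ode_bound. fold D. apply Rmult_le_pos; lra. }
  assert (Hcos : Rabs (cos (freq k * a)) <= 1) by apply Rabs_le, COS_bound.
  assert (Hsin : Rabs (sin (freq k * a)) <= 1) by apply Rabs_le, SIN_bound.
  assert (Hk0 := Cmod_ge_0 (ode_coef z k)).
  assert (Hzk : 0 <= Cmod z * Cmod (ode_coef z k)) by (apply Rmult_le_pos; lra).
  split.
  - eapply Rle_trans; [apply Cmod_triangle|]. apply Hi.
    + eapply Rle_trans; [now apply Cmod_RtoC_le_1|]. rewrite Cmod_mult, Rmult_assoc. nra.
    + eapply Rle_trans; [now apply Cmod_RtoC_le_1|].
      rewrite Cmod_mult, Cmod_R, Rabs_right by lra. apply Rmult_le_compat_r; nra.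
  - unfold ode_dterm, Cminus. rewrite Cmult_plus_distr_l.
    eapply Rle_trans; [apply Cmod_triangle|]. rewrite Rplus_comm. apply Hi.
    + rewrite Cmod_mult, Cmod_opp, Cmod_R, Rabs_right, Rmult_assoc by lra.
      apply Rmult_le_compat_l; [lra|].
      eapply Rle_trans; [now apply Cmod_RtoC_le_1|]. rewrite Cmod_mult. lra.
    + rewrite Cmod_mult, Cmod_R, Rabs_right, Rmult_assoc by lra.
      apply Rmult_le_compat_l; [lra|].
      eapply Rle_trans; [now apply Cmod_RtoC_le_1|].
      rewrite Cmod_mult, Cmod_R, Rabs_right by lra. lra.
Qed.

Definition ode_sum (z : C) (a : R) : C :=
  (series1 (fun k => Re (ode_term z a k)), series1 (fun k => Im (ode_term z a k))).

Definition ode_dsum (z : C) (a : R) : C :=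
  (series1 (fun k => Re (ode_dterm z a k)), series1 (fun k => Im (ode_dterm z a k))).

Lemma csums_dom (u : nat -> C) (C0 : R) :
  (forall k, (1 <= k)%nat -> Cmod (u k) <= C0 * / INR k ^ 2) ->
  csums u (series1 (fun k => Re (u k)), series1 (fun k => Im (u k))).
Proof.
  intros H.
  destruct (sums_dom_inv_sqr (fun k => Re (u k)) C0) as [l Hl].
  { intros n Hn. eapply Rle_trans; [apply re_le_Cmod|auto]. }
  destruct (sums_dom_inv_sqr (fun k => Im (u k)) C0) as [l' Hl'].
  { intros n Hn. eapply Rle_trans; [apply im_le_Cmod|auto]. }
  rewrite (sums_series1 _ _ Hl), (sums_series1 _ _ Hl'). now split.
Qed.

Lemma ode_sum_spec (z : C) (a : R) : 0 < Re z -> csums (ode_term z a) (ode_sum z a).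
Proof. intros Hz. apply csums_dom with (ode_bound z). intros k Hk. now apply ode_term_bounds. Qed.

Lemma ode_dsum_spec (z : C) (a : R) : 0 < Re z -> csums (ode_dterm z a) (ode_dsum z a).
Proof. intros Hz. apply csums_dom with (ode_bound z). intros k Hk. now apply ode_term_bounds. Qed.

Lemma ode_sum_derive (z : C) (a : R) :
  0 < Re z ->
  is_derive (fun t => Re (ode_sum z t)) a (Re (ode_dsum z a)) /\
  is_derive (fun t => Im (ode_sum z t)) a (Im (ode_dsum z a)).
Proof.
  intros Hz. destruct sums_inv_sqr as [s Hs].
  assert (HA := sums_scal (ode_bound z) _ _ Hs).
  split; simpl.
  - apply (is_derive_series1 (fun k t => Re (ode_term z t k)) (fun k t => Re (ode_dterm z t k)) _ _ a) in HA; auto.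
    + intros k x Hk. eapply Rle_trans; [apply re_le_Cmod|now apply ode_term_bounds].
    + intros k x Hk. eapply Rle_trans; [apply re_le_Cmod|now apply ode_term_bounds].
    + intros k x Hk. unfold ode_term, ode_dterm.
      destruct z as [x0 y0]. destruct (ode_coef _ _) as [u v]. simpl.
      auto_derive; auto. ring.
    + intros k x Hk. unfold ode_dterm.
      destruct z as [x0 y0]. destruct (ode_coef _ _) as [u v]. simpl.
      apply derivable_continuous_pt, ex_derive_Reals_0. auto_derive. auto.
  - apply (is_derive_series1 (fun k t => Im (ode_term z t k)) (fun k t => Im (ode_dterm z t k)) _ _ a) in HA; auto.
    + intros k x Hk. eapply Rle_trans; [apply im_le_Cmod|now apply ode_term_bounds].
    + intros k x Hk. eapply Rle_trans; [apply im_le_Cmod|now apply ode_term_bounds].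
    + intros k x Hk. unfold ode_term, ode_dterm.
      destruct z as [x0 y0]. destruct (ode_coef _ _) as [u v]. simpl.
      auto_derive; auto. ring.
    + intros k x Hk. unfold ode_dterm.
      destruct z as [x0 y0]. destruct (ode_coef _ _) as [u v]. simpl.
      apply derivable_continuous_pt, ex_derive_Reals_0. auto_derive. auto.
Qed.

Lemma csums_plus (u v : nat -> C) (l l' : C) :
  csums u l -> csums v l' -> csums (fun n => u n + v n)%C (l + l')%C.
Proof. intros [H1 H2] [H3 H4]. split; simpl; now apply sums_plus. Qed.

(** In [ode_dterm + z * ode_term] the sines cancel and the denominator [z^2 + b^2] disappears,
    leaving [2 cos (b a) / b^2], whose sum is known on [[0, 1]]. *)
Lemma ode_equation (z : C) (a : R) :
  0 < Re z -> 0 <= a <= 1 -> (ode_dsum z a + z * ode_sum z a)%C = RtoC (bern 2 a).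
Proof.
  intros Hz Ha.
  assert (H := csums_plus _ _ _ _ (ode_dsum_spec z a Hz) (csums_scal z _ _ (ode_sum_spec z a Hz))).
  apply (csums_unique _ _ _ H).
  assert (H2 := csums_RtoC _ _ (sums_scal 2 _ _ (sums_cos_sqr a Ha))).
  replace (2 * (bern 2 a / 2)) with (bern 2 a) in H2 by field.
  eapply csums_ext; [|exact H2]. intros k Hk.
  assert (Hb := freq_pos k Hk).
  assert (Hn := sqr_plus_sqr_neq_0 z (freq k) Hz Hb).
  assert (Hn2 : RtoC (freq k) <> 0) by (apply RtoC_neq_0; lra).
  unfold ode_dterm, ode_term, ode_coef, Rdiv. rewrite RtoC_mult, RtoC_mult, RtoC_inv, RtoC_pow by (apply pow_nonzero; lra).
  rewrite RtoC_pow in Hn.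
  field. now split.
Qed.

(** Minus the particular solution, polynomial in [a], of [f' + z f = bern 2]. Adding it to [ode_sum]
    gives a solution of the homogeneous equation. *)
Definition ode_poly (z : C) (a : R) : C :=
  (- (/ (z * z * z)) + RtoC (bern 1 a) * / (z * z) - RtoC (bern 2 a) * / z)%C.

Definition ode_full (z : C) (a : R) : C := (ode_sum z a + ode_poly z a)%C.

Lemma Cexp_mult_RtoC (z : C) (a : R) :
  Cexp (z * RtoC a) = (exp (Re z * a) * cos (Im z * a), exp (Re z * a) * sin (Im z * a)).
Proof. unfold Cexp. now rewrite re_scal_r, im_scal_r. Qed.

(** With [z = x + i y] and [f = X + i Y], the hypotheses are the components of [f' = - z f]; the
    conclusions are those of the constancy of [exp (z t) f t]. *)
Lemma linear_ode_solution (x y a : R) (X Y : R -> R) :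
  0 <= a <= 1 ->
  (forall t, 0 <= t <= 1 -> is_derive X t (- (x * X t) + y * Y t)) ->
  (forall t, 0 <= t <= 1 -> is_derive Y t (- (x * Y t) - y * X t)) ->
  exp (x * a) * (cos (y * a) * X a - sin (y * a) * Y a) = X 0 /\
  exp (x * a) * (sin (y * a) * X a + cos (y * a) * Y a) = Y 0.
Proof.
  intros Ha DX DY.
  assert (Hconst : forall F : R -> R, (forall t, 0 <= t <= 1 -> is_derive F t 0) -> F a = F 0).
  { intros F HF. destruct (MVT_gen F 0 a (fun _ => 0)) as [c [_ E]].
    - intros t Ht. rewrite Rmin_left, Rmax_right in Ht by lra. apply HF; lra.
    - intros t Ht. rewrite Rmin_left, Rmax_right in Ht by lra.
      apply (is_derive_continuity_pt F t 0), HF; lra.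
    - lra. }
  assert (E1 := Hconst (fun t => exp (x * t) * (cos (y * t) * X t - sin (y * t) * Y t))).
  assert (E2 := Hconst (fun t => exp (x * t) * (sin (y * t) * X t + cos (y * t) * Y t))).
  cbv beta in E1, E2.
  rewrite !Rmult_0_r, exp_0, cos_0, sin_0 in E1, E2.
  rewrite E1, E2.
  - split; ring.
  - intros t Ht. specialize (DX t Ht). specialize (DY t Ht).
    assert (EX : Derive (fun u : R => X u) t = - (x * X t) + y * Y t) by now apply is_derive_unique.
    assert (EY : Derive (fun u : R => Y u) t = - (x * Y t) - y * X t) by now apply is_derive_unique.
    auto_derive; [repeat split; eexists; eassumption|].
    rewrite EX, EY. ring.
  - intros t Ht. specialize (DX t Ht). specialize (DY t Ht).
    assert (EX : Derive (fun u : R => X u) t = - (x * X t) + y * Y t) by now apply is_derive_unique.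
    assert (EY : Derive (fun u : R => Y u) t = - (x * Y t) - y * X t) by now apply is_derive_unique.
    auto_derive; [repeat split; eexists; eassumption|].
    rewrite EX, EY. ring.
Qed.

(* [ode_full z] solves [f' = - z f]. *)
Lemma ode_full_solution (z : C) (a : R) :
  0 < Re z -> 0 <= a <= 1 -> (Cexp (z * RtoC a) * ode_full z a)%C = ode_full z 0.
Proof.
  intros Hz Ha.
  assert (Hz0 : z <> 0) by (apply C_neq_0_Re; lra).
  set (dfull := fun t => (ode_dsum z t + / (z * z) - RtoC (bern 1 t) * / z)%C).
  assert (Hb1 : forall t, is_derive (bern 1) t 1).
  { intros t. rewrite <- (bern_0 t). apply is_derive_bern. }
  assert (Hd : forall t, is_derive (fun t => Re (ode_full z t)) t (Re (dfull t)) /\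
                         is_derive (fun t => Im (ode_full z t)) t (Im (dfull t))).
  { intros t. destruct (ode_sum_derive z t Hz) as [D1 D2].
    unfold ode_full, ode_poly, dfull.
    set (A0 := (- / (z * z * z))%C). set (A1 := (/ (z * z))%C). set (A2 := (/ z)%C). clearbody A0 A1 A2.
    assert (E0 : Derive (fun x => bern 1 x) t = 1) by (apply is_derive_unique, Hb1).
    assert (E1 : Derive (fun x => bern 2 x) t = bern 1 t) by (apply is_derive_unique, is_derive_bern).
    assert (X0 : ex_derive (fun x => bern 1 x) t) by (exists 1; apply Hb1).
    assert (X1 : ex_derive (fun x => bern 2 x) t) by (exists (bern 1 t); apply is_derive_bern).
    split.
    - apply (is_derive_ext (fun x => Re (ode_sum z x) + (Re A0 + bern 1 x * Re A1 - bern 2 x * Re A2))).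
      { intros x. eqR. unfold Re, Im. simpl. ring. }
      replace (Re (ode_dsum z t + A1 - bern 1 t * A2)) with
        (Re (ode_dsum z t) + (Re A1 - bern 1 t * Re A2)) by (unfold Re, Im; simpl; ring).
      apply (is_derive_plus (V := R_NormedModule)); [exact D1|].
      auto_derive; [auto|]. rewrite E0, E1. ring.
    - apply (is_derive_ext (fun x => Im (ode_sum z x) + (Im A0 + bern 1 x * Im A1 - bern 2 x * Im A2))).
      { intros x. eqR. unfold Re, Im. simpl. ring. }
      replace (Im (ode_dsum z t + A1 - bern 1 t * A2)) with
        (Im (ode_dsum z t) + (Im A1 - bern 1 t * Im A2)) by (unfold Re, Im; simpl; ring).
      apply (is_derive_plus (V := R_NormedModule)); [exact D2|].
      auto_derive; [auto|]. rewrite E0, E1. ring. }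
  assert (Heq : forall t, 0 <= t <= 1 -> dfull t = (- (z * ode_full z t))%C).
  { intros t Ht. assert (E := ode_equation z t Hz Ht).
    unfold dfull, ode_full, ode_poly.
    replace (ode_dsum z t) with (RtoC (bern 2 t) - z * ode_sum z t)%C by (rewrite <- E; ring).
    field. exact Hz0. }
  set (x := Re z) in *. set (y := Im z).
  set (X := fun t => Re (ode_full z t)) in *. set (Y := fun t => Im (ode_full z t)) in *.
  assert (DX : forall t, 0 <= t <= 1 -> is_derive X t (- (x * X t) + y * Y t)).
  { intros t Ht. replace (- (x * X t) + y * Y t) with (Re (dfull t)); [exact (proj1 (Hd t))|].
    rewrite Heq by exact Ht. unfold X, Y, x, y. rewrite re_opp, re_mult. ring. }
  assert (DY : forall t, 0 <= t <= 1 -> is_derive Y t (- (x * Y t) - y * X t)).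
  { intros t Ht. replace (- (x * Y t) - y * X t) with (Im (dfull t)); [exact (proj2 (Hd t))|].
    rewrite Heq by exact Ht. unfold X, Y, x, y. rewrite im_opp, im_mult. ring. }
  destruct (linear_ode_solution x y a X Y) as [E1 E2]; auto.
  assert (Hez : Cexp (z * a) = (exp (x * a) * cos (y * a), exp (x * a) * sin (y * a))).
  { apply Cexp_mult_RtoC. }
  rewrite Hez. apply injective_projections.
  - transitivity (exp (x * a) * (cos (y * a) * X a - sin (y * a) * Y a)).
    { unfold X, Y, Re, Im. simpl. ring. }
    rewrite E1. reflexivity.
  - transitivity (exp (x * a) * (sin (y * a) * X a + cos (y * a) * Y a)).
    { unfold X, Y, Re, Im. simpl. ring. }
    rewrite E2. reflexivity.
Qed.

Lemma ode_sum_period (z : C) : ode_sum z 1 = ode_sum z 0.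
Proof.
  unfold ode_sum. f_equal; unfold series1; apply Series_ext; intros k; unfold ode_term;
    replace (freq (S k) * 1) with (0 + 2 * INR (S k) * PI) by (unfold freq; ring);
    rewrite cos_period, sin_period, Rmult_0_r; reflexivity.
Qed.

(** Two relations between the values at 0 and 1 determine both: [exp z * f 1 = f 0] from the
    equation, and [f 1 = f 0 + 1 / z^2], because the trigonometric sum has period 1 and only
    [bern 1] jumps. *)
Lemma ode_full_0 (z : C) :
  0 < Re z -> ode_full z 0 = (Cexp z / (z * z * (1 - Cexp z)))%C.
Proof.
  intros Hz. assert (Hz0 : z <> 0) by (apply C_neq_0_Re; lra).
  assert (H := ode_full_solution z 1 Hz ltac:(lra)).
  assert (E : ode_full z 1 = (ode_full z 0 + / (z * z))%C).
  { unfold ode_full. rewrite ode_sum_period. unfold ode_poly.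
    rewrite !bern_1, !bern_2.
    replace (1 - 1/2) with (/2) by field. replace (0 - 1/2) with (-/2) by field.
    replace (1 ^ 2 / 2 - 1 / 2 + 1 / 12) with (/12) by field.
    replace (0 ^ 2 / 2 - 0 / 2 + 1 / 12) with (/12) by field.
    rewrite RtoC_opp, !RtoC_inv by lra. field. exact Hz0. }
  rewrite E, Cmult_1_r in H.
  assert (Hn : (1 - Cexp z)%C <> 0).
  { intros E'. apply (Cexp_neq_1 z Hz). replace (Cexp z - 1)%C with (- (1 - Cexp z))%C by ring.
    rewrite E'. ring. }
  replace (ode_full z 0) with (ode_full z 0 * (1 - Cexp z) / (1 - Cexp z))%C by (field; exact Hn).
  replace (ode_full z 0 * (1 - Cexp z))%C with (Cexp z * / (z * z))%C.
  - field. split; auto.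
  - transitivity (Cexp z * (ode_full z 0 + / (z * z)) - Cexp z * ode_full z 0)%C; [ring|].
    rewrite H. ring.
Qed.

Lemma C2_neq_0 : RtoC 2 <> 0.
Proof. apply RtoC_neq_0. lra. Qed.

Lemma RtoC_Rinv (x : R) : RtoC (/ x) = (/ RtoC x)%C.
Proof.
  destruct (Req_dec x 0) as [->|H]; [|now apply RtoC_inv].
  rewrite Rinv_0. unfold Cinv, RtoC. simpl. f_equal; unfold Rdiv; ring.
Qed.

(** Since [z^2 / (z^2 + b^2) = z^2 / b^2 - z^4 / (b^2 (z^2 + b^2))], the series is a combination of
    the cosine series and [ode_sum] at [a = 0]. The value is [(z / 4) coth (z / 2) - 1 / 2]. *)
Lemma csums_coth (z : C) :
  0 < Re z ->
  csums (fun k => z * z / (z * z + RtoC (freq k ^ 2)))%C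
        (z / 4 - 1 / 2 + z / 2 / (Cexp z - 1))%C.
Proof.
  intros Hz. assert (Hz0 : z <> 0) by (apply C_neq_0_Re; lra).
  assert (H1 := csums_scal (z * z) _ _ (csums_RtoC _ _ (sums_cos_sqr 0 ltac:(lra)))).
  assert (H2 := csums_scal (z * z * z / 2) _ _ (ode_sum_spec z 0 Hz)).
  assert (H := csums_minus _ _ _ _ H1 H2).
  replace (z / 4 - 1 / 2 + z / 2 / (Cexp z - 1))%C with
    (z * z * RtoC (bern 2 0 / 2) - z * z * z / 2 * ode_sum z 0)%C.
  - eapply csums_ext; [|exact H]. intros k Hk.
    assert (Hb := freq_pos k Hk).
    assert (Hn := sqr_plus_sqr_neq_0 z (freq k) Hz Hb).
    assert (Hn2 : RtoC (freq k ^ 2) <> 0) by (apply RtoC_neq_0, pow_nonzero; lra).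
    unfold ode_term, ode_coef. rewrite Rmult_0_r, cos_0, sin_0.
    unfold Rdiv. rewrite RtoC_mult, RtoC_inv by (apply pow_nonzero; lra).
    field. repeat split; auto; apply C2_neq_0.
  - replace (ode_sum z 0) with (ode_full z 0 - ode_poly z 0)%C by (unfold ode_full; ring).
    rewrite ode_full_0 by exact Hz. unfold ode_poly. rewrite bern_1, !bern_2.
    replace ((0 ^ 2 / 2 - 0 / 2 + 1 / 12) / 2) with (/24) by field.
    replace (0 ^ 2 / 2 - 0 / 2 + 1 / 12) with (/12) by field.
    replace (0 - 1/2) with (-/2) by field.
    rewrite RtoC_opp, !RtoC_inv by lra.
    assert (Hn := Cexp_neq_1 z Hz).
    field. repeat split; auto.
    intros E. apply Hn. replace (Cexp z - 1)%C with (- (1 - Cexp z))%C by ring. rewrite E. ring.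
Qed.

(* [2 Re (e^(i b a) / (y + i b)) / b^(2 m)] *)
Definition fourier_term (m : nat) (y a : R) (k : nat) : R :=
  2 * (y * cos (freq k * a) + freq k * sin (freq k * a)) / (freq k ^ (2 * m) * (y ^ 2 + freq k ^ 2)).

(** The explicit solution at real [z = y] is [exp (- y a)] times its value at 0, that is
    [- geom_kernel y a / y^2]; subtracting [ode_poly] removes precisely the three Laurent terms of
    [laurent_rem 3]. *)
Lemma sums_fourier_1 (y a : R) :
  0 < y -> 0 <= a <= 1 -> sums (fourier_term 1 y a) (- laurent_rem 3 y a / y ^ 2).
Proof.
  intros Hy Ha. set (z := RtoC y).
  assert (Hz : 0 < Re z) by exact Hy.
  assert (Hz0 : z <> 0) by (apply C_neq_0_Re; lra).
  destruct (ode_sum_spec z a Hz) as [H _].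
  assert (E := ode_full_solution z a Hz Ha). rewrite ode_full_0 in E by exact Hz.
  assert (He : forall t, Cexp (RtoC t) = RtoC (exp t)).
  { intros t. unfold Cexp. simpl. rewrite cos_0, sin_0, Rmult_1_r, Rmult_0_r. reflexivity. }
  assert (Hem : exp (- y) * exp y = 1) by (rewrite <- exp_plus, Rplus_opp_l; apply exp_0).
  assert (Hye := exp_pos y).
  assert (Hye1 : 1 - exp y <> 0).
  { assert (exp 0 < exp y) by (apply exp_increasing; lra). rewrite exp_0 in *. lra. }
  assert (Hae : exp (- (a * y)) * exp (y * a) = 1).
  { rewrite <- exp_plus. replace (- (a * y) + y * a) with 0 by ring. apply exp_0. }
  assert (Hae0 := exp_pos (y * a)).
  assert (Es : ode_sum z a = RtoC (- laurent_rem 3 y a / y ^ 2)).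
  { replace (ode_sum z a) with (ode_full z a - ode_poly z a)%C by (unfold ode_full; ring).
    replace (ode_full z a) with (/ RtoC (exp (y * a)) * (Cexp z / (z * z * (1 - Cexp z))))%C.
    - replace (- laurent_rem 3 y a / y ^ 2) with
        (- (/ exp (y * a) * / (1 + - / exp y) + - ((1 + - (bern 1 a * y) + bern 2 a * (y * y)) * / y)) * / (y * y)).
      + unfold z. rewrite He. unfold ode_poly.
        rewrite !RtoC_mult, !RtoC_Rinv, RtoC_opp, RtoC_plus, RtoC_opp, !RtoC_mult, !RtoC_Rinv, !RtoC_plus, !RtoC_opp, !RtoC_mult, !RtoC_Rinv.
        assert (Hc1 : RtoC (exp y) <> 0) by (apply RtoC_neq_0; lra).
        assert (Hc2 : RtoC (exp (y * a)) <> 0) by (apply RtoC_neq_0; lra).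
        assert (Hc4 : (1 - RtoC (exp y))%C <> 0).
        { rewrite <- RtoC_minus. now apply RtoC_neq_0. }
        assert (Hc5 : (RtoC (exp y) + RtoC (-1))%C <> 0).
        { rewrite <- RtoC_plus. apply RtoC_neq_0. lra. }
        field. repeat split; auto.
      + unfold laurent_rem, bern_sum, geom_kernel. rewrite !nsum_S, nsum_0, bern_0.
        replace (exp (- (a * y))) with (/ exp (y * a)).
        2:{ apply (Rmult_eq_reg_r (exp (y * a))); [|lra]. rewrite Hae. field. lra. }
        replace (exp (- y)) with (/ exp y).
        2:{ apply (Rmult_eq_reg_r (exp y)); [|lra]. rewrite Hem. field. lra. }
        field. repeat split; lra.
    - rewrite <- E. rewrite <- He. rewrite RtoC_mult. fold z. field. unfold z.
      rewrite <- RtoC_mult, He. apply RtoC_neq_0. lra. }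
  rewrite Es in H.
  eapply sums_ext; [|exact H]. intros k Hk.
  assert (Hb := freq_pos k Hk).
  unfold ode_term, ode_coef, fourier_term, z.
  rewrite <- RtoC_mult, <- RtoC_plus, <- RtoC_mult.
  unfold Cdiv. rewrite <- RtoC_inv, <- !RtoC_mult, <- RtoC_plus by (apply Rmult_integral_contrapositive_currified; nra).
  simpl Re. simpl Nat.mul. field. split; nra.
Qed.

(** Because [b >= 1], [(y + b) (1 + y) <= (y + b)^2 <= 2 (y^2 + b^2)]. The bound is a product of a
    function of [b] and one of [y], as both the exchange of sums and the termwise integration
    require. *)
Lemma fourier_term_bound (m : nat) (y a : R) (k : nat) :
  (1 <= m)%nat -> (1 <= k)%nat -> 0 < y ->
  Rabs (fourier_term m y a k) <= 4 * / freq k ^ (2 * m) * / (1 + y).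
Proof.
  intros Hm Hk Hy. assert (Hb := freq_ge_1 k Hk).
  assert (Hp : 0 < freq k ^ (2 * m)) by (apply pow_lt; lra).
  unfold fourier_term, Rdiv. set (b := freq k) in *.
  assert (Hq : 0 < y ^ 2 + b ^ 2) by nra.
  rewrite Rinv_mult, Rabs_mult, (Rabs_right (/ b ^ (2 * m) * / (y ^ 2 + b ^ 2))).
  2:{ apply Rle_ge, Rmult_le_pos; left; now apply Rinv_0_lt_compat. }
  assert (Hn : Rabs (2 * (y * cos (b * a) + b * sin (b * a))) <= 2 * (y + b)).
  { assert (Hc := COS_bound (b * a)). assert (Hs := SIN_bound (b * a)).
    apply Rabs_le. nra. }
  apply Rle_trans with (2 * (y + b) * (/ b ^ (2 * m) * / (y ^ 2 + b ^ 2))).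
  { apply Rmult_le_compat_r; [|exact Hn].
    apply Rmult_le_pos; left; now apply Rinv_0_lt_compat. }
  assert (Hk2 : (y + b) * / (y ^ 2 + b ^ 2) <= 2 * / (1 + y)).
  { apply (Rmult_le_reg_r ((y ^ 2 + b ^ 2) * (1 + y))); [apply Rmult_lt_0_compat; lra|].
    replace ((y + b) * / (y ^ 2 + b ^ 2) * ((y ^ 2 + b ^ 2) * (1 + y))) with ((y + b) * (1 + y)) by (field; lra).
    replace (2 * / (1 + y) * ((y ^ 2 + b ^ 2) * (1 + y))) with (2 * (y ^ 2 + b ^ 2)) by (field; lra).
    assert (0 <= (y - b) ^ 2) by apply pow2_ge_0. nra. }
  replace (2 * (y + b) * (/ b ^ (2 * m) * / (y ^ 2 + b ^ 2)))
    with (2 * / b ^ (2 * m) * ((y + b) * / (y ^ 2 + b ^ 2))) by ring.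
  replace (4 * / b ^ (2 * m) * / (1 + y)) with (2 * / b ^ (2 * m) * (2 * / (1 + y))) by ring.
  apply Rmult_le_compat_l; [|exact Hk2].
  apply Rmult_le_pos; [lra|]. left. now apply Rinv_0_lt_compat.
Qed.

(** * Polynomials compared with powers at 0, and the Fourier expansion of all Laurent remainders *)

Definition bigO (L : nat) (g : R -> R) : Prop :=
  exists C0, forall y, 0 < y <= 1 -> Rabs (g y) <= C0 * y ^ L.

Definition is_poly (L : nat) (P : R -> R) : Prop := exists c : nat -> R, forall y, P y = nsum L (fun j => c j * y ^ j).

Lemma poly_bounded (L : nat) (c : nat -> R) :
  exists D, forall y, 0 < y <= 1 -> Rabs (nsum L (fun j => c j * y ^ j)) <= D.
Proof.
  exists (nsum L (fun j => Rabs (c j))). intros y Hy.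
  eapply Rle_trans; [apply nsum_Rabs|]. apply nsum_le. intros i _.
  rewrite Rabs_mult, <- RPow_abs, (Rabs_right y) by lra.
  rewrite <- (Rmult_1_r (Rabs (c i))) at 2. apply Rmult_le_compat_l; [apply Rabs_pos|].
  rewrite <- (pow1 i). apply pow_incr. lra.
Qed.

(** The constant coefficient is the limit at 0, hence 0; dividing by [y] lowers both the degree and
    the order of vanishing. *)
Lemma small_poly_zero (L : nat) (P : R -> R) : is_poly L P -> bigO L P -> forall y, P y = 0.
Proof.
  revert P. induction L as [|L IH]; intros P [c Hc] [C0 HC] y; [now rewrite Hc, nsum_0|].
  set (Q := fun y => nsum L (fun j => c (S j) * y ^ j)).
  assert (HPQ : forall y, P y = c 0%nat + y * Q y).
  { intros t. rewrite Hc, nsum_first. unfold Q. rewrite <- nsum_scal. f_equal; [simpl; ring|].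
    apply nsum_ext. intros; simpl; ring. }
  destruct (poly_bounded L (fun j => c (S j))) as [D HD].
  assert (HC0 : 0 <= C0).
  { specialize (HC 1 ltac:(lra)). rewrite pow1 in HC. assert (H := Rabs_pos (P 1)). lra. }
  assert (HD0 : 0 <= D).
  { specialize (HD 1 ltac:(lra)). eapply Rle_trans; [apply Rabs_pos|exact HD]. }
  assert (Hc0 : c 0%nat = 0).
  { destruct (Req_dec (c 0%nat) 0) as [|Hn]; auto. exfalso.
    assert (Hp : 0 < Rabs (c 0%nat)) by now apply Rabs_pos_lt.
    (* At this [t] the bounds give [|c 0| <= (C0 + D) t], which is less than [|c 0|]. *)
    set (t := Rmin 1 (Rabs (c 0%nat) / (2 * (C0 + D + 1)))).
    assert (Ht : 0 < t <= 1).
    { split; [|apply Rmin_l]. apply Rmin_glb_lt; [lra|]. apply Rdiv_lt_0_compat; lra. }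
    assert (Ht2 : t * (2 * (C0 + D + 1)) <= Rabs (c 0%nat)).
    { apply Rle_trans with (Rabs (c 0%nat) / (2 * (C0 + D + 1)) * (2 * (C0 + D + 1))).
      - apply Rmult_le_compat_r; [lra|apply Rmin_r].
      - right. field. lra. }
    specialize (HC t Ht). specialize (HD t Ht). fold (Q t) in HD.
    assert (Htp : t ^ S L <= t).
    { simpl. rewrite <- (Rmult_1_r t) at 3. apply Rmult_le_compat_l; [lra|].
      rewrite <- (pow1 L). apply pow_incr. lra. }
    assert (Rabs (c 0%nat) <= Rabs (P t) + t * Rabs (Q t)).
    { replace (c 0%nat) with (P t + - (t * Q t)) at 1 by (rewrite HPQ; ring).
      eapply Rle_trans; [apply Rabs_triang|]. rewrite Rabs_Ropp, Rabs_mult, (Rabs_right t) by lra. lra. }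
    nra. }
  rewrite HPQ, Hc0, (IH Q); [ring| |].
  - exists (fun j => c (S j)). reflexivity.
  - exists C0. intros t Ht. specialize (HC t Ht). rewrite HPQ, Hc0, Rplus_0_l, Rabs_mult, (Rabs_right t) in HC by lra.
    apply (Rmult_le_reg_l t); [lra|]. simpl in HC. lra.
Qed.

Lemma affine_small_zero (A B C0 : R) :
  (forall y, 0 < y <= 1 -> Rabs (A + B * y) <= C0 * y ^ 2) -> A = 0 /\ B = 0.
Proof.
  intros H. assert (E : forall y, A + B * y = 0).
  { apply (small_poly_zero 2); [|now exists C0].
    exists (fun j => match j with O => A | _ => B end). intros y. rewrite !nsum_S, nsum_0. ring. }
  assert (H0 := E 0). assert (H1 := E 1). lra.
Qed.

Lemma laurent_rem_S (L : nat) (y a : R) :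
  0 < y -> laurent_rem (S L) y a = laurent_rem L y a - (-1) ^ L * bern L a * y ^ L / y.
Proof. intros Hy. unfold laurent_rem, bern_sum. rewrite nsum_S. field. lra. Qed.

(* Both sides of [1 / (y + i b) = 1 / (i b) - y / (i b)^2 - y^2 / (b^2 (y + i b))] are summed over
   [b]; as [y -> 0] the last part is [O(y^2)], which identifies the first two sums. *)
Lemma fourier_step (m : nat) (a : R) :
  (1 <= m)%nat -> 0 <= a <= 1 ->
  (forall y, 0 < y -> sums (fourier_term m y a) ((-1) ^ m * laurent_rem (2 * m + 1) y a / y ^ (2 * m))) ->
  sums (fun k => cos (freq k * a) / freq k ^ (2 * m + 2)) ((-1) ^ m * bern (2 * m + 2) a / 2) /\
  sums (fun k => sin (freq k * a) / freq k ^ (2 * m + 1)) (- (-1) ^ m * bern (2 * m + 1) a / 2) /\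
  (forall y, 0 < y -> sums (fourier_term (S m) y a)
                       ((-1) ^ S m * laurent_rem (2 * S m + 1) y a / y ^ (2 * S m))).
Proof.
  intros Hm Ha Hs.
  destruct (sums_cos_pow (2 * m + 2) a) as [c Hc]; [lia|].
  destruct (sums_sin_pow (2 * m + 1) a) as [s Hsn]; [lia|].
  set (T := fun y => (2 * y * c + 2 * s - (-1) ^ m * laurent_rem (2 * m + 1) y a / y ^ (2 * m)) / y ^ 2).
  assert (HT : forall y, 0 < y -> sums (fourier_term (S m) y a) (T y)).
  { intros y Hy.
    assert (H := sums_minus _ _ _ _ (sums_plus _ _ _ _ (sums_scal (2 * y) _ _ Hc) (sums_scal 2 _ _ Hsn)) (Hs y Hy)).
    apply (sums_scal (/ y ^ 2)) in H.
    eapply sums_eq; [|eapply sums_ext; [|exact H]].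
    - unfold T. field. split; [apply pow_nonzero|]; lra.
    - intros k Hk. unfold fourier_term.
      assert (Hb := freq_pos k Hk).
      replace (2 * S m)%nat with (2 * m + 2)%nat by lia.
      rewrite !pow_add. assert (freq k ^ (2 * m) <> 0) by (apply pow_nonzero; lra).
      field. repeat split; nra. }
  assert (ET : forall y, 0 < y -> y ^ 2 * T y = (2 * s + (-1) ^ m * bern (2 * m + 1) a)
      + (2 * c - (-1) ^ m * bern (2 * m + 2) a) * y
      - (-1) ^ m * laurent_rem (2 * m + 3) y a / y ^ (2 * m)).
  { intros y Hy. unfold T.
    replace (2 * m + 3)%nat with (S (S (2 * m + 1))) by lia.
    rewrite (laurent_rem_S (S (2 * m + 1))), (laurent_rem_S (2 * m + 1)) by exact Hy.
    replace (S (2 * m + 1)) with (2 * m + 2)%nat by lia.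
    rewrite !pow_add, !pow_1_even.
    assert (y ^ (2 * m) <> 0) by (apply pow_nonzero; lra).
    field. split; auto; lra. }
  destruct sums_inv_sqr as [S2 HS2].
  assert (HTb : forall y, 0 < y <= 1 -> Rabs (T y) <= 4 * S2).
  { intros y Hy. apply (sums_Rabs_le (fourier_term (S m) y a) (fun k => 4 * / INR k ^ 2)).
    - intros k Hk. eapply Rle_trans; [apply fourier_term_bound; lia || lra|].
      rewrite Rmult_assoc. apply Rmult_le_compat_l; [lra|].
      rewrite <- (Rmult_1_r (/ INR k ^ 2)).
      apply Rmult_le_compat.
      + left. apply Rinv_0_lt_compat, pow_lt, freq_pos. exact Hk.
      + left. apply Rinv_0_lt_compat. lra.
      + apply inv_freq_pow_le; lia.
      + rewrite <- Rinv_1. apply Rinv_le_contravar; lra.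
    - apply HT; lra.
    - now apply sums_scal. }
  (* In the constant, [4 * S2] bounds [T], and 2 comes from the factor [1 + y <= 2] in the bound on
     the Laurent remainder. *)
  destruct (affine_small_zero (2 * s + (-1) ^ m * bern (2 * m + 1) a)
     (2 * c - (-1) ^ m * bern (2 * m + 2) a) (4 * S2 + 2)) as [E1 E2].
  { intros y Hy. specialize (ET y ltac:(lra)).
    replace (2 * s + (-1) ^ m * bern (2 * m + 1) a + (2 * c - (-1) ^ m * bern (2 * m + 2) a) * y)
      with (y ^ 2 * T y + (-1) ^ m * laurent_rem (2 * m + 3) y a / y ^ (2 * m)) by (rewrite ET; ring).
    assert (Hp : 0 < y ^ (2 * m)) by (apply pow_lt; lra).
    assert (Hl := laurent_rem_bound (2 * m + 3) y a ltac:(lra) Ha).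
    eapply Rle_trans; [apply Rabs_triang|].
    rewrite Rabs_mult, (Rabs_right (y ^ 2)) by nra.
    unfold Rdiv. rewrite !Rabs_mult, pow_1_abs, Rmult_1_l.
    rewrite (Rabs_right (/ y ^ (2 * m))) by (apply Rle_ge, Rlt_le, Rinv_0_lt_compat; auto).
    assert (Rabs (laurent_rem (2 * m + 3) y a) * / y ^ (2 * m) <= 2 * y ^ 2).
    { apply (Rmult_le_reg_r (y ^ (2 * m))); auto.
      rewrite Rmult_assoc, Rinv_l, Rmult_1_r by lra.
      eapply Rle_trans; [exact Hl|].
      rewrite pow_add. replace (y ^ (2 * m) * y ^ 3 * (1 + / y)) with ((y + 1) * (y ^ 2 * y ^ (2 * m))) by (field; lra).
      rewrite Rmult_assoc. apply Rmult_le_compat_r; [|lra].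
      apply Rmult_le_pos; [apply pow2_ge_0|lra]. }
    assert (y ^ 2 * Rabs (T y) <= y ^ 2 * (4 * S2)) by (apply Rmult_le_compat_l; [apply pow2_ge_0|auto]).
    lra. }
  split; [|split].
  - eapply sums_eq; [|exact Hc]. lra.
  - eapply sums_eq; [|exact Hsn]. lra.
  - intros y Hy. eapply sums_eq; [|exact (HT y Hy)].
    specialize (ET y Hy). rewrite E1, E2 in ET.
    replace (2 * S m + 1)%nat with (2 * m + 3)%nat by lia.
    replace (2 * S m)%nat with (2 * m + 2)%nat by lia.
    assert (y ^ (2 * m) <> 0) by (apply pow_nonzero; lra).
    apply (Rmult_eq_reg_l (y ^ 2)); [|apply pow_nonzero; lra].
    rewrite ET, pow_add. simpl ((-1) ^ S m). field. split; auto; lra.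
Qed.

Lemma sums_fourier (m : nat) (y a : R) :
  (1 <= m)%nat -> 0 < y -> 0 <= a <= 1 ->
  sums (fourier_term m y a) ((-1) ^ m * laurent_rem (2 * m + 1) y a / y ^ (2 * m)).
Proof.
  intros Hm Hy Ha. revert y Hy. induction m as [|m IH]; [lia|]. intros y Hy.
  destruct (Nat.eq_dec m 0) as [->|Hn].
  - eapply sums_eq; [|apply sums_fourier_1; auto].
    change (2 * 1 + 1)%nat with 3%nat. change (2 * 1)%nat with 2%nat. field. lra.
  - assert (Hm' : (1 <= m)%nat) by lia. apply fourier_step; auto.
Qed.

Lemma sums_cos_bern (m : nat) (a : R) :
  0 <= a <= 1 ->
  sums (fun k => cos (freq k * a) / freq k ^ (2 * m + 2)) ((-1) ^ m * bern (2 * m + 2) a / 2).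
Proof.
  intros Ha. destruct m as [|m].
  - eapply sums_eq; [|apply sums_cos_sqr; auto]. change (2 * 0 + 2)%nat with 2%nat. field.
  - apply fourier_step; [lia|auto|]. intros; apply sums_fourier; lia || auto.
Qed.

Lemma sums_sin_bern (m : nat) (a : R) :
  (1 <= m)%nat -> 0 <= a <= 1 ->
  sums (fun k => sin (freq k * a) / freq k ^ (2 * m + 1)) (- (-1) ^ m * bern (2 * m + 1) a / 2).
Proof.
  intros Hm Ha. apply fourier_step; auto. intros; apply sums_fourier; auto.
Qed.

(** * Partial fractions of [1 / (x^(2N) + 1)] and [x^N / (x^(2N) + 1)] *)

Definition csum (n : nat) (f : nat -> C) : C :=
  (nsum n (fun i => Re (f i)), nsum n (fun i => Im (f i))).

Lemma csum_S (n : nat) (f : nat -> C) : csum (S n) f = (csum n f + f n)%C.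
Proof. unfold csum. rewrite !nsum_S. apply injective_projections; reflexivity. Qed.

Lemma csum_ext (n : nat) (f g : nat -> C) :
  (forall i, (i < n)%nat -> f i = g i) -> csum n f = csum n g.
Proof. intros H. unfold csum. f_equal; apply nsum_ext; intros; now rewrite H. Qed.

Lemma csum_scal (n : nat) (c : C) (f : nat -> C) :
  csum n (fun i => c * f i)%C = (c * csum n f)%C.
Proof.
  induction n as [|n IH]; [apply injective_projections; unfold csum; rewrite !nsum_0; simpl; ring|].
  rewrite !csum_S, IH. ring.
Qed.

Lemma csum_swap (p q : nat) (f : nat -> nat -> C) :
  csum p (fun i => csum q (f i)) = csum q (fun j => csum p (fun i => f i j)).
Proof. unfold csum. f_equal; apply nsum_swap. Qed.

Lemma csum_single (n k : nat) (f : nat -> C) :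
  (k < n)%nat -> (forall i, (i < n)%nat -> i <> k -> f i = 0) -> csum n f = f k.
Proof.
  intros Hk H. unfold csum.
  rewrite !(nsum_single n k) by (try exact Hk; intros; now rewrite H). now destruct (f k).
Qed.

Lemma geometric_factor (n : nat) (X v : C) :
  (X ^ n - v ^ n)%C = ((X - v) * csum n (fun k => X ^ k * v ^ (n - 1 - k)))%C.
Proof.
  induction n as [|n IH].
  - unfold csum. rewrite !nsum_0. apply injective_projections; simpl; ring.
  - rewrite csum_S.
    rewrite (csum_ext n _ (fun k => v * (X ^ k * v ^ (n - 1 - k)))%C).
    + rewrite csum_scal. replace (S n - 1 - n)%nat with 0%nat by lia.
      transitivity ((X ^ n - v ^ n) * v + (X - v) * X ^ n)%C; [simpl; ring|]. rewrite IH. ring.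
    + intros i Hi. replace (S n - 1 - i)%nat with (S (n - 1 - i)) by lia. simpl. ring.
Qed.

Definition cis (t : R) : C := (cos t, sin t).

Lemma cis_pow (t : R) (n : nat) : (cis t ^ n)%C = cis (INR n * t).
Proof.
  induction n as [|n IH].
  - unfold cis. now rewrite Rmult_0_l, cos_0, sin_0.
  - rewrite Cpow_S, IH, S_INR. unfold cis.
    replace ((INR n + 1) * t) with (t + INR n * t) by ring.
    rewrite cos_plus, sin_plus. apply injective_projections; simpl; ring.
Qed.

Lemma cis_odd_sum (n : nat) (x : R) :
  nsum n (fun j => cos ((2 * INR j + 1) * x)) * (2 * sin x) = sin (2 * INR n * x) /\
  nsum n (fun j => sin ((2 * INR j + 1) * x)) * (2 * sin x) = 1 - cos (2 * INR n * x).
Proof.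
  induction n as [|n [IH1 IH2]].
  - replace (2 * INR 0 * x) with 0 by (simpl INR; ring). rewrite !nsum_0, cos_0, sin_0. split; ring.
  - rewrite !nsum_S, !(Rmult_plus_distr_r (nsum n _)), IH1, IH2, S_INR.
    replace (2 * (INR n + 1) * x) with ((2 * INR n + 1) * x + x) by ring.
    replace (2 * INR n * x) with ((2 * INR n + 1) * x - x) by ring.
    rewrite sin_plus, sin_minus, cos_plus, cos_minus. split; ring.
Qed.

Definition root_arg (N j : nat) : R := PI * (2 * INR j + 1) / (2 * INR N).

(** The angles [root_arg N j] are those of [2N]-th roots of -1; their squares run over the [N]-th
    roots of -1. The decomposition is made in [X = x^2], so the squares come first. *)
Definition root_sqr (N j : nat) : C := cis (2 * root_arg N j).

(** A geometric sum whose ratio has angle [2 x] with [x = PI t / N]; for [0 < t < 2 N] the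
    denominator [sin x] vanishes only at [t = N], where every summand is -1. *)
Lemma root_power_sum (N t : nat) :
  (0 < N)%nat -> (0 < t < 2 * N)%nat ->
  csum N (fun j => root_sqr N j ^ t)%C = if Nat.eqb t N then (- RtoC (INR N))%C else 0.
Proof.
  intros HN Ht. assert (HNr : 0 < INR N) by (apply lt_0_INR; lia).
  set (x := PI * INR t / INR N).
  assert (HS : csum N (fun j => root_sqr N j ^ t)%C =
    (nsum N (fun j => cos ((2 * INR j + 1) * x)), nsum N (fun j => sin ((2 * INR j + 1) * x)))).
  { unfold csum, root_sqr. f_equal; apply nsum_ext; intros j _; rewrite cis_pow; unfold cis; simpl;
      f_equal; unfold x, root_arg; field; lra. }
  rewrite HS. destruct (Nat.eqb_spec t N) as [->|Hn].
  - replace x with PI by (unfold x; field; lra).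
    apply injective_projections; simpl.
    + rewrite (nsum_ext N _ (fun _ => -1)).
      * rewrite nsum_const. ring.
      * intros j _. replace ((2 * INR j + 1) * PI) with (PI + 2 * INR j * PI) by ring.
        now rewrite cos_period, cos_PI.
    + rewrite (nsum_ext N _ (fun _ => 0)).
      * rewrite nsum_const. ring.
      * intros j _. replace ((2 * INR j + 1) * PI) with (PI + 2 * INR j * PI) by ring.
        now rewrite sin_period, sin_PI.
  - assert (Hsin : sin x <> 0).
    { assert (HPI := PI_RGT_0). assert (Ht0 : 0 < INR t) by (apply lt_0_INR; lia).
      destruct (lt_dec t N) as [Hl|Hg].
      - apply Rgt_not_eq, sin_gt_0.
        + apply Rdiv_lt_0_compat; [apply Rmult_lt_0_compat|]; lra.
        + apply (Rmult_lt_reg_r (INR N)); [lra|]. unfold x, Rdiv. rewrite Rmult_assoc, Rinv_l by lra.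
          rewrite Rmult_1_r. apply Rmult_lt_compat_l; [lra|]. now apply lt_INR.
      - assert (Hx : PI < x).
        { apply (Rmult_lt_reg_r (INR N)); [lra|]. unfold x, Rdiv. rewrite Rmult_assoc, Rinv_l by lra.
          rewrite Rmult_1_r. apply Rmult_lt_compat_l; [lra|]. apply lt_INR. lia. }
        assert (Hx2 : x < 2 * PI).
        { apply (Rmult_lt_reg_r (INR N)); [lra|]. unfold x, Rdiv. rewrite Rmult_assoc, Rinv_l by lra.
          rewrite Rmult_1_r. rewrite (Rmult_comm 2), Rmult_assoc. apply Rmult_lt_compat_l; [lra|].
          replace (2 * INR N) with (INR (2 * N)) by (rewrite mult_INR; reflexivity). apply lt_INR. lia. }
        apply Rlt_not_eq. now apply sin_lt_0. }
    destruct (cis_odd_sum N x) as [E1 E2].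
    assert (Ex : 2 * INR N * x = 0 + 2 * INR t * PI) by (unfold x; field; lra).
    rewrite Ex, sin_period, sin_0 in E1. rewrite Ex, cos_period, cos_0 in E2.
    apply injective_projections; simpl.
    + apply (Rmult_eq_reg_r (2 * sin x)); [rewrite E1; ring|auto].
    + apply (Rmult_eq_reg_r (2 * sin x)); [rewrite E2; ring|auto].
Qed.

Lemma root_sqr_pow_N (N j : nat) : (0 < N)%nat -> (root_sqr N j ^ N)%C = RtoC (-1).
Proof.
  intros HN. assert (HNr : 0 < INR N) by (apply lt_0_INR; lia).
  unfold root_sqr. rewrite cis_pow.
  replace (INR N * (2 * root_arg N j)) with (PI + 2 * INR j * PI) by (unfold root_arg; field; lra).
  unfold cis. rewrite cos_period, sin_period, cos_PI, sin_PI. reflexivity.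
Qed.

(** The half power is [i] or [-i]. Multiplying by it turns a real part into an imaginary part with
    alternating sign, which is how the numerator [X^M] is obtained from the same fractions. *)
Lemma root_sqr_pow_half (M j : nat) :
  (0 < M)%nat -> (root_sqr (2 * M) j ^ M)%C = (0, (-1) ^ j).
Proof.
  intros HM. assert (HMr : 0 < INR M) by (apply lt_0_INR; lia).
  unfold root_sqr. rewrite cis_pow.
  replace (INR M * (2 * root_arg (2 * M) j)) with (PI / 2 + INR j * PI)
    by (unfold root_arg; rewrite mult_INR; simpl INR; field; lra).
  unfold cis. induction j as [|j IH].
  - rewrite Rmult_0_l, Rplus_0_r, cos_PI2, sin_PI2. reflexivity.
  - rewrite S_INR. replace (PI / 2 + (INR j + 1) * PI) with (PI / 2 + INR j * PI + PI) by ring.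
    rewrite neg_cos, neg_sin. injection IH as E1 E2. rewrite E1, E2. simpl. f_equal; ring.
Qed.

Lemma Cpow_opp (u : C) (k : nat) : ((- u) ^ k)%C = (RtoC ((-1) ^ k) * u ^ k)%C.
Proof.
  replace (- u)%C with (RtoC (-1) * u)%C by ring. rewrite Cpow_mult_l, RtoC_pow. reflexivity.
Qed.

Lemma pow_m1_sqr (p : nat) : (-1) ^ p * (-1) ^ p = 1.
Proof. rewrite <- pow_add. replace (p + p)%nat with (2 * p)%nat by lia. apply pow_1_even. Qed.

(** For [v = root_sqr j] and [N = 2 M], [(- v)^N = -1], so [X^N + 1] is [X + v] times a geometric
    polynomial [G] in [X] and [- v]. Hence [1 / (X + v) = G / (X^N + 1)], and the sum over [j]
    reduces to power sums of the roots. *)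
Lemma root_sum (M s : nat) (X : R) :
  (0 < M)%nat -> (s = 0 \/ s = M)%nat ->
  (forall j, (X + root_sqr (2 * M) j)%C <> 0) ->
  csum (2 * M) (fun j => root_sqr (2 * M) j ^ (S s) / (X + root_sqr (2 * M) j))%C =
  (RtoC (INR (2 * M) * (if Nat.eqb s 0 then 1 else (-1) ^ M * X ^ M) / (X ^ (2 * M) + 1))).
Proof.
  intros HM Hs Hnz. set (N := (2 * M)%nat).
  assert (HN : (0 < N)%nat) by (unfold N; lia).
  assert (HX : 0 < X ^ N + 1).
  { unfold N. rewrite pow_mult. assert (0 <= (X ^ 2) ^ M) by (apply pow_le, pow2_ge_0). lra. }
  assert (HXc : RtoC (X ^ N + 1) <> 0) by (apply RtoC_neq_0; lra).
  assert (E : forall j, (root_sqr N j ^ (S s) / (X + root_sqr N j))%C =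
     (/ RtoC (X ^ N + 1) * csum N (fun k => RtoC (X ^ k * (-1) ^ (N - 1 - k)) * root_sqr N j ^ (N - k + s)))%C).
  { intros j. assert (H := geometric_factor N (RtoC X) (- root_sqr N j)%C).
    rewrite Cpow_opp, root_sqr_pow_N, <- RtoC_pow in H by exact HN.
    assert (E1 : (-1) ^ N = 1) by apply pow_1_even. rewrite E1 in H.
    replace (RtoC (X ^ N) - 1 * -1)%C with (RtoC (X ^ N + 1)) in H by (rewrite RtoC_plus; ring).
    rewrite H.
    set (G := csum N (fun k => (RtoC X) ^ k * (- root_sqr N j) ^ (N - 1 - k))%C) in *.
    assert (HG : G <> 0) by (intros E; apply HXc; rewrite H, E; ring).
    replace (csum N _) with (root_sqr N j ^ S s * G)%C.
    - specialize (Hnz j). fold N in Hnz. field. split; auto. intros E. apply Hnz. rewrite <- E. ring.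
    - unfold G. rewrite <- csum_scal. apply csum_ext. intros k Hk.
      rewrite Cpow_opp, RtoC_mult, <- !RtoC_pow.
      replace (N - k + s)%nat with (S s + (N - 1 - k))%nat by lia.
      rewrite Cpow_add_r. ring. }
  rewrite (csum_ext N _ _ (fun j _ => E j)), csum_scal, csum_swap.
  assert (E2 : forall k, (k < N)%nat ->
    csum N (fun j => RtoC (X ^ k * (-1) ^ (N - 1 - k)) * root_sqr N j ^ (N - k + s))%C =
    (RtoC (X ^ k * (-1) ^ (N - 1 - k)) * (if Nat.eqb (N - k + s) N then - RtoC (INR N) else 0))%C).
  { intros k Hk. rewrite csum_scal. rewrite root_power_sum by (unfold N in *; lia). reflexivity. }
  (* The exponent [N - k + s] equals [N] only for [k = s], so one monomial [X^s] survives: 1 for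
     [s = 0], [X^M] for [s = M]. *)
  rewrite (csum_ext N _ _ E2), (csum_single N s).
  - replace (N - s + s)%nat with N by (unfold N; lia). rewrite Nat.eqb_refl.
    unfold Rdiv. rewrite (RtoC_mult (INR N * _)), RtoC_inv by lra.
    rewrite <- RtoC_opp, <- RtoC_mult. rewrite Cmult_comm. f_equal. f_equal.
    destruct Hs as [->| ->].
    + simpl (Nat.eqb 0 0). replace (N - 1 - 0)%nat with (S (2 * (M - 1))) by (unfold N; lia).
      rewrite pow_1_odd. ring.
    + rewrite (proj2 (Nat.eqb_neq M 0)) by lia.
      assert (Ep : (-1) ^ (N - 1 - M) * (-1) ^ M = -1).
      { rewrite <- pow_add. replace (N - 1 - M + M)%nat with (S (2 * (M - 1))) by (unfold N; lia).
        apply pow_1_odd. }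
      assert (Em := pow_m1_sqr M).
      replace ((-1) ^ (N - 1 - M)) with (- (-1) ^ M); [ring|].
      transitivity ((-1) ^ (N - 1 - M) * ((-1) ^ M * (-1) ^ M)); [|rewrite Em; ring].
      rewrite <- Rmult_assoc, Ep. ring.
  - unfold N; lia.
  - intros i Hi Hne. replace (Nat.eqb (N - i + s) N) with false; [ring|].
    symmetry. apply Nat.eqb_neq. lia.
Qed.

Lemma root_sum_Re (M s : nat) (X : R) :
  (0 < M)%nat -> (s = 0 \/ s = M)%nat ->
  (forall j, (X + root_sqr (2 * M) j)%C <> 0) ->
  nsum (2 * M) (fun j => Re (root_sqr (2 * M) j ^ (S s) / (X + root_sqr (2 * M) j))%C) =
  INR (2 * M) * (if Nat.eqb s 0 then 1 else (-1) ^ M * X ^ M) / (X ^ (2 * M) + 1).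
Proof. intros H1 H2 H3. exact (f_equal Re (root_sum M s X H1 H2 H3)). Qed.

Lemma nsum_fold (M : nat) (f : nat -> R) :
  (forall j, (j < M)%nat -> f (2 * M - 1 - j)%nat = f j) -> nsum (2 * M) f = 2 * nsum M f.
Proof.
  intros H. replace (2 * M)%nat with (M + M)%nat at 1 by lia.
  rewrite nsum_add, (nsum_rev M (fun i => f (M + i)%nat)).
  rewrite (nsum_ext M (fun i => f (M + (M - 1 - i))%nat) f); [ring|].
  intros j Hj. rewrite <- (H j Hj). f_equal. lia.
Qed.

(** Pairing conjugate roots halves the sum and leaves the indices [j < M], whose [root] has positive
    real part; the coth expansion was proved in that half plane. *)
Lemma root_sqr_reflect (M j : nat) :
  (j < 2 * M)%nat -> root_sqr (2 * M) (2 * M - 1 - j) = Cconj (root_sqr (2 * M) j).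
Proof.
  intros Hj. assert (HMr : 0 < INR M) by (apply lt_0_INR; lia).
  unfold root_sqr.
  replace (2 * root_arg (2 * M) (2 * M - 1 - j)) with (- (2 * root_arg (2 * M) j) + 2 * INR 1 * PI).
  - unfold cis. rewrite cos_period, sin_period, cos_neg, sin_neg. reflexivity.
  - unfold root_arg. rewrite !minus_INR, mult_INR by lia. simpl INR. field. lra.
Qed.

Lemma Cconj_div' (u v : C) : v <> 0 -> Cconj (u / v) = (Cconj u / Cconj v)%C.
Proof. intros H. unfold Cdiv. now rewrite Cmult_conj, Cinv_conj. Qed.

Definition pf_term (N : nat) (X : R) (j : nat) : C := (root_sqr N j / (X + root_sqr N j))%C.

Lemma pf_term_reflect (M j : nat) (X : R) :
  (j < 2 * M)%nat -> (X + root_sqr (2 * M) j)%C <> 0 ->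
  pf_term (2 * M) X (2 * M - 1 - j) = Cconj (pf_term (2 * M) X j).
Proof.
  intros Hj Hn. unfold pf_term. rewrite root_sqr_reflect, Cconj_div' by auto.
  f_equal. rewrite Cplus_conj. f_equal. unfold Cconj, RtoC. simpl. f_equal; ring.
Qed.

Lemma root_sqr_shift_neq_0 (M j : nat) (X : R) :
  (0 < M)%nat -> (X + root_sqr (2 * M) j)%C <> 0.
Proof.
  intros HM E.
  assert (E' : root_sqr (2 * M) j = RtoC (- X)).
  { replace (root_sqr (2 * M) j) with ((X + root_sqr (2 * M) j) - X)%C by ring.
    rewrite E, RtoC_opp. ring. }
  assert (H := root_sqr_pow_N (2 * M) j ltac:(lia)). rewrite E', <- RtoC_pow in H.
  assert (H' : (- X) ^ (2 * M) = -1) by exact (f_equal Re H). rewrite pow_mult in H'.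
  assert (0 <= ((- X) ^ 2) ^ M) by (apply pow_le, pow2_ge_0). lra.
Qed.

Lemma partial_fraction_one (M : nat) (X : R) :
  (0 < M)%nat ->
  / (X ^ (2 * M) + 1) = 2 / INR (2 * M) * nsum M (fun j => Re (pf_term (2 * M) X j)).
Proof.
  intros HM. assert (HNr : 0 < INR (2 * M)) by (apply lt_0_INR; lia).
  assert (Hnz := fun j => root_sqr_shift_neq_0 M j X HM).
  assert (E := root_sum_Re M 0 X HM (or_introl eq_refl) Hnz).
  rewrite nsum_fold in E.
  - simpl (Nat.eqb 0 0) in E.
    rewrite (nsum_ext M (fun j => Re (pf_term (2 * M) X j))
       (fun i => Re (root_sqr (2 * M) i ^ 1 / (X + root_sqr (2 * M) i)))).
    2:{ intros j _. now rewrite Cpow_1_r. }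
    assert (HX : 0 < X ^ (2 * M) + 1).
    { rewrite pow_mult. assert (0 <= (X ^ 2) ^ M) by (apply pow_le, pow2_ge_0). lra. }
    transitivity (/ INR (2 * M) * (INR (2 * M) * 1 / (X ^ (2 * M) + 1))); [field; lra|].
    rewrite <- E. field. lra.
  - intros j Hj. rewrite !Cpow_1_r. change (Re (pf_term (2 * M) X (2 * M - 1 - j)) = Re (pf_term (2 * M) X j)).
    rewrite pf_term_reflect by (lia || auto). reflexivity.
Qed.

Lemma partial_fraction_pow (M : nat) (X : R) :
  (0 < M)%nat ->
  X ^ M / (X ^ (2 * M) + 1) =
  2 / INR (2 * M) * nsum M (fun j => (-1) ^ (M + j + 1) * Im (pf_term (2 * M) X j)).
Proof.
  intros HM. assert (HNr : 0 < INR (2 * M)) by (apply lt_0_INR; lia).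
  assert (Hnz := fun j => root_sqr_shift_neq_0 M j X HM).
  assert (E := root_sum_Re M M X HM (or_intror eq_refl) Hnz).
  assert (ET : forall j, Re (root_sqr (2 * M) j ^ S M / (X + root_sqr (2 * M) j))
                 = - (-1) ^ j * Im (pf_term (2 * M) X j)).
  { intros j. rewrite Cpow_S, root_sqr_pow_half by exact HM.
    simpl Re at 1. simpl Im at 1. ring. }
  rewrite (nsum_ext _ _ _ (fun j _ => ET j)), nsum_fold in E.
  - rewrite (proj2 (Nat.eqb_neq M 0)) in E by lia.
    assert (HX : 0 < X ^ (2 * M) + 1).
    { rewrite pow_mult. assert (0 <= (X ^ 2) ^ M) by (apply pow_le, pow2_ge_0). lra. }
    assert (Em := pow_m1_sqr M).
    rewrite (nsum_ext M (fun j => (-1) ^ (M + j + 1) * Im (pf_term (2 * M) X j))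
       (fun j => (-1) ^ M * (- (-1) ^ j * Im (pf_term (2 * M) X j)))).
    2:{ intros j _. rewrite !pow_add. ring. }
    rewrite nsum_scal.
    transitivity (/ INR (2 * M) * (-1) ^ M * (INR (2 * M) * ((-1) ^ M * X ^ M) / (X ^ (2 * M) + 1))).
    + transitivity ((-1) ^ M * (-1) ^ M * (X ^ M / (X ^ (2 * M) + 1))); [rewrite Em; ring|field; lra].
    + rewrite <- E. field. lra.
  - intros j Hj. rewrite pf_term_reflect by (lia || auto).
    assert (Ep : (-1) ^ (2 * M - 1 - j) * (-1) ^ j = -1).
    { rewrite <- pow_add. replace (2 * M - 1 - j + j)%nat with (S (2 * (M - 1))) by lia. apply pow_1_odd. }
    assert (Ej := pow_m1_sqr j).
    replace ((-1) ^ (2 * M - 1 - j)) with (- (-1) ^ j); [simpl; ring|].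
    transitivity ((-1) ^ (2 * M - 1 - j) * ((-1) ^ j * (-1) ^ j)); [|rewrite Ej; ring].
    rewrite <- Rmult_assoc, Ep. ring.
Qed.

(** * Sums over the lattice points [c n^N] through coth *)

Definition root (N j : nat) : C := cis (root_arg N j).

Lemma root_sqr_root (N j : nat) : root_sqr N j = (root N j * root N j)%C.
Proof.
  unfold root_sqr, root, cis. rewrite cos_2a, sin_2a. apply injective_projections; simpl; ring.
Qed.

Lemma root_Re_pos (M j : nat) : (j < M)%nat -> 0 < Re (root (2 * M) j).
Proof.
  intros Hj. change (0 < cos (root_arg (2 * M) j)).
  assert (HPI := PI_RGT_0). assert (Hj0 := pos_INR j).
  assert (H1 : 2 * INR j + 1 < 2 * INR M).
  { replace 1 with (INR 1) by reflexivity. replace 2 with (INR 2) by reflexivity.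
    rewrite <- !mult_INR, <- plus_INR. apply lt_INR. lia. }
  unfold root_arg. rewrite mult_INR. simpl (INR 2).
  apply cos_gt_0.
  - apply Rlt_trans with 0; [lra|]. apply Rdiv_lt_0_compat; [|lra]. apply Rmult_lt_0_compat; lra.
  - apply (Rmult_lt_reg_r (2 * (2 * INR M))); [lra|].
    unfold Rdiv. rewrite Rmult_assoc, Rinv_l by lra. nra.
Qed.

Definition coth_sum (z : C) : C := (z / 4 - 1 / 2 + z / 2 / (Cexp z - 1))%C.

(** Multiplying numerator and denominator by [(2 PI Bs)^2] turns [w^2 / ((n / Bs)^2 + w^2)] into
    [z^2 / (z^2 + (2 PI n)^2)] with [z = 2 PI Bs w]. *)
Lemma csums_pf_term (M j : nat) (Bs : R) :
  (j < M)%nat -> 0 < Bs ->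
  csums (fun n => pf_term (2 * M) ((INR n / Bs) ^ 2) j) (coth_sum (RtoC (2 * PI * Bs) * root (2 * M) j)).
Proof.
  intros Hj HB. assert (HPI := PI_RGT_0).
  set (w := root (2 * M) j). set (z := (RtoC (2 * PI * Bs) * w)%C).
  assert (HpB : 0 < 2 * PI * Bs) by (apply Rmult_lt_0_compat; lra).
  assert (Hz : 0 < Re z).
  { unfold z. rewrite re_scal_l. apply Rmult_lt_0_compat; [exact HpB|now apply root_Re_pos]. }
  eapply csums_ext; [|exact (csums_coth z Hz)].
  intros n Hn. unfold pf_term. rewrite root_sqr_root. fold w.
  assert (HnX := root_sqr_shift_neq_0 M j ((INR n / Bs) ^ 2) ltac:(lia)).
  rewrite root_sqr_root in HnX.
  assert (E : (z * z + RtoC (freq n ^ 2))%C = (RtoC ((2 * PI * Bs) ^ 2) * (RtoC ((INR n / Bs) ^ 2) + w * w))%C).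
  { unfold z, freq. replace ((2 * PI * INR n) ^ 2) with ((2 * PI * Bs) ^ 2 * (INR n / Bs) ^ 2) by (field; lra).
    rewrite (RtoC_mult ((2 * PI * Bs) ^ 2)), (RtoC_pow (2 * PI * Bs)). ring. }
  rewrite E. unfold z. rewrite RtoC_pow. field. split; [exact HnX|].
  apply RtoC_neq_0. lra.
Qed.

(* Below, [Bs ^ (2 M) = b / c] matches the frequency [b] with the points [c n ^ (2 M)]. *)
Definition lattice_cos (M : nat) : R := nsum M (fun j => (-1) ^ (M + j + 1) * Im (root (2 * M) j)).
Definition lattice_sin (M : nat) : R := nsum M (fun j => Re (root (2 * M) j)).
Definition lattice_exp (M : nat) (Bs : R) (j : nat) : C :=
  (root (2 * M) j / (Cexp (RtoC (2 * PI * Bs) * root (2 * M) j) - 1))%C.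
Definition lattice_exp_cos (M : nat) (Bs : R) : R :=
  nsum M (fun j => (-1) ^ (M + j + 1) * Im (lattice_exp M Bs j)).
Definition lattice_exp_sin (M : nat) (Bs : R) : R := nsum M (fun j => Re (lattice_exp M Bs j)).

(** The three summands have separate fates: the linear one becomes an integral, the second is
    exponentially small in [Bs], and the constant is the contribution at [n = 0]. *)
Lemma coth_sum_parts (M j : nat) (Bs : R) :
  (j < M)%nat -> 0 < Bs ->
  coth_sum (RtoC (2 * PI * Bs) * root (2 * M) j) =
  (RtoC (PI * Bs / 2) * root (2 * M) j + RtoC (PI * Bs) * lattice_exp M Bs j + RtoC (- (1 / 2)))%C.
Proof.
  intros Hj HB. assert (HPI := PI_RGT_0).
  unfold coth_sum, lattice_exp.
  set (E := Cexp _).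
  assert (HE : (E - 1)%C <> 0).
  { apply Cexp_neq_1. rewrite re_scal_l. apply Rmult_lt_0_compat; [apply Rmult_lt_0_compat; lra|].
    now apply root_Re_pos. }
  replace (PI * Bs / 2) with (/ 2 * (PI * Bs)) by field.
  replace (- (1/2)) with (- / 2) by field.
  replace (2 * PI * Bs) with (2 * (PI * Bs)) by ring.
  rewrite RtoC_opp, !(RtoC_mult _ (PI * Bs)), RtoC_Rinv.
  field. auto.
Qed.

Lemma lattice_y (M n : nat) (c b Bs : R) :
  0 < c -> 0 < b -> Bs ^ (2 * M) = b / c -> c * INR n ^ (2 * M) = b * ((INR n / Bs) ^ 2) ^ M.
Proof.
  intros Hc Hb HBN. rewrite <- pow_mult. unfold Rdiv. rewrite Rpow_mult_distr, pow_inv, HBN.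
  field. lra.
Qed.

Lemma lattice_y_sqr (M n : nat) (c b Bs : R) :
  0 < c -> 0 < b -> Bs ^ (2 * M) = b / c ->
  (c * INR n ^ (2 * M)) ^ 2 + b ^ 2 = b ^ 2 * (((INR n / Bs) ^ 2) ^ (2 * M) + 1).
Proof.
  intros Hc Hb HBN. rewrite (lattice_y M n c b Bs) by auto. replace (2 * M)%nat with (M + M)%nat by lia. rewrite pow_add. ring.
Qed.

Lemma lattice_half (M : nat) : (0 < M)%nat -> 2 / INR (2 * M) * nsum M (fun _ => - (1 / 2)) = - (1 / 2).
Proof.
  intros HM. assert (HMr : 0 < INR M) by (now apply lt_0_INR).
  rewrite nsum_const, mult_INR. simpl (INR 2). field. lra.
Qed.

Lemma sums_lattice_sin (M : nat) (c b Bs : R) :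
  (0 < M)%nat -> 0 < c -> 0 < b -> 0 < Bs -> Bs ^ (2 * M) = b / c ->
  sums (fun n => b / ((c * INR n ^ (2 * M)) ^ 2 + b ^ 2))
    (PI * Bs / (b * INR (2 * M)) * (lattice_sin M + 2 * lattice_exp_sin M Bs) - 1 / (2 * b)).
Proof.
  intros HM Hc Hb HB HBN. assert (HNr : 0 < INR (2 * M)) by (apply lt_0_INR; lia).
  assert (H : sums (fun n => nsum M (fun j => Re (pf_term (2 * M) ((INR n / Bs) ^ 2) j)))
    (nsum M (fun j => PI * Bs / 2 * Re (root (2 * M) j) + PI * Bs * Re (lattice_exp M Bs j) + - (1 / 2)))).
  { apply (sums_nsum M (fun j n => Re (pf_term (2 * M) ((INR n / Bs) ^ 2) j))). intros j Hj.
    destruct (csums_pf_term M j Bs Hj HB) as [H _].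
    rewrite coth_sum_parts in H by auto.
    eapply sums_eq; [|exact H]. rewrite !re_plus, !re_scal_l. reflexivity. }
  apply (sums_scal (/ b * (2 / INR (2 * M)))) in H.
  eapply sums_eq; [|eapply sums_ext; [|exact H]].
  - rewrite !nsum_plus, !nsum_scal. fold (lattice_sin M) (lattice_exp_sin M Bs).
    assert (E := lattice_half M HM).
    transitivity (/ b * (2 / INR (2 * M)) * (PI * Bs / 2 * lattice_sin M + PI * Bs * lattice_exp_sin M Bs)
       + / b * (2 / INR (2 * M) * nsum M (fun _ => - (1 / 2)))); [ring|].
    rewrite E. field. lra.
  - intros n Hn. cbv beta. rewrite Rmult_assoc, <- partial_fraction_one by exact HM.
    rewrite (lattice_y_sqr M n c b Bs) by auto.
    assert (0 <= (((INR n / Bs) ^ 2) ^ (2 * M))) by (apply pow_le, pow2_ge_0).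
    field. lra.
Qed.

(** Only imaginary parts enter, so the real constant [- 1/2] of the coth expansion drops out;
    accordingly this summand vanishes at [n = 0]. *)
Lemma sums_lattice_cos (M : nat) (c b Bs : R) :
  (0 < M)%nat -> 0 < c -> 0 < b -> 0 < Bs -> Bs ^ (2 * M) = b / c ->
  sums (fun n => c * INR n ^ (2 * M) / ((c * INR n ^ (2 * M)) ^ 2 + b ^ 2))
    (PI * Bs / (b * INR (2 * M)) * (lattice_cos M + 2 * lattice_exp_cos M Bs)).
Proof.
  intros HM Hc Hb HB HBN. assert (HNr : 0 < INR (2 * M)) by (apply lt_0_INR; lia).
  assert (H : sums (fun n => nsum M (fun j => (-1) ^ (M + j + 1) * Im (pf_term (2 * M) ((INR n / Bs) ^ 2) j)))
    (nsum M (fun j => PI * Bs / 2 * ((-1) ^ (M + j + 1) * Im (root (2 * M) j))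
      + PI * Bs * ((-1) ^ (M + j + 1) * Im (lattice_exp M Bs j))))).
  { apply (sums_nsum M (fun j n => (-1) ^ (M + j + 1) * Im (pf_term (2 * M) ((INR n / Bs) ^ 2) j))). intros j Hj.
    destruct (csums_pf_term M j Bs Hj HB) as [_ H].
    rewrite coth_sum_parts in H by auto.
    apply (sums_scal ((-1) ^ (M + j + 1))) in H.
    eapply sums_eq; [|exact H]. rewrite !im_plus, !im_scal_l. simpl (Im (RtoC _)). ring. }
  apply (sums_scal (/ b * (2 / INR (2 * M)))) in H.
  eapply sums_eq; [|eapply sums_ext; [|exact H]].
  - rewrite !nsum_plus, !nsum_scal. fold (lattice_cos M) (lattice_exp_cos M Bs). field. lra.
  - intros n Hn. cbv beta. rewrite Rmult_assoc, <- partial_fraction_pow by exact HM.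
    rewrite (lattice_y_sqr M n c b Bs), (lattice_y M n c b Bs) by auto.
    assert (0 <= (((INR n / Bs) ^ 2) ^ (2 * M))) by (apply pow_le, pow2_ge_0).
    field. lra.
Qed.

(** * Improper integrals over the half line *)

Definition int0oo (g : R -> R) (l : R) : Prop :=
  is_RInt_gen g (at_right 0) (Rbar_locally p_infty) l.

Lemma filter_prod_0oo (P : R -> R -> Prop) (e X : R) :
  0 < e -> (forall u v, 0 < u < e -> X < v -> 0 < v -> P u v) ->
  filter_prod (at_right 0) (Rbar_locally p_infty) (fun ab => P (fst ab) (snd ab)).
Proof.
  intros He H.
  apply (Filter_prod _ _ _ (fun u => 0 < u < e) (fun v => Rmax X 0 < v)).
  - exists (mkposreal e He). intros u Hu Hu0. split; [exact Hu0|].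
    unfold ball in Hu. simpl in Hu. unfold AbsRing_ball, abs, minus, plus, opp in Hu. simpl in Hu.
    apply Rabs_def2 in Hu. lra.
  - exists (Rmax X 0). auto.
  - intros u v Hu Hv. assert (H1 := Rmax_l X 0). assert (H2 := Rmax_r X 0). apply H; simpl; lra.
Qed.

Lemma int0oo_spec (g : R -> R) (l : R) :
  int0oo g l <-> forall eps, 0 < eps -> exists d X, 0 < d /\
    forall u v, 0 < u < d -> X < v -> 0 < v -> exists I, is_RInt g u v I /\ Rabs (I - l) < eps.
Proof.
  split.
  - intros H eps He.
    destruct (H (fun I => Rabs (I - l) < eps)) as [Q1 Q2 H1 H2 H3].
    { exists (mkposreal eps He). intros x Hx. exact Hx. }
    destruct H1 as [d Hd]. destruct H2 as [X HX].
    exists d, X. split; [apply cond_pos|]. intros u v Hu Hv _.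
    apply (H3 u v); [|now apply HX].
    apply Hd; [|lra]. unfold ball. simpl. unfold AbsRing_ball, abs, minus, plus, opp. simpl.
    apply Rabs_def1; lra.
  - intros H P [eps HP]. destruct (H eps (cond_pos eps)) as [d [X [Hd HX]]].
    apply (filter_prod_0oo (fun u v => exists y, is_RInt g u v y /\ P y) d X); auto.
    intros u v Hu Hv Hv0. destruct (HX u v Hu Hv Hv0) as [I [HI1 HI2]].
    exists I. split; [exact HI1|]. apply HP. exact HI2.
Qed.

Lemma int0oo_unique (g : R -> R) (l l' : R) : int0oo g l -> int0oo g l' -> l = l'.
Proof.
  intros H H'. rewrite <- (is_RInt_gen_unique _ _ H). now apply is_RInt_gen_unique.
Qed.

Lemma int0oo_eq (g : R -> R) (l l' : R) : l = l' -> int0oo g l -> int0oo g l'.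
Proof. now intros ->. Qed.

Lemma int0oo_ext (f g : R -> R) (l : R) :
  (forall x, 0 < x -> f x = g x) -> int0oo f l -> int0oo g l.
Proof.
  intros H. apply is_RInt_gen_ext.
  apply (filter_prod_0oo (fun u v => forall x, Rmin u v < x < Rmax u v -> f x = g x) 1 0); [lra|].
  intros u v Hu Hv _ x Hx. apply H. apply Rlt_trans with (Rmin u v); [|tauto].
  apply Rmin_glb_lt; lra.
Qed.

Lemma int0oo_plus (f g : R -> R) (l l' : R) :
  int0oo f l -> int0oo g l' -> int0oo (fun x => f x + g x) (l + l').
Proof. intros H H'. exact (is_RInt_gen_plus _ _ _ _ H H'). Qed.

Lemma int0oo_minus (f g : R -> R) (l l' : R) :
  int0oo f l -> int0oo g l' -> int0oo (fun x => f x - g x) (l - l').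
Proof. intros H H'. exact (is_RInt_gen_minus _ _ _ _ H H'). Qed.

Lemma int0oo_scal (c : R) (f : R -> R) (l : R) : int0oo f l -> int0oo (fun x => c * f x) (c * l).
Proof. intros H. exact (is_RInt_gen_scal _ c _ H). Qed.

Lemma int0oo_zero : int0oo (fun _ => 0) 0.
Proof.
  apply int0oo_spec. intros eps He. exists 1, 0. split; [lra|]. intros u v _ _ _. exists 0.
  split; [|rewrite Rminus_0_r, Rabs_R0; exact He].
  assert (H := is_RInt_const (V := R_NormedModule) u v 0).
  match type of H with is_RInt _ _ _ ?t => assert (E : t = 0) by apply Rmult_0_r; rewrite E in H end. exact H.
Qed.

Lemma int0oo_nsum (n : nat) (f : nat -> R -> R) (l : nat -> R) :
  (forall i, (i < n)%nat -> int0oo (f i) (l i)) ->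
  int0oo (fun x => nsum n (fun i => f i x)) (nsum n l).
Proof.
  induction n as [|n IH]; intros H; [exact int0oo_zero|].
  rewrite nsum_S. eapply int0oo_ext; [intros x _; symmetry; apply nsum_S|].
  apply int0oo_plus; [apply IH; intros|]; apply H; lia.
Qed.

Lemma int0oo_Rabs_le (f g : R -> R) (l l' : R) :
  (forall x, 0 < x -> Rabs (f x) <= g x) -> int0oo f l -> int0oo g l' -> Rabs l <= l'.
Proof.
  intros H Hf Hg.
  apply (RInt_gen_norm (V := R_CompleteNormedModule) (Fa := at_right 0) (Fb := Rbar_locally p_infty) f g l l'); auto.
  - apply (filter_prod_0oo (fun u v => u <= v) 1 1); [lra|]. intros; lra.
  - apply (filter_prod_0oo (fun u v => forall x, u <= x <= v -> norm (f x) <= g x) 1 1); [lra|].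
    intros u v Hu Hv _ x Hx. apply H. lra.
Qed.

Definition cont_pos (g : R -> R) : Prop := forall x, 0 < x -> continuous g x.

Lemma cont_pos_ex_RInt (g : R -> R) (u v : R) : cont_pos g -> 0 < u -> 0 < v -> ex_RInt g u v.
Proof.
  intros Hg Hu Hv. apply (ex_RInt_continuous (V := R_CompleteNormedModule)). intros x Hx. apply Hg.
  apply Rlt_le_trans with (Rmin u v); [|tauto]. now apply Rmin_glb_lt.
Qed.

Lemma RInt_mono_interval (g : R -> R) (u u' v v' : R) :
  cont_pos g -> (forall x, 0 < x -> 0 <= g x) -> 0 < u' -> u' <= u -> u <= v -> v <= v' ->
  RInt g u v <= RInt g u' v'.
Proof.
  intros Hc Hp Hu' Hu Huv Hv.
  rewrite <- (RInt_Chasles g u' u v') by (apply cont_pos_ex_RInt; auto; lra).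
  rewrite <- (RInt_Chasles g u v v') by (apply cont_pos_ex_RInt; auto; lra).
  assert (0 <= RInt g u' u).
  { apply RInt_ge_0; [lra|apply cont_pos_ex_RInt; auto; lra|]. intros; apply Hp; lra. }
  assert (0 <= RInt g v v').
  { apply RInt_ge_0; [lra|apply cont_pos_ex_RInt; auto; lra|]. intros; apply Hp; lra. }
  unfold plus. simpl. lra.
Qed.

Lemma int0oo_exists_pos (g : R -> R) (C0 : R) :
  cont_pos g -> (forall x, 0 < x -> 0 <= g x) ->
  (forall u v, 0 < u <= v -> RInt g u v <= C0) -> exists l, int0oo g l.
Proof.
  intros Hc Hp HC.
  destruct (completeness (fun r => exists u v, 0 < u <= v /\ r = RInt g u v)) as [l [Hl1 Hl2]].
  - exists C0. intros r [u [v [H ->]]]. now apply HC.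
  - exists (RInt g 1 1), 1, 1. split; [lra|reflexivity].
  - exists l. apply int0oo_spec. intros eps He.
    assert (Hex : exists u v, 0 < u <= v /\ l - eps < RInt g u v).
    { apply NNPP. intros Hn. assert (Hb : l <= l - eps); [|lra]. apply Hl2.
      intros r [u [v [H ->]]]. apply Rnot_lt_le. intros Hlt. apply Hn. now exists u, v. }
    destruct Hex as [u [v [Huv Hgt]]]. exists u, v. split; [lra|].
    intros u' v' Hu' Hv' Hv0. exists (RInt g u' v'). split.
    + apply (RInt_correct (V := R_CompleteNormedModule)), cont_pos_ex_RInt; auto; lra.
    + assert (RInt g u v <= RInt g u' v') by (apply RInt_mono_interval; auto; lra).
      assert (RInt g u' v' <= l) by (apply Hl1; exists u', v'; split; [lra|reflexivity]).
      apply Rabs_def1; lra.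
Qed.

Lemma RInt_le_int0oo (g : R -> R) (l u v : R) :
  cont_pos g -> (forall x, 0 < x -> 0 <= g x) -> int0oo g l -> 0 < u <= v -> RInt g u v <= l.
Proof.
  intros Hc Hp Hg Huv. apply Rnot_lt_le. intros Hlt.
  destruct (proj1 (int0oo_spec g l) Hg (RInt g u v - l) ltac:(lra)) as [d [X [Hd H]]].
  set (u' := Rmin (d / 2) u). set (v' := Rmax (X + 1) v).
  assert (Hu' : 0 < u') by (apply Rmin_glb_lt; lra).
  assert (Hu1 := Rmin_l (d / 2) u). assert (Hu2 := Rmin_r (d / 2) u).
  assert (Hv1 := Rmax_l (X + 1) v). assert (Hv2 := Rmax_r (X + 1) v). fold u' in Hu1, Hu2. fold v' in Hv1, Hv2.
  destruct (H u' v') as [I [HI1 HI2]]; try lra.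
  rewrite <- (is_RInt_unique _ _ _ _ HI1) in HI2. apply Rabs_def2 in HI2.
  assert (RInt g u v <= RInt g u' v') by (apply RInt_mono_interval; auto; lra). lra.
Qed.

(** The function [g + h] lies between 0 and [2 h], so its integral exists as a supremum over compact
    intervals; that of [h] is then subtracted. *)
Lemma int0oo_dom (g h : R -> R) (l : R) :
  cont_pos g -> cont_pos h -> (forall x, 0 < x -> Rabs (g x) <= h x) -> int0oo h l ->
  exists l', int0oo g l' /\ Rabs l' <= l.
Proof.
  intros Hg Hh Hgh Hl.
  assert (Hh0 : forall x, 0 < x -> 0 <= h x).
  { intros x Hx. eapply Rle_trans; [apply Rabs_pos|apply (Hgh x Hx)]. }
  destruct (int0oo_exists_pos (fun x => g x + h x) (2 * l)) as [s Hs].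
  - intros x Hx. apply (continuous_plus (V := R_NormedModule)); auto.
  - intros x Hx. specialize (Hgh x Hx). apply Rabs_le_between in Hgh. lra.
  - intros u v Huv.
    apply Rle_trans with (RInt (fun x => 2 * h x) u v).
    + apply RInt_le; [lra| | |].
      * apply cont_pos_ex_RInt; try lra. intros x Hx. apply (continuous_plus (V := R_NormedModule)); auto.
      * apply cont_pos_ex_RInt; try lra. intros x Hx. apply (continuous_scal_r (V := R_NormedModule) 2 h). auto.
      * intros x Hx. specialize (Hgh x ltac:(lra)). apply Rabs_le_between in Hgh. lra.
    + assert (E : RInt (fun x => 2 * h x) u v = 2 * RInt h u v).
      { apply (RInt_scal (V := R_CompleteNormedModule) h u v 2). apply cont_pos_ex_RInt; auto; lra. }
      rewrite E. apply Rmult_le_compat_l; [lra|]. now apply RInt_le_int0oo.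
  - exists (s - l). assert (H : int0oo g (s - l)).
    { eapply int0oo_ext; [|exact (int0oo_minus _ _ _ _ Hs Hl)]. intros x _. cbv beta. ring. }
    split; [exact H|]. now apply (int0oo_Rabs_le g h).
Qed.

Definition lim0 (F : R -> R) (l : R) : Prop :=
  forall eps, 0 < eps -> exists d, 0 < d /\ forall u, 0 < u < d -> Rabs (F u - l) < eps.
Definition limoo (F : R -> R) (l : R) : Prop :=
  forall eps, 0 < eps -> exists X, forall v, X < v -> 0 < v -> Rabs (F v - l) < eps.

Lemma int0oo_derive (F g : R -> R) (l0 l1 : R) :
  (forall x, 0 < x -> is_derive F x (g x)) -> cont_pos g -> lim0 F l0 -> limoo F l1 ->
  int0oo g (l1 - l0).
Proof.
  intros HF Hg H0 H1. apply int0oo_spec. intros eps He.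
  destruct (H0 (eps / 2)) as [d [Hd Hd']]; [lra|]. destruct (H1 (eps / 2)) as [X HX]; [lra|].
  exists d, X. split; [exact Hd|]. intros u v Hu Hv Hv0. exists (F v - F u). split.
  - apply (is_RInt_derive (V := R_CompleteNormedModule) F g); intros x Hx.
    + apply HF. apply Rlt_le_trans with (Rmin u v); [|tauto]. apply Rmin_glb_lt; lra.
    + apply Hg. apply Rlt_le_trans with (Rmin u v); [|tauto]. apply Rmin_glb_lt; lra.
  - specialize (Hd' u Hu). specialize (HX v Hv Hv0).
    apply Rabs_def2 in Hd'. apply Rabs_def2 in HX. apply Rabs_def1; lra.
Qed.

Lemma int0oo_comp (g phi dphi : R -> R) (l : R) :
  cont_pos g -> int0oo g l ->
  (forall x, 0 < x -> 0 < phi x) ->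
  (forall x, 0 < x -> is_derive phi x (dphi x)) -> cont_pos dphi ->
  lim0 phi 0 -> (forall A, exists X, forall x, X < x -> 0 < x -> A < phi x) ->
  int0oo (fun x => dphi x * g (phi x)) l.
Proof.
  intros Hg Hl Hp Hd Hdc H0 H1. apply int0oo_spec. intros eps He.
  destruct (proj1 (int0oo_spec g l) Hl eps He) as [d [X [Hdp H]]].
  destruct (H0 d Hdp) as [d' [Hd' Hd'']]. destruct (H1 X) as [X' HX'].
  exists d', X'. split; [exact Hd'|]. intros u v Hu Hv Hv0.
  destruct (H (phi u) (phi v)) as [I [HI1 HI2]].
  - specialize (Hd'' u Hu). specialize (Hp u ltac:(lra)).
    rewrite Rminus_0_r, Rabs_right in Hd''; lra.
  - now apply HX'.
  - now apply Hp.
  - exists I. split; [|exact HI2].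
    rewrite <- (is_RInt_unique _ _ _ _ HI1).
    apply (is_RInt_comp (V := R_CompleteNormedModule) g phi dphi u v); intros x Hx.
    + apply Hg, Hp. apply Rlt_le_trans with (Rmin u v); [|tauto]. apply Rmin_glb_lt; lra.
    + assert (0 < x) by (apply Rlt_le_trans with (Rmin u v); [apply Rmin_glb_lt; lra|tauto]).
      split; auto.
Qed.

(** * Real powers *)

Lemma Rpower_pos (x y : R) : 0 < Rpower x y.
Proof. apply exp_pos. Qed.

Lemma is_derive_Rpower (p x : R) : 0 < x -> is_derive (fun y => Rpower y p) x (p * Rpower x (p - 1)).
Proof. intros Hx. apply is_derive_Reals. now apply derivable_pt_lim_power. Qed.

Lemma continuous_of_derive (f : R -> R) (x l : R) : is_derive f x l -> continuous f x.
Proof. intros H. apply (ex_derive_continuous (V := R_NormedModule)). now exists l. Qed.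

Lemma cont_pos_Rpower (p : R) : cont_pos (fun y => Rpower y p).
Proof. intros x Hx. eapply continuous_of_derive. now apply is_derive_Rpower. Qed.

Lemma cont_pos_mult (f g : R -> R) : cont_pos f -> cont_pos g -> cont_pos (fun x => f x * g x).
Proof. intros Hf Hg x Hx. apply (continuous_mult (K := R_AbsRing)); auto. Qed.

Lemma Rpower_le_1 (x p : R) : 0 < x <= 1 -> 0 <= p -> Rpower x p <= 1.
Proof.
  intros Hx Hp. rewrite <- (Rpower_1 1) by lra.
  assert (H := Rle_Rpower_l x 1 p Hp ltac:(lra)). rewrite Rpower_1 by lra.
  unfold Rpower in H at 2. rewrite ln_1, Rmult_0_r, exp_0 in H. exact H.
Qed.

Lemma lim0_Rpower (F : R -> R) (l C0 p : R) :
  0 < p -> (forall x, 0 < x <= 1 -> Rabs (F x - l) <= C0 * Rpower x p) -> lim0 F l.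
Proof.
  intros Hp H eps He.
  assert (HC : 0 <= C0).
  { assert (H1 := H 1 ltac:(lra)). assert (H2 := Rabs_pos (F 1 - l)).
    assert (0 < Rpower 1 p) by apply Rpower_pos. nra. }
  set (t := eps / (C0 + 1)). assert (Ht : 0 < t) by (apply Rdiv_lt_0_compat; lra).
  exists (Rmin 1 (Rpower t (/ p))). split; [apply Rmin_glb_lt; [lra|apply Rpower_pos]|].
  intros u Hu. assert (Hu1 := Rmin_l 1 (Rpower t (/ p))). assert (Hu2 := Rmin_r 1 (Rpower t (/ p))).
  eapply Rle_lt_trans; [apply H; lra|].
  assert (Hup : Rpower u p < t).
  { replace t with (Rpower (Rpower t (/ p)) p).
    - apply Rlt_Rpower_l; lra.
    - rewrite Rpower_mult, Rinv_l, Rpower_1; lra. }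
  assert (0 < Rpower u p) by apply Rpower_pos.
  apply Rle_lt_trans with ((C0 + 1) * Rpower u p); [nra|].
  replace eps with ((C0 + 1) * t) by (unfold t; field; lra).
  apply Rmult_lt_compat_l; lra.
Qed.

Lemma limoo_Rpower (F : R -> R) (l C0 p : R) :
  p < 0 -> (forall x, 1 <= x -> Rabs (F x - l) <= C0 * Rpower x p) -> limoo F l.
Proof.
  intros Hp H.
  assert (H0 : lim0 (fun x => F (/ x)) l).
  { apply (lim0_Rpower _ l C0 (- p)); [lra|]. intros x Hx.
    replace (Rpower x (- p)) with (Rpower (/ x) p).
    - apply H. rewrite <- Rinv_1. apply Rinv_le_contravar; lra.
    - unfold Rpower. rewrite ln_Rinv by lra. f_equal. ring. }
  intros eps He. destruct (H0 eps He) as [d [Hd Hd']]. exists (/ d). intros v Hv Hv0.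
  rewrite <- (Rinv_inv v). apply Hd'. split; [now apply Rinv_0_lt_compat|].
  rewrite <- (Rinv_inv d). apply Rinv_lt_contravar; [|exact Hv].
  apply Rmult_lt_0_compat; [now apply Rinv_0_lt_compat|exact Hv0].
Qed.

Lemma pow_le_fact_exp (n : nat) (y : R) : 0 <= y -> y ^ n <= INR (fact n) * exp y.
Proof.
  revert y. induction n as [|n IH]; intros y Hy.
  - simpl. assert (H := exp_ineq1_le y). lra.
  - assert (HD : forall t, is_derive (fun t => INR (fact (S n)) * exp t - t ^ S n) t
               (INR (fact (S n)) * exp t - INR (S n) * t ^ n)).
    { intros t. apply (is_derive_minus (V := R_NormedModule)).
      - apply (is_derive_scal exp). apply is_derive_exp.
      - replace (INR (S n) * t ^ n) with (INR (S n) * 1 * t ^ n) by ring.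
        apply (is_derive_pow (fun t => t) (S n) t 1), (is_derive_id (K := R_AbsRing)). }
    destruct (MVT_gen (fun t => INR (fact (S n)) * exp t - t ^ S n) 0 y
      (fun t => INR (fact (S n)) * exp t - INR (S n) * t ^ n)) as [c [Hc E]].
    + intros t _. apply HD.
    + intros t _. exact (is_derive_continuity_pt _ t _ (HD t)).
    + rewrite Rmin_left, Rmax_right in Hc by lra.
      rewrite exp_0 in E. simpl (0 ^ S n) in E.
      assert (Hf : 0 < INR (fact (S n))) by apply INR_fact_pos.
      assert (H0 : 0 <= INR (fact (S n)) * exp c - INR (S n) * c ^ n).
      { rewrite fact_simpl, mult_INR. specialize (IH c ltac:(lra)).
        assert (0 <= INR (S n)) by apply pos_INR. nra. }
      assert (0 <= (INR (fact (S n)) * exp c - INR (S n) * c ^ n) * (y - 0)) by (apply Rmult_le_pos; lra).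
      lra.
Qed.

Lemma Rpower_exp_bound (p : R) : exists C0, forall y, 1 <= y -> Rpower y p * exp (- y) <= C0.
Proof.
  set (n := Z.to_nat (up (Rabs p))).
  exists (INR (fact n)). intros y Hy.
  assert (Hn : p <= INR n).
  { destruct (archimed (Rabs p)) as [H _]. assert (H1 := Rle_abs p). assert (H2 := Rabs_pos p).
    unfold n. rewrite INR_IZR_INZ, Z2Nat.id; [lra|]. apply le_IZR. lra. }
  assert (H1 : Rpower y p <= y ^ n).
  { rewrite <- Rpower_pow by lra. apply Rle_Rpower; lra. }
  assert (H2 := pow_le_fact_exp n y ltac:(lra)).
  assert (He := exp_pos (- y)).
  apply Rle_trans with ((INR (fact n) * exp y) * exp (- y)).
  - apply Rmult_le_compat_r; lra.
  - rewrite Rmult_assoc, <- exp_plus, Rplus_opp_r, exp_0. lra.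
Qed.

(** * The Gamma function *)

(* [y^(p-1) / (1 + y^p)^2] has an explicit antiderivative, decays like a power at
   both ends, and dominates the Gamma integrand up to a constant. *)
Lemma int0oo_power_majorant (p : R) :
  0 < p -> int0oo (fun y => Rpower y (p - 1) / (1 + Rpower y p) ^ 2) (/ p).
Proof.
  intros Hp. replace (/ p) with (0 - (- / p)) by ring.
  apply (int0oo_derive (fun y => - / p * / (1 + Rpower y p))).
  - intros x Hx. assert (H := Rpower_pos x p).
    assert (Hd := is_derive_Rpower p x Hx).
    evar_last.
    + apply (is_derive_scal (fun y => / (1 + Rpower y p))).
      apply (is_derive_inv (fun y => 1 + Rpower y p)); [|lra].
      apply (is_derive_plus (V := R_NormedModule)); [apply (is_derive_const (V := R_NormedModule))|exact Hd].
    + unfold plus, zero. simpl. field. lra.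
  - intros x Hx. assert (H := Rpower_pos x p).
    apply (continuous_mult (K := R_AbsRing)); [now apply cont_pos_Rpower|].
    apply (continuous_comp (fun y => (1 + Rpower y p) ^ 2) Rinv).
    + apply (continuous_of_derive _ x (INR 2 * (0 + p * Rpower x (p - 1)) * (1 + Rpower x p) ^ 1)).
      apply (is_derive_pow (fun y => 1 + Rpower y p) 2).
      apply (is_derive_plus (V := R_NormedModule)); [apply (is_derive_const (V := R_NormedModule))|].
      now apply is_derive_Rpower.
    + apply continuous_Rinv. apply pow_nonzero. lra.
  - apply (lim0_Rpower _ _ (/ p) p Hp). intros x Hx. assert (H := Rpower_pos x p).
    replace (- / p * / (1 + Rpower x p) - - / p) with (/ p * Rpower x p * / (1 + Rpower x p)) by (field; lra).
    assert (H1 : 0 < / p) by now apply Rinv_0_lt_compat.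
    rewrite Rabs_right.
    + rewrite <- (Rmult_1_r (/ p * Rpower x p)) at 2. apply Rmult_le_compat_l; [nra|].
      rewrite <- Rinv_1. apply Rinv_le_contravar; lra.
    + apply Rle_ge, Rmult_le_pos; [nra|]. left. apply Rinv_0_lt_compat. lra.
  - apply (limoo_Rpower _ _ (/ p) (- p)); [lra|]. intros x Hx. assert (H := Rpower_pos x p).
    assert (H1 : 0 < / p) by now apply Rinv_0_lt_compat.
    rewrite Rminus_0_r, Rabs_mult, Rabs_Ropp, !Rabs_right, Rpower_Ropp by
      (apply Rle_ge, Rlt_le, Rinv_0_lt_compat; lra).
    apply Rmult_le_compat_l; [lra|]. apply Rinv_le_contravar; lra.
Qed.

Definition gamma_integrand (x b y : R) : R := Rpower y (x - 1) * exp (- (b * y)).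

Lemma cont_pos_exp (b : R) : cont_pos (fun y => exp (- (b * y))).
Proof.
  intros y _. apply (continuous_of_derive _ y (- b * exp (- (b * y)))). auto_derive; auto. ring.
Qed.

Lemma int0oo_gamma_1 (x : R) : 0 < x -> int0oo (gamma_integrand x 1) (Gamma_pos x).
Proof.
  intros Hx.
  destruct (Rpower_exp_bound (2 * x)) as [C1 HC1].
  assert (HC1p : 0 < C1).
  { eapply Rlt_le_trans; [|apply (HC1 1); lra]. apply Rmult_lt_0_compat; apply exp_pos. }
  (* The constant covers two ranges: for [y <= 1], [(1 + y^x)^2 <= 4]; for [y > 1],
     [(1 + y^x)^2 <= 4 y^(2x)] and [y^(2x) exp (- y) <= C1]. *)
  assert (Hdom : exists l, int0oo (gamma_integrand x 1) l /\ Rabs l <= (4 + 4 * C1) * / x).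
  { apply (int0oo_dom _ (fun y => (4 + 4 * C1) * (Rpower y (x - 1) / (1 + Rpower y x) ^ 2))).
    - apply cont_pos_mult; [apply cont_pos_Rpower|apply cont_pos_exp].
    - intros y Hy. assert (H := Rpower_pos y x).
      apply (continuous_scal_r (V := R_NormedModule)).
      apply (continuous_mult (K := R_AbsRing)); [now apply cont_pos_Rpower|].
      apply (continuous_comp (fun y => (1 + Rpower y x) ^ 2) Rinv).
      + apply (continuous_of_derive _ y (INR 2 * (0 + x * Rpower y (x - 1)) * (1 + Rpower y x) ^ 1)).
        apply (is_derive_pow (fun y => 1 + Rpower y x) 2).
        apply (is_derive_plus (V := R_NormedModule)); [apply (is_derive_const (V := R_NormedModule))|].
        now apply is_derive_Rpower.
      + apply continuous_Rinv. apply pow_nonzero. lra.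
    - intros y Hy. unfold gamma_integrand. rewrite Rmult_1_l.
      assert (H := Rpower_pos y x). assert (H1 := Rpower_pos y (x - 1)). assert (He := exp_pos (- y)).
      rewrite Rabs_right by (apply Rle_ge, Rmult_le_pos; lra).
      replace ((4 + 4 * C1) * (Rpower y (x - 1) / (1 + Rpower y x) ^ 2))
        with (Rpower y (x - 1) * ((4 + 4 * C1) / (1 + Rpower y x) ^ 2)) by (field; lra).
      apply Rmult_le_compat_l; [lra|].
      apply (Rmult_le_reg_r ((1 + Rpower y x) ^ 2)); [apply pow_lt; lra|].
      unfold Rdiv. rewrite Rmult_assoc, Rinv_l, Rmult_1_r by (apply pow_nonzero; lra).
      destruct (Rle_dec y 1) as [Hle|Hgt].
      + assert (Rpower y x <= 1) by (apply Rpower_le_1; lra).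
        assert (exp (- y) <= 1).
        { rewrite <- exp_0. left. apply exp_increasing. lra. }
        assert ((1 + Rpower y x) ^ 2 <= 4) by nra.
        nra.
      + assert (Hone : 1 <= Rpower y x).
        { rewrite <- (Rpower_O y) by lra. apply Rle_Rpower; lra. }
        assert (E2 : Rpower y (2 * x) = Rpower y x * Rpower y x).
        { rewrite <- Rpower_plus. f_equal. ring. }
        specialize (HC1 y ltac:(lra)). rewrite E2 in HC1.
        assert ((1 + Rpower y x) ^ 2 <= 4 * (Rpower y x * Rpower y x)) by nra.
        assert (exp (- y) * (1 + Rpower y x) ^ 2 <= exp (- y) * (4 * (Rpower y x * Rpower y x)))
          by (apply Rmult_le_compat_l; lra).
        lra.
    - apply int0oo_scal. now apply int0oo_power_majorant. }
  destruct Hdom as [l [Hl _]].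
  assert (E : Gamma_pos x = l); [|now rewrite E].
  unfold Gamma_pos. apply is_RInt_gen_unique.
  apply (int0oo_ext (gamma_integrand x 1)); [|exact Hl].
  intros y _. unfold gamma_integrand. now rewrite Rmult_1_l.
Qed.

Lemma int0oo_scale (g : R -> R) (l b : R) :
  0 < b -> cont_pos g -> int0oo g l -> int0oo (fun x => b * g (b * x)) l.
Proof.
  intros Hb Hg Hl. apply (int0oo_comp g (fun x => b * x) (fun _ => b)); auto.
  - intros x Hx. now apply Rmult_lt_0_compat.
  - intros x _. auto_derive; auto. ring.
  - intros x _. apply continuous_const.
  - apply (lim0_Rpower _ _ b 1); [lra|]. intros x Hx. rewrite Rpower_1, Rminus_0_r, Rabs_right by nra. lra.
  - intros A0. exists (A0 / b). intros x Hx _. apply (Rmult_lt_reg_r (/ b)); [now apply Rinv_0_lt_compat|].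
    replace (b * x * / b) with x by (field; lra). exact Hx.
Qed.

Lemma Gamma_pos_gt_0 (x : R) : 0 < x -> 0 < Gamma_pos x.
Proof.
  intros Hx. assert (H := int0oo_gamma_1 x Hx).
  assert (Hc : cont_pos (gamma_integrand x 1)) by (apply cont_pos_mult; [apply cont_pos_Rpower|apply cont_pos_exp]).
  assert (Hp : forall y, 0 < y -> 0 < gamma_integrand x 1 y)
    by (intros; apply Rmult_lt_0_compat; apply exp_pos).
  apply Rlt_le_trans with (RInt (gamma_integrand x 1) 1 2).
  - apply RInt_gt_0; [lra|intros; apply Hp; lra|intros; apply Hc; lra].
  - apply RInt_le_int0oo; auto; [|lra]. intros. left. auto.
Qed.

(** ** Taylor remainders of [exp (- u)] and the continued Gamma integral *)

Definition exp_taylor (p : nat) (u : R) : R := nsum p (fun i => (- u) ^ i / INR (fact i)).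
Definition exp_rem (p : nat) (u : R) : R := exp (- u) - exp_taylor p u.

Lemma exp_rem_derive (p : nat) (u : R) : is_derive (exp_rem p) u (- exp_rem (pred p) u).
Proof.
  unfold exp_rem.
  replace (- (exp (- u) - exp_taylor (pred p) u)) with (- exp (- u) - - exp_taylor (pred p) u) by ring.
  apply (is_derive_minus (V := R_NormedModule)); [auto_derive; auto; ring|].
  destruct p as [|p]; simpl pred; unfold exp_taylor.
  - rewrite nsum_0, Ropp_0. apply (is_derive_ext (fun _ => 0)); [reflexivity|].
    apply (is_derive_const (V := R_NormedModule)).
  - apply (is_derive_ext (fun v => 1 + nsum p (fun i => / INR (fact (S i)) * (- v) ^ S i))).
    { intros v. rewrite nsum_first. eqR. f_equal; [simpl; field|].
      apply nsum_ext. intros; apply Rmult_comm. }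
    replace (- nsum p (fun i => (- u) ^ i / INR (fact i)))
      with (0 + nsum p (fun i => / INR (fact (S i)) * (INR (S i) * -1 * (- u) ^ i))).
    + apply (is_derive_plus (V := R_NormedModule)); [apply (is_derive_const (V := R_NormedModule))|].
      apply (is_derive_nsum p (fun i v => / INR (fact (S i)) * (- v) ^ S i)
        (fun i v => / INR (fact (S i)) * (INR (S i) * -1 * (- v) ^ i))).
      intros i _. apply (is_derive_scal (fun v => (- v) ^ S i)).
      apply (is_derive_pow (fun v => - v) (S i) u (-1)). auto_derive; auto; ring.
    + rewrite Rplus_0_l, <- (Rmult_1_l (nsum p (fun i => (- u) ^ i / _))), Ropp_mult_distr_l, <- nsum_scal.
      apply nsum_ext. intros i _. rewrite fact_simpl, mult_INR.
      assert (H := INR_fact_pos i). assert (INR (S i) <> 0) by (apply not_0_INR; lia). field. lra.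
Qed.

Lemma exp_rem_0 (p : nat) : exp_rem (S p) 0 = 0.
Proof.
  unfold exp_rem, exp_taylor. rewrite nsum_first, Ropp_0, exp_0.
  rewrite nsum_zero; [simpl; field|]. intros i _. rewrite pow_ne_zero by lia. unfold Rdiv; ring.
Qed.

Lemma exp_rem_bound (p : nat) (u : R) : 0 <= u -> Rabs (exp_rem p u) <= u ^ p.
Proof.
  revert u. induction p as [|p IH]; intros u Hu.
  - unfold exp_rem, exp_taylor. rewrite nsum_0, Rminus_0_r, Rabs_right by (left; apply exp_pos).
    simpl. rewrite <- exp_0. destruct (Req_dec u 0) as [->|Hn]; [rewrite Ropp_0; lra|].
    left. apply exp_increasing. lra.
  - destruct (MVT_gen (exp_rem (S p)) 0 u (fun t => - exp_rem p t)) as [c [Hc E]].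
    + intros t _. apply exp_rem_derive.
    + intros t _. exact (is_derive_continuity_pt _ t _ (exp_rem_derive (S p) t)).
    + rewrite Rmin_left, Rmax_right in Hc by lra.
      rewrite exp_rem_0, !Rminus_0_r in E. rewrite E, Rabs_mult, Rabs_Ropp, (Rabs_right u) by lra.
      simpl. rewrite (Rmult_comm u). apply Rmult_le_compat_r; [lra|].
      eapply Rle_trans; [apply IH; lra|]. apply pow_incr. lra.
Qed.

Lemma exp_rem_bound_oo (p : nat) (u : R) : 0 <= u -> Rabs (exp_rem (S p) u) <= 2 * u ^ p.
Proof.
  intros Hu.
  replace (exp_rem (S p) u) with (exp_rem p u + - ((- u) ^ p / INR (fact p))).
  - eapply Rle_trans; [apply Rabs_triang|]. rewrite Rabs_Ropp.
    assert (H := exp_rem_bound p u Hu).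
    assert (Rabs ((- u) ^ p / INR (fact p)) <= u ^ p); [|lra].
    assert (Hf : 1 <= INR (fact p)) by (apply INR_pos; apply lt_O_fact).
    assert (Hp : 0 <= u ^ p) by now apply pow_le.
    unfold Rdiv. rewrite Rabs_mult, <- RPow_abs, Rabs_Ropp, (Rabs_right u), (Rabs_right (/ _)).
    + rewrite <- (Rmult_1_r (u ^ p)) at 2. apply Rmult_le_compat_l; [exact Hp|].
      rewrite <- Rinv_1. apply Rinv_le_contravar; lra.
    + apply Rle_ge. left. apply Rinv_0_lt_compat. lra.
    + lra.
  - unfold exp_rem, exp_taylor. rewrite nsum_S. ring.
Qed.

Lemma cont_pos_of_derive (f df : R -> R) : (forall x, 0 < x -> is_derive f x (df x)) -> cont_pos f.
Proof. intros H x Hx. eapply continuous_of_derive. now apply H. Qed.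

Lemma is_derive_mult_R (f g : R -> R) (x df dg : R) :
  is_derive f x df -> is_derive g x dg -> is_derive (fun t => f t * g t) x (df * g x + f x * dg).
Proof.
  intros Hf Hg. apply (is_derive_mult (K := R_AbsRing) f g x df dg Hf Hg). intros; apply Rmult_comm.
Qed.

(** The range in which [y^(x-1) * exp_rem p y] is integrable: the remainder is [O(y^p)] at 0 and,
    for [p >= 1], [O(y^(p-1))] at infinity. *)
Definition gamma_strip (x : R) (p : nat) : Prop :=
  (p = 0%nat /\ 0 < x) \/ ((1 <= p)%nat /\ - INR p < x < 1 - INR p).

Lemma rising_S (x : R) (k : nat) : rising x (S k) = x * rising (x + 1) k.
Proof.
  unfold rising. simpl. rewrite Rplus_0_r. f_equal.
  rewrite <- seq_shift, map_map. f_equal. apply map_ext. intros i. rewrite S_INR. ring.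
Qed.

Lemma Rpower_mult_pow (x p : R) (n : nat) : 0 < x -> Rpower x p * x ^ n = Rpower x (p + INR n).
Proof. intros Hx. rewrite Rpower_plus, Rpower_pow by exact Hx. reflexivity. Qed.

(** The Cauchy-Saalschuetz formula for Gamma at negative non-integers. Integration by parts raises
    [x] and lowers [p] by one; the boundary terms vanish by the two bounds on [exp_rem]. *)
Lemma int0oo_exp_rem (x : R) (p : nat) :
  gamma_strip x p ->
  int0oo (fun y => Rpower y (x - 1) * exp_rem p y) (Gamma_pos (x + INR p) / rising x p).
Proof.
  revert x. induction p as [|p IH]; intros x Hx.
  - destruct Hx as [[_ Hx]|[Hp _]]; [|lia].
    rewrite Rplus_0_r. unfold rising. simpl. unfold Rdiv. rewrite Rinv_1, Rmult_1_r.
    eapply int0oo_ext; [|exact (int0oo_gamma_1 x Hx)].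
    intros y _. unfold gamma_integrand, exp_rem, exp_taylor. rewrite nsum_0, Rmult_1_l. ring.
  - assert (Hx' : - INR (S p) < x < 1 - INR (S p)) by (destruct Hx as [[Hp _]|[_ H]]; [lia|exact H]).
    rewrite S_INR in Hx'. assert (Hp0 := pos_INR p).
    assert (HxS : gamma_strip (x + 1) p).
    { destruct p as [|p]; [left; simpl INR in Hx'; split; [reflexivity|lra]|right].
      split; [lia|]. lra. }
    specialize (IH (x + 1) HxS).
    assert (HD : forall y, 0 < y -> is_derive (fun y => Rpower y x * exp_rem (S p) y) y
               (x * Rpower y (x - 1) * exp_rem (S p) y + Rpower y x * - exp_rem p y)).
    { intros y Hy. apply (is_derive_mult_R (fun y => Rpower y x) (exp_rem (S p))); [now apply is_derive_Rpower|apply exp_rem_derive]. }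
    assert (H0 : int0oo (fun y => x * Rpower y (x - 1) * exp_rem (S p) y + Rpower y x * - exp_rem p y) (0 - 0)).
    { apply (int0oo_derive (fun y => Rpower y x * exp_rem (S p) y)); auto.
      - intros y Hy. apply (continuous_plus (V := R_NormedModule)).
        + apply cont_pos_mult; [|apply (cont_pos_of_derive _ _ (fun t _ => exp_rem_derive (S p) t))|exact Hy].
          intros t Ht. apply (continuous_scal_r (V := R_NormedModule) x (fun y => Rpower y (x - 1))).
          now apply cont_pos_Rpower.
        + apply cont_pos_mult; [apply cont_pos_Rpower| |exact Hy].
          intros t _. apply (continuous_opp (V := R_NormedModule)).
          eapply continuous_of_derive. apply exp_rem_derive.
      - apply (lim0_Rpower _ _ 1 (x + INR (S p))); [rewrite S_INR; lra|]. intros y Hy.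
        rewrite Rminus_0_r, Rabs_mult, (Rabs_right (Rpower y x)) by (left; apply Rpower_pos).
        rewrite Rmult_1_l, <- Rpower_mult_pow by lra.
        apply Rmult_le_compat_l; [left; apply Rpower_pos|]. apply exp_rem_bound. lra.
      - apply (limoo_Rpower _ _ 2 (x + INR p)); [lra|]. intros y Hy.
        rewrite Rminus_0_r, Rabs_mult, (Rabs_right (Rpower y x)) by (left; apply Rpower_pos).
        rewrite <- Rpower_mult_pow by lra.
        replace (2 * (Rpower y x * y ^ p)) with (Rpower y x * (2 * y ^ p)) by ring.
        apply Rmult_le_compat_l; [left; apply Rpower_pos|]. apply exp_rem_bound_oo. lra. }
    assert (Hs := int0oo_plus _ _ _ _ H0 IH). apply (int0oo_scal (/ x)) in Hs.
    eapply int0oo_eq; [|eapply int0oo_ext; [|exact Hs]].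
    + rewrite rising_S, S_INR. replace (x + (INR p + 1)) with (x + 1 + INR p) by ring.
      unfold Rdiv. rewrite Rinv_mult. ring.
    + intros y _. replace (x + 1 - 1) with x by ring. field. lra.
Qed.

(** [Gamma] shifts its argument by [up (- x)] steps, which equals [p] on the strip; for [x > 0] it
    is not positive and [Z.to_nat] truncates it to 0. *)
Lemma Gamma_strip_eq (x : R) (p : nat) :
  gamma_strip x p -> Gamma x = Gamma_pos (x + INR p) / rising x p.
Proof.
  intros Hx. assert (Hk : Z.to_nat (up (- x)) = p); [|unfold Gamma; now rewrite Hk].
  destruct Hx as [[-> Hx]|[Hp Hx]].
  - destruct (archimed (- x)) as [H1 H2].
    assert (H : IZR (up (- x)) < 1) by lra. apply (lt_IZR _ 1) in H. lia.
  - replace (up (- x)) with (Z.of_nat p); [apply Nat2Z.id|].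
    apply tech_up; rewrite <- INR_IZR_INZ; lra.
Qed.

Lemma int0oo_exp_rem_scale (x b : R) (p : nat) :
  gamma_strip x p -> 0 < b ->
  int0oo (fun y => Rpower y (x - 1) * exp_rem p (b * y)) (Gamma x * Rpower b (- x)).
Proof.
  intros Hx Hb. rewrite (Gamma_strip_eq x p Hx).
  assert (H := int0oo_exp_rem x p Hx).
  apply (int0oo_scale _ _ b Hb) in H.
  - apply (int0oo_scal (Rpower b (- x))) in H.
    eapply int0oo_eq; [|eapply int0oo_ext; [|exact H]]; [ring|].
    intros y Hy. unfold Rpower at 2. rewrite ln_mult by lra.
    replace ((x - 1) * (ln b + ln y)) with ((x - 1) * ln b + (x - 1) * ln y) by ring.
    rewrite exp_plus. fold (Rpower b (x - 1)) (Rpower y (x - 1)).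
    assert (E : Rpower b (- x) * (b * Rpower b (x - 1)) = 1).
    { rewrite <- (Rpower_1 b) at 2 by lra. rewrite <- !Rpower_plus.
      replace (- x + (1 + (x - 1))) with 0 by ring. now apply Rpower_O. }
    transitivity ((Rpower b (- x) * (b * Rpower b (x - 1))) * (Rpower y (x - 1) * exp_rem p (b * y))); [ring|].
    rewrite E. ring.
  - apply cont_pos_mult; [apply cont_pos_Rpower|].
    apply (cont_pos_of_derive _ _ (fun t _ => exp_rem_derive p t)).
Qed.

Lemma gamma_strip_0 (x : R) : 0 < x -> gamma_strip x 0.
Proof. intros H. now left. Qed.

Lemma Gamma_pos_succ (x : R) : 0 < x -> Gamma_pos (x + 1) = x * Gamma_pos x.
Proof.
  intros Hx.
  assert (H1 := int0oo_exp_rem x 0 (gamma_strip_0 x Hx)).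
  assert (H2 := int0oo_exp_rem (x + 1) 0 (gamma_strip_0 (x + 1) ltac:(lra))).
  unfold rising in *. simpl in *. rewrite Rplus_0_r in *.
  unfold Rdiv in *. rewrite Rinv_1, Rmult_1_r in *.
  assert (H0 : int0oo (fun y => x * Rpower y (x - 1) * exp_rem 0 y + Rpower y x * - exp_rem 0 y) (0 - 0)).
  { destruct (Rpower_exp_bound (x + 1)) as [C1 HC1].
    apply (int0oo_derive (fun y => Rpower y x * exp_rem 0 y)).
    - intros y Hy. apply (is_derive_mult_R (fun y => Rpower y x) (exp_rem 0)); [now apply is_derive_Rpower|apply (exp_rem_derive 0)].
    - intros y Hy. apply (continuous_plus (V := R_NormedModule)).
      + apply cont_pos_mult; [|apply (cont_pos_of_derive _ _ (fun t _ => exp_rem_derive 0 t))|exact Hy].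
        intros t Ht. apply (continuous_scal_r (V := R_NormedModule) x (fun y => Rpower y (x - 1))).
        now apply cont_pos_Rpower.
      + apply cont_pos_mult; [apply cont_pos_Rpower| |exact Hy].
        intros t _. apply (continuous_opp (V := R_NormedModule)).
        eapply continuous_of_derive. apply (exp_rem_derive 0).
    - apply (lim0_Rpower _ _ 1 x); [lra|]. intros y Hy.
      rewrite Rminus_0_r, Rabs_mult, (Rabs_right (Rpower y x)) by (left; apply Rpower_pos).
      rewrite Rmult_comm. apply Rmult_le_compat_r; [left; apply Rpower_pos|].
      apply (exp_rem_bound 0). lra.
    - apply (limoo_Rpower _ _ C1 (Ropp 1)); [lra|]. intros y Hy.
      rewrite Rminus_0_r. unfold exp_rem, exp_taylor. rewrite nsum_0, Rminus_0_r.
      rewrite Rabs_right by (apply Rle_ge, Rmult_le_pos; left; apply exp_pos).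
      rewrite Rpower_Ropp, Rpower_1 by lra. apply (Rmult_le_reg_r y); [lra|].
      replace (C1 * / y * y) with C1 by (field; lra).
      specialize (HC1 y Hy). rewrite Rpower_plus, Rpower_1 in HC1 by lra. lra. }
  assert (H := int0oo_minus _ _ _ _ (int0oo_scal x _ _ H1) H0).
  apply (int0oo_unique _ _ _ H2). eapply int0oo_eq; [|eapply int0oo_ext; [|exact H]]; [ring|].
  intros y _. replace (x + 1 - 1) with x by ring. ring.
Qed.

Lemma rising_succ_neq_0 (x : R) (p : nat) : gamma_strip x p -> x <> 0 /\ rising x p <> 0.
Proof.
  revert x. induction p as [|p IH]; intros x Hx.
  - destruct Hx as [[_ Hx]|[Hp _]]; [|lia]. split; [lra|]. unfold rising. simpl. lra.
  - destruct Hx as [[Hp _]|[_ Hx]]; [lia|]. rewrite S_INR in Hx. assert (Hp0 := pos_INR p).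
    split; [lra|]. rewrite rising_S. apply Rmult_integral_contrapositive_currified; [lra|].
    apply IH. destruct p as [|p]; [left; simpl INR in Hx; split; [reflexivity|lra]|right].
    split; [lia|]. lra.
Qed.

Lemma gamma_strip_succ (x : R) (p : nat) : gamma_strip x p -> gamma_strip (x + 1) (pred p).
Proof.
  intros [[-> Hx]|[Hp Hx]]; [left; split; [reflexivity|lra]|].
  destruct p as [|[|p]]; [lia|left; simpl INR in Hx; split; [reflexivity|lra]|right].
  simpl pred. rewrite (S_INR (S p)) in Hx. split; [lia|lra].
Qed.

Lemma Gamma_succ (x : R) (p : nat) : gamma_strip x p -> Gamma (x + 1) = x * Gamma x.
Proof.
  intros Hx. assert (HxS := gamma_strip_succ x p Hx).
  destruct (rising_succ_neq_0 x p Hx) as [Hx0 Hr].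
  rewrite (Gamma_strip_eq _ _ Hx), (Gamma_strip_eq _ _ HxS).
  destruct p as [|p].
  - destruct Hx as [[_ Hx]|[Hp _]]; [|lia]. unfold rising. simpl.
    rewrite !Rplus_0_r, Gamma_pos_succ by exact Hx. field.
  - simpl pred. rewrite rising_S in *. rewrite S_INR. replace (x + (INR p + 1)) with (x + 1 + INR p) by ring.
    apply Rmult_neq_0_reg in Hr. field. tauto.
Qed.

Lemma Gamma_neq_0 (x : R) (p : nat) : gamma_strip x p -> Gamma x <> 0.
Proof.
  intros Hx. rewrite (Gamma_strip_eq _ _ Hx). destruct (rising_succ_neq_0 x p Hx) as [_ Hr].
  apply Rmult_integral_contrapositive_currified; [|now apply Rinv_neq_0_compat].
  apply Rgt_not_eq, Gamma_pos_gt_0. destruct Hx as [[-> Hx]|[Hp Hx]]; simpl; lra.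
Qed.

Lemma Gamma_rising (x : R) (p r : nat) :
  gamma_strip x p -> Gamma (x + INR r) = rising x r * Gamma x.
Proof.
  revert x p. induction r as [|r IH]; intros x p Hx.
  - rewrite Rplus_0_r. unfold rising. simpl. ring.
  - rewrite S_INR. replace (x + (INR r + 1)) with (x + 1 + INR r) by ring.
    rewrite (IH _ _ (gamma_strip_succ x p Hx)), (Gamma_succ x p Hx), rising_S. ring.
Qed.

(** * The Hurwitz zeta function as a Mellin transform *)

Lemma bigO_plus (L : nat) (f g : R -> R) : bigO L f -> bigO L g -> bigO L (fun y => f y + g y).
Proof.
  intros [C1 H1] [C2 H2]. exists (C1 + C2). intros y Hy. specialize (H1 y Hy). specialize (H2 y Hy).
  eapply Rle_trans; [apply Rabs_triang|]. lra.
Qed.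

Lemma bigO_scal (L : nat) (c : R) (f : R -> R) : bigO L f -> bigO L (fun y => c * f y).
Proof.
  intros [C1 H1]. exists (Rabs c * C1). intros y Hy. rewrite Rabs_mult, Rmult_assoc.
  apply Rmult_le_compat_l; [apply Rabs_pos|auto].
Qed.

Lemma bigO_ext (L : nat) (f g : R -> R) : (forall y, 0 < y -> f y = g y) -> bigO L f -> bigO L g.
Proof. intros E [C1 H1]. exists C1. intros y Hy. rewrite <- E by lra. auto. Qed.

Lemma bigO_nsum (L n : nat) (f : nat -> R -> R) :
  (forall i, (i < n)%nat -> bigO L (f i)) -> bigO L (fun y => nsum n (fun i => f i y)).
Proof.
  induction n as [|n IH]; intros H.
  - exists 0. intros y _. rewrite nsum_0, Rabs_R0. lra.
  - eapply bigO_ext; [intros y _; symmetry; apply nsum_S|].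
    apply bigO_plus; [apply IH; intros|]; apply H; lia.
Qed.

Lemma bigO_weaken (L L' : nat) (f : R -> R) : (L <= L')%nat -> bigO L' f -> bigO L f.
Proof.
  intros HL [C1 H1]. exists (Rabs C1). intros y Hy. eapply Rle_trans; [apply (H1 y Hy)|].
  assert (H0 : 0 <= y ^ L') by (apply pow_le; lra).
  assert (y ^ L' <= y ^ L).
  { replace L' with (L + (L' - L))%nat by lia. rewrite pow_add.
    rewrite <- (Rmult_1_r (y ^ L)) at 2. apply Rmult_le_compat_l; [apply pow_le; lra|].
    rewrite <- (pow1 (L' - L)). apply pow_incr. lra. }
  assert (C1 <= Rabs C1) by apply Rle_abs. assert (0 <= Rabs C1) by apply Rabs_pos.
  apply Rle_trans with (Rabs C1 * y ^ L'); [apply Rmult_le_compat_r|apply Rmult_le_compat_l]; lra.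
Qed.

Lemma is_poly_plus (L : nat) (P Q : R -> R) : is_poly L P -> is_poly L Q -> is_poly L (fun y => P y + Q y).
Proof.
  intros [c Hc] [d Hd]. exists (fun j => c j + d j). intros y. rewrite Hc, Hd, <- nsum_plus.
  apply nsum_ext. intros; ring.
Qed.

Lemma is_poly_scal (L : nat) (k : R) (P : R -> R) : is_poly L P -> is_poly L (fun y => k * P y).
Proof.
  intros [c Hc]. exists (fun j => k * c j). intros y. rewrite Hc, <- nsum_scal.
  apply nsum_ext. intros; ring.
Qed.

Lemma is_poly_nsum (L n : nat) (f : nat -> R -> R) :
  (forall i, (i < n)%nat -> is_poly L (f i)) -> is_poly L (fun y => nsum n (fun i => f i y)).
Proof.
  induction n as [|n IH]; intros H.
  - exists (fun _ => 0). intros y. rewrite nsum_0, nsum_zero; [reflexivity|]. intros; ring.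
  - destruct (is_poly_plus L _ _ (IH (fun i Hi => H i ltac:(lia))) (H n ltac:(lia))) as [c Hc].
    exists c. intros y. rewrite nsum_S. apply Hc.
Qed.

Lemma is_poly_monomial (L j : nat) (k : R) : (j < L)%nat -> is_poly L (fun y => k * y ^ j).
Proof.
  intros Hj. exists (fun i => if Nat.eqb i j then k else 0). intros y.
  rewrite (nsum_single L j); [now rewrite Nat.eqb_refl|exact Hj|].
  intros i _ Hi. apply Nat.eqb_neq in Hi. rewrite Hi. ring.
Qed.

Lemma is_poly_ext (L : nat) (P Q : R -> R) : (forall y, P y = Q y) -> is_poly L P -> is_poly L Q.
Proof. intros E [c Hc]. exists c. intros y. now rewrite <- E. Qed.

(** The preimage of [hurwitz_EM] under the Mellin transform, term by term. Each [h p] stands for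
    [exp (- u)] with [p] Taylor terms removed, and [p] is the order that the power of [y] in front
    demands. The family [h] is a parameter so that the full exponential, its Taylor parts and its
    remainders share one expression. *)
Definition em_part (h : nat -> R -> R) (L K M : nat) (a y : R) : R :=
  nsum M (fun n => h (pred L) ((INR n + a) * y)) + h L ((INR M + a) * y) / y
  + h (pred L) ((INR M + a) * y) / 2
  + nsum K (fun k => bern (2 * S k) 1 * y ^ (2 * k + 1) * h (L - 2 * S k)%nat ((INR M + a) * y)).

Lemma bern_sum_even (K : nat) (y : R) :
  bern_sum (2 * K + 2) y 1 = 1 - y / 2 + nsum K (fun k => bern (2 * S k) 1 * y ^ (2 * S k)).
Proof.
  induction K as [|K IH].
  - unfold bern_sum. simpl (2 * 0 + 2)%nat. rewrite !nsum_S, !nsum_0, bern_0, bern_1. field.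
  - replace (2 * S K + 2)%nat with (S (S (2 * K + 2))) by lia.
    unfold bern_sum in *. rewrite (nsum_S (S (2 * K + 2))), (nsum_S (2 * K + 2)), IH, nsum_S.
    replace (S (2 * K + 2)) with (2 * K + 3)%nat by lia. rewrite bern_odd_1.
    replace (2 * S K)%nat with (2 * K + 2)%nat by lia.
    rewrite pow_add, pow_1_even. ring.
Qed.

Lemma geometric_exp_sum (M : nat) (a y : R) :
  0 < y -> nsum M (fun n => exp (- ((INR n + a) * y))) =
           geom_kernel y a - exp (- ((INR M + a) * y)) / (1 - exp (- y)).
Proof.
  intros Hy. assert (H := one_minus_exp_pos y Hy). induction M as [|M IH].
  - rewrite nsum_0. unfold geom_kernel. rewrite Rplus_0_l. ring.
  - rewrite nsum_S, IH, S_INR.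
    replace (- ((INR M + 1 + a) * y)) with (- ((INR M + a) * y) + - y) by ring.
    rewrite exp_plus. field. lra.
Qed.

(** The sum up to [M] lacks the tail [exp (- (M+a) y) / (1 - exp (- y))], and the Euler-Maclaurin
    corrections are the first Laurent terms of that tail. What is left of it is a Laurent remainder
    at [a = 1]. *)
Lemma em_part_exp (L K M : nat) (a y : R) :
  0 < y ->
  em_part (fun _ u => exp (- u)) L K M a y =
  geom_kernel y a - exp (- ((INR M + a) * y)) * laurent_rem (2 * K + 2) y 1.
Proof.
  intros Hy. assert (H := one_minus_exp_pos y Hy). unfold em_part.
  rewrite geometric_exp_sum by exact Hy. unfold laurent_rem. rewrite bern_sum_even.
  set (e := exp (- ((INR M + a) * y))).
  rewrite (nsum_ext K _ (fun k => (e / y) * (bern (2 * S k) 1 * y ^ (2 * S k)))).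
  - rewrite nsum_scal. unfold geom_kernel. rewrite (Rmult_1_l y). field. lra.
  - intros k _. replace (y ^ (2 * S k)) with (y * y ^ (2 * k + 1)) by (rewrite tech_pow_Rmult; f_equal; lia). field. lra.
Qed.

Lemma em_part_minus (h g : nat -> R -> R) (L K M : nat) (a y : R) :
  em_part (fun p u => h p u - g p u) L K M a y = em_part h L K M a y - em_part g L K M a y.
Proof.
  unfold em_part. rewrite nsum_minus.
  rewrite (nsum_ext K _ (fun k => bern (2 * S k) 1 * y ^ (2 * k + 1) * h (L - 2 * S k)%nat ((INR M + a) * y)
    - bern (2 * S k) 1 * y ^ (2 * k + 1) * g (L - 2 * S k)%nat ((INR M + a) * y))) by (intros; ring).
  rewrite nsum_minus. unfold Rdiv. ring.
Qed.

Lemma is_poly_taylor (L p j : nat) (b : R) :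
  (forall i, (i < p)%nat -> (j + i < L)%nat) -> is_poly L (fun y => y ^ j * exp_taylor p (b * y)).
Proof.
  intros H. apply (is_poly_ext L (fun y => nsum p (fun i => ((- b) ^ i / INR (fact i)) * y ^ (j + i)))).
  - intros y. unfold exp_taylor. rewrite <- nsum_scal. apply nsum_ext. intros i _.
    rewrite pow_add. replace (- (b * y)) with ((- b) * y) by ring. rewrite Rpow_mult_distr.
    unfold Rdiv. ring.
  - apply is_poly_nsum. intros i Hi. apply is_poly_monomial. auto.
Qed.

Lemma bigO_exp_rem (L p j : nat) (b : R) :
  0 <= b -> (L <= j + p)%nat -> bigO L (fun y => y ^ j * exp_rem p (b * y)).
Proof.
  intros Hb HL. apply (bigO_weaken L (j + p)); [exact HL|]. exists (b ^ p). intros y Hy.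
  rewrite Rabs_mult, (Rabs_right (y ^ j)) by (apply Rle_ge, pow_le; lra).
  rewrite pow_add. replace (b ^ p * (y ^ j * y ^ p)) with (y ^ j * (b * y) ^ p) by (rewrite Rpow_mult_distr; ring).
  apply Rmult_le_compat_l; [apply pow_le; lra|]. apply exp_rem_bound. apply Rmult_le_pos; lra.
Qed.

Lemma bigO_laurent (L : nat) (a : R) : 0 <= a <= 1 -> bigO L (fun y => y * laurent_rem L y a).
Proof.
  intros Ha. exists 2. intros y Hy. rewrite Rabs_mult, (Rabs_right y) by lra.
  assert (H := laurent_rem_bound L y a ltac:(lra) Ha).
  apply Rle_trans with (y * (y ^ L * (1 + / y))); [apply Rmult_le_compat_l; lra|].
  replace (y * (y ^ L * (1 + / y))) with ((1 + y) * y ^ L) by (field; lra).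
  apply Rmult_le_compat_r; [apply pow_le|]; lra.
Qed.

(* The two sides differ by a polynomial of degree less than [L] divided by [y],
   while each of them is [O(y^(L-1))] at 0. *)
Lemma em_identity (L K M : nat) (a y : R) :
  (L <= 2 * K + 2)%nat -> 0 < a <= 1 -> 0 < y ->
  em_part exp_rem L K M a y =
  laurent_rem L y a - exp (- ((INR M + a) * y)) * laurent_rem (2 * K + 2) y 1.
Proof.
  intros HL Ha Hy.
  assert (HM := pos_INR M). set (b := INR M + a). assert (Hb : 0 < b) by (unfold b; lra).
  assert (Hsplit : forall t, 0 < t -> em_part exp_rem L K M a t =
     (geom_kernel t a - exp (- (b * t)) * laurent_rem (2 * K + 2) t 1) - em_part exp_taylor L K M a t).
  { intros t Ht. unfold b. rewrite <- (em_part_exp L K M a t Ht), <- em_part_minus. reflexivity. }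
  (* [PT t] is [t] times the Taylor part. Its degree is below [L] because in each summand of
     [em_part] the Taylor order and the power of [t] in front are balanced. *)
  set (PT := fun t => nsum M (fun n => t ^ 1 * exp_taylor (pred L) ((INR n + a) * t))
    + t ^ 0 * exp_taylor L (b * t) + (/ 2) * (t ^ 1 * exp_taylor (pred L) (b * t))
    + nsum K (fun k => bern (2 * S k) 1 * (t ^ (2 * S k) * exp_taylor (L - 2 * S k)%nat (b * t)))).
  assert (HPT : forall t, 0 < t -> t * em_part exp_taylor L K M a t = PT t).
  { intros t Ht. unfold em_part, PT. fold b. rewrite !Rmult_plus_distr_l, <- !nsum_scal.
    f_equal; [f_equal; [f_equal|]|].
    - apply nsum_ext. intros; ring.
    - field. lra.
    - field.
    - apply nsum_ext. intros k _. replace (t ^ (2 * S k)) with (t * t ^ (2 * k + 1)) by (rewrite tech_pow_Rmult; f_equal; lia). ring. }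
  assert (Hz : bern_sum L y a + -1 * PT y = 0).
  { apply (small_poly_zero L (fun t => bern_sum L t a + -1 * PT t)).
    - apply is_poly_plus.
      + exists (fun j => (-1) ^ j * bern j a). reflexivity.
      + apply is_poly_scal. unfold PT. repeat apply is_poly_plus.
        * apply is_poly_nsum. intros n _. apply is_poly_taylor. intros; lia.
        * apply is_poly_taylor. intros; lia.
        * apply is_poly_scal, is_poly_taylor. intros; lia.
        * apply is_poly_nsum. intros k _. apply is_poly_scal, is_poly_taylor. intros; lia.
    - apply (bigO_ext L (fun t => (nsum M (fun n => t ^ 1 * exp_rem (pred L) ((INR n + a) * t))
        + t ^ 0 * exp_rem L (b * t) + (/ 2) * (t ^ 1 * exp_rem (pred L) (b * t))
        + nsum K (fun k => bern (2 * S k) 1 * (t ^ (2 * S k) * exp_rem (L - 2 * S k)%nat (b * t))))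
        + (-1 * (t * laurent_rem L t a) + exp (- (b * t)) * (t * laurent_rem (2 * K + 2) t 1)))).
      + intros t Ht.
        assert (E : t * em_part exp_rem L K M a t = nsum M (fun n => t ^ 1 * exp_rem (pred L) ((INR n + a) * t))
          + t ^ 0 * exp_rem L (b * t) + (/ 2) * (t ^ 1 * exp_rem (pred L) (b * t))
          + nsum K (fun k => bern (2 * S k) 1 * (t ^ (2 * S k) * exp_rem (L - 2 * S k)%nat (b * t)))).
        { unfold em_part. fold b. rewrite !Rmult_plus_distr_l, <- !nsum_scal.
          f_equal; [f_equal; [f_equal|]|].
          - apply nsum_ext. intros; ring.
          - field. lra.
          - field.
          - apply nsum_ext. intros k _. replace (t ^ (2 * S k)) with (t * t ^ (2 * k + 1)) by (rewrite tech_pow_Rmult; f_equal; lia). ring. }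
        rewrite <- E, Hsplit, <- HPT by exact Ht. unfold laurent_rem at 2. field. lra.
      + apply bigO_plus; [repeat apply bigO_plus|apply bigO_plus].
        * apply bigO_nsum. intros n _. assert (H := pos_INR n). apply bigO_exp_rem; [lra|lia].
        * apply bigO_exp_rem; [lra|lia].
        * apply bigO_scal, bigO_exp_rem; [lra|lia].
        * apply bigO_nsum. intros k _. apply bigO_scal, bigO_exp_rem; [lra|lia].
        * apply bigO_scal, bigO_laurent. lra.
        * destruct (bigO_weaken L _ _ HL (bigO_laurent (2 * K + 2) 1 ltac:(lra))) as [C0 HC0].
          exists C0. intros t Ht. specialize (HC0 t Ht). rewrite Rabs_mult.
          rewrite (Rabs_right (exp _)) by (left; apply exp_pos).
          assert (exp (- (b * t)) <= 1).
          { rewrite <- exp_0. left. apply exp_increasing. assert (0 < b * t) by (apply Rmult_lt_0_compat; lra). lra. }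
          assert (H1 := Rabs_pos (t * laurent_rem (2 * K + 2) t 1)). nra. }
  rewrite Hsplit by exact Hy. unfold laurent_rem at 2.
  replace (em_part exp_taylor L K M a y) with (bern_sum L y a / y); [ring|].
  apply (Rmult_eq_reg_l y); [|lra]. rewrite HPT by exact Hy. field_simplify; [|lra]. lra.
Qed.

(** The range in which [y^(s-1) * laurent_rem L y a] is integrable: the remainder is [O(y^(L-1))] at
    0, and for [L >= 1] it is [O(y^(L-2))] at infinity. *)
Definition mellin_strip (s : R) (L : nat) : Prop :=
  (L = 0%nat /\ 1 < s) \/ ((1 <= L)%nat /\ 1 - INR L < s < 2 - INR L).

Lemma mellin_strip_gamma (s : R) (L : nat) :
  mellin_strip s L -> gamma_strip s (pred L) /\ gamma_strip (s - 1) L /\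
    forall k, gamma_strip (s + (2 * INR k + 1)) (L - 2 * S k).
Proof.
  intros [[-> Hs]|[HL Hs]]; (split; [|split]).
  - left. split; [reflexivity|lra].
  - left. split; [reflexivity|lra].
  - intros k. assert (H := pos_INR k). left. split; [reflexivity|lra].
  - destruct L as [|[|L]]; [lia| |].
    + left. simpl INR in Hs. split; [reflexivity|lra].
    + right. simpl pred. rewrite (S_INR (S L)) in Hs. split; [lia|lra].
  - right. split; [exact HL|lra].
  - intros k.
    destruct (le_lt_dec L (2 * S k)) as [Hle|Hlt].
    + left. split; [lia|]. apply le_INR in Hle. rewrite mult_INR, (S_INR k) in Hle. simpl (INR 2) in Hle. lra.
    + right. split; [lia|]. rewrite minus_INR, mult_INR, (S_INR k) by lia. simpl (INR 2). lra.
Qed.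

Lemma int0oo_em_part (s a : R) (L K M : nat) :
  mellin_strip s L -> 0 < a ->
  int0oo (fun y => Rpower y (s - 1) * em_part exp_rem L K M a y) (Gamma s * hurwitz_EM s a K M).
Proof.
  intros Hs Ha. destruct (mellin_strip_gamma s L Hs) as [G1 [G2 G3]].
  assert (HM := pos_INR M). set (b := INR M + a). assert (Hb : 0 < b) by (unfold b; lra).
  assert (I1 : int0oo (fun y => nsum M (fun n => Rpower y (s - 1) * exp_rem (pred L) ((INR n + a) * y)))
     (nsum M (fun n => Gamma s * Rpower (INR n + a) (- s)))).
  { apply (int0oo_nsum M (fun n y => Rpower y (s - 1) * exp_rem (pred L) ((INR n + a) * y))).
    intros n _. assert (Hn := pos_INR n). apply int0oo_exp_rem_scale; [exact G1|lra]. }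
  assert (I2 := int0oo_exp_rem_scale (s - 1) b L G2 Hb).
  assert (I3 := int0oo_scal (/ 2) _ _ (int0oo_exp_rem_scale s b (pred L) G1 Hb)).
  assert (I4 : int0oo (fun y => nsum K (fun k => bern (2 * S k) 1 *
      (Rpower y (s + (2 * INR k + 1) - 1) * exp_rem (L - 2 * S k) (b * y))))
     (nsum K (fun k => bern (2 * S k) 1 * (Gamma (s + (2 * INR k + 1)) * Rpower b (- (s + (2 * INR k + 1))))))).
  { apply (int0oo_nsum K (fun k y => bern (2 * S k) 1 *
      (Rpower y (s + (2 * INR k + 1) - 1) * exp_rem (L - 2 * S k) (b * y)))).
    intros k _. apply int0oo_scal. apply int0oo_exp_rem_scale; [apply G3|exact Hb]. }
  assert (Hs1 : s - 1 <> 0) by (apply (rising_succ_neq_0 _ _ G2)).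
  eapply int0oo_eq; [|eapply int0oo_ext; [|exact (int0oo_plus _ _ _ _ (int0oo_plus _ _ _ _ (int0oo_plus _ _ _ _ I1 I2) I3) I4)]].
  - unfold hurwitz_EM. fold b. rewrite !Rmult_plus_distr_l, <- !nsum_scal.
    f_equal; [f_equal; [f_equal|]|].
    + replace s with (s - 1 + 1) at 3 by ring. rewrite (Gamma_succ _ _ G2).
      replace (- (s - 1)) with (1 - s) by ring. field. exact Hs1.
    + field.
    + apply nsum_ext. intros k _.
      replace (2 * INR k + 1) with (INR (2 * S k - 1)).
      2:{ replace (2 * S k - 1)%nat with (2 * k + 1)%nat by lia. rewrite plus_INR, mult_INR. reflexivity. }
      rewrite (Gamma_rising s _ _ G1).
      replace (1 - s - 2 * INR (S k)) with (- (s + INR (2 * S k - 1))).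
      * unfold bern, bernnum. ring.
      * rewrite minus_INR, mult_INR by lia. simpl (INR 2). simpl (INR 1). ring.
  - intros y Hy. unfold em_part. fold b.
    rewrite !Rmult_plus_distr_l, <- !nsum_scal.
    f_equal; [f_equal; [f_equal|]|].
    + unfold Rminus at 1. rewrite Rpower_plus, Rpower_Ropp, Rpower_1 by lra. unfold Rdiv. ring.
    + unfold Rdiv. ring.
    + apply nsum_ext. intros k _.
      replace (s + (2 * INR k + 1) - 1) with (s - 1 + INR (2 * k + 1)) by (rewrite plus_INR, mult_INR; simpl; ring).
      rewrite <- Rpower_mult_pow by exact Hy. ring.
Qed.

Lemma cont_pos_minus (f g : R -> R) : cont_pos f -> cont_pos g -> cont_pos (fun x => f x - g x).
Proof. intros Hf Hg x Hx. apply (continuous_minus (V := R_NormedModule)); auto. Qed.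

Lemma cont_pos_plus (f g : R -> R) : cont_pos f -> cont_pos g -> cont_pos (fun x => f x + g x).
Proof. intros Hf Hg x Hx. apply (continuous_plus (V := R_NormedModule)); auto. Qed.

Lemma cont_pos_const (c : R) : cont_pos (fun _ => c).
Proof. intros x _. apply continuous_const. Qed.

Lemma cont_pos_pow (n : nat) : cont_pos (fun y => y ^ n).
Proof.
  induction n as [|n IH]; [exact (cont_pos_const 1)|].
  apply (cont_pos_mult (fun y => y)); [|exact IH]. intros x _. apply continuous_id.
Qed.

Lemma cont_pos_nsum (n : nat) (f : nat -> R -> R) :
  (forall i, (i < n)%nat -> cont_pos (f i)) -> cont_pos (fun y => nsum n (fun i => f i y)).
Proof.
  induction n as [|n IH]; intros H; [exact (cont_pos_const 0)|].
  intros x Hx. apply (continuous_ext (fun y => nsum n (fun i => f i y) + f n y)).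
  - intros y. now rewrite nsum_S.
  - apply cont_pos_plus; auto.
Qed.

Lemma cont_pos_inv (f : R -> R) : cont_pos f -> (forall x, 0 < x -> f x <> 0) -> cont_pos (fun x => / f x).
Proof.
  intros Hf Hn x Hx. apply (continuous_comp f Rinv); [now apply Hf|]. apply continuous_Rinv. auto.
Qed.

Lemma cont_pos_id : cont_pos (fun x => x).
Proof. intros x _. apply continuous_id. Qed.

Lemma cont_pos_geom_kernel (a : R) : cont_pos (fun y => geom_kernel y a).
Proof.
  intros y Hy. assert (H := one_minus_exp_pos y Hy).
  apply (ex_derive_continuous (V := R_NormedModule)). unfold geom_kernel. auto_derive. lra.
Qed.

Lemma cont_pos_laurent (L : nat) (a : R) : cont_pos (fun y => laurent_rem L y a).
Proof.
  apply cont_pos_minus; [apply cont_pos_geom_kernel|]. apply cont_pos_mult.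
  - apply (cont_pos_nsum L (fun j y => (-1) ^ j * bern j a * y ^ j)). intros i _.
    apply cont_pos_mult; [apply cont_pos_const|apply cont_pos_pow].
  - apply cont_pos_inv; [apply cont_pos_id|intros; lra].
Qed.

Lemma int0oo_gamma (q b : R) :
  0 < q -> 0 < b -> int0oo (gamma_integrand q b) (Gamma q * Rpower b (- q)).
Proof.
  intros Hq Hb. eapply int0oo_ext; [|exact (int0oo_exp_rem_scale q b 0 (gamma_strip_0 q Hq) Hb)].
  intros y _. unfold exp_rem, exp_taylor, gamma_integrand. rewrite nsum_0, Rminus_0_r. reflexivity.
Qed.

Lemma cont_pos_gamma_integrand (q b : R) : cont_pos (gamma_integrand q b).
Proof. apply cont_pos_mult; [apply cont_pos_Rpower|apply cont_pos_exp]. Qed.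

(** The bound [y^(2K+2) (1 + 1/y)] on the remainder splits into two powers, hence two Gamma
    integrals; both carry a negative power of [b], which will be [M + a]. *)
Lemma int0oo_em_error (s b : R) (K : nat) :
  0 < s + 2 * INR K + 1 -> 0 < b ->
  exists e, int0oo (fun y => Rpower y (s - 1) * (exp (- (b * y)) * laurent_rem (2 * K + 2) y 1)) e /\
    Rabs e <= Gamma (s + 2 * INR K + 1) * Rpower b (- (s + 2 * INR K + 1))
              + Gamma (s + 2 * INR K + 2) * Rpower b (- (s + 2 * INR K + 2)).
Proof.
  intros Hq Hb.
  apply (int0oo_dom _ (fun y => gamma_integrand (s + 2 * INR K + 1) b y + gamma_integrand (s + 2 * INR K + 2) b y)).
  - apply cont_pos_mult; [apply cont_pos_Rpower|]. apply cont_pos_mult; [apply cont_pos_exp|apply cont_pos_laurent].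
  - apply cont_pos_plus; apply cont_pos_gamma_integrand.
  - intros y Hy. rewrite !Rabs_mult, (Rabs_right (Rpower y (s - 1))), (Rabs_right (exp _))
      by (left; apply exp_pos).
    assert (H := laurent_rem_bound (2 * K + 2) y 1 Hy ltac:(lra)).
    assert (He := exp_pos (- (b * y))). assert (Hr := Rpower_pos y (s - 1)).
    apply Rle_trans with (Rpower y (s - 1) * (exp (- (b * y)) * (y ^ (2 * K + 2) * (1 + / y)))).
    { apply Rmult_le_compat_l; [lra|]. apply Rmult_le_compat_l; [lra|exact H]. }
    unfold gamma_integrand.
    replace (s + 2 * INR K + 1 - 1) with (s - 1 + INR (2 * K + 1)) by (rewrite plus_INR, mult_INR; simpl; ring).
    replace (s + 2 * INR K + 2 - 1) with (s - 1 + INR (2 * K + 2)) by (rewrite plus_INR, mult_INR; simpl; ring).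
    rewrite <- !Rpower_mult_pow by exact Hy.
    replace (y ^ (2 * K + 2)) with (y * y ^ (2 * K + 1)) by (rewrite tech_pow_Rmult; f_equal; lia). right. field. lra.
  - apply int0oo_plus; apply int0oo_gamma; lra.
Qed.

Lemma is_lim_seq_shift_Rpower (a q : R) :
  0 < a -> 0 < q -> is_lim_seq (fun M => Rpower (INR M + a) (- q)) 0.
Proof.
  intros Ha Hq.
  apply is_lim_seq_spec. intros [eps He].
  assert (HL : limoo (fun x => Rpower x (- q)) 0).
  { apply (limoo_Rpower _ _ 1 (- q)); [lra|]. intros x Hx.
    rewrite Rminus_0_r, Rabs_right by (left; apply Rpower_pos). lra. }
  destruct (HL eps He) as [X HX].
  exists (Z.to_nat (up (Rabs X))). intros n Hn.
  assert (H0 := pos_INR n). apply HX; [|lra].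
  destruct (archimed (Rabs X)) as [H _]. assert (H1 := Rle_abs X). assert (H2 := Rabs_pos X).
  apply le_INR in Hn. rewrite INR_IZR_INZ, Z2Nat.id in Hn; [lra|]. apply le_IZR. lra.
Qed.

(** By [em_identity] the integral is [Gamma s * hurwitz_EM s a K M] plus an error, for every [M].
    The integral does not depend on [M] and the error tends to 0, so the Euler-Maclaurin expressions
    converge to the integral divided by [Gamma s], which is not 0. *)
Lemma zeta_mellin (s a : R) (L : nat) :
  mellin_strip s L -> 0 < a <= 1 ->
  int0oo (fun y => Rpower y (s - 1) * laurent_rem L y a) (Gamma s * hurwitz_zeta s a).
Proof.
  intros Hs Ha. destruct (mellin_strip_gamma s L Hs) as [G1 _].
  assert (HG := Gamma_neq_0 s _ G1).
  set (K := (Z.to_nat (up (Rabs s)) + 1)%nat).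
  assert (HK : Rabs s + 1 < INR K).
  { unfold K. rewrite plus_INR. simpl (INR 1). destruct (archimed (Rabs s)) as [H _].
    assert (H2 := Rabs_pos s). rewrite INR_IZR_INZ, Z2Nat.id; [lra|]. apply le_IZR. lra. }
  assert (Hsa := Rle_abs s). assert (Hsb := Rle_abs (- s)). rewrite Rabs_Ropp in Hsb.
  assert (Hq : 0 < s + 2 * INR K + 1) by (assert (H := Rabs_pos s); lra).
  (* The value of [K] fixed in [hurwitz_zeta] exceeds [|s| + 1], enough for the polynomial
     comparison in [em_identity]. *)
  assert (HL : (L <= 2 * K + 2)%nat).
  { destruct Hs as [[-> _]|[_ Hs]]; [lia|]. apply INR_le. rewrite plus_INR, mult_INR. simpl (INR 2).
    lra. }
  set (f := fun y => Rpower y (s - 1) * laurent_rem L y a).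
  set (B := fun b => Gamma (s + 2 * INR K + 1) * Rpower b (- (s + 2 * INR K + 1))
              + Gamma (s + 2 * INR K + 2) * Rpower b (- (s + 2 * INR K + 2))).
  assert (Hf : forall M, exists e, int0oo f (Gamma s * hurwitz_EM s a K M + e) /\ Rabs e <= B (INR M + a)).
  { intros M. assert (HM := pos_INR M).
    destruct (int0oo_em_error s (INR M + a) K Hq ltac:(lra)) as [e [He1 He2]].
    exists e. split; [|exact He2].
    eapply int0oo_ext; [|exact (int0oo_plus _ _ _ _ (int0oo_em_part s a L K M Hs (proj1 Ha)) He1)].
    intros y Hy. cbv beta. rewrite (em_identity L K M a y HL Ha Hy). unfold f. ring. }
  destruct (Hf 0%nat) as [e0 [Hf0 _]]. set (J := Gamma s * hurwitz_EM s a K 0 + e0) in *.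
  assert (Hlim : is_lim_seq (hurwitz_EM s a K) (J / Gamma s)).
  { apply (is_lim_seq_ext (fun M => (J - (J - Gamma s * hurwitz_EM s a K M)) / Gamma s)).
    { intros M. field. exact HG. }
    replace (J / Gamma s) with ((J - 0) / Gamma s) by (unfold Rdiv; ring).
    apply is_lim_seq_mult'; [|apply is_lim_seq_const].
    apply is_lim_seq_minus'; [apply is_lim_seq_const|].
    apply is_lim_seq_abs_0.
    apply (is_lim_seq_le_le (fun _ => 0) _ (fun M => B (INR M + a))).
    - intros M. split; [apply Rabs_pos|]. destruct (Hf M) as [e [H1 H2]].
      rewrite (int0oo_unique _ _ _ Hf0 H1).
      replace (Gamma s * hurwitz_EM s a K M + e - Gamma s * hurwitz_EM s a K M) with e by ring. exact H2.
    - apply is_lim_seq_const.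
    - replace 0 with (Gamma (s + 2 * INR K + 1) * 0 + Gamma (s + 2 * INR K + 2) * 0) by ring.
      apply is_lim_seq_plus'; apply is_lim_seq_mult'; try apply is_lim_seq_const;
        apply is_lim_seq_shift_Rpower; lra. }
  assert (E : hurwitz_zeta s a = J / Gamma s).
  { unfold hurwitz_zeta. fold K. now rewrite (is_lim_seq_unique _ _ Hlim). }
  rewrite E. replace (Gamma s * (J / Gamma s)) with J by (field; exact HG). exact Hf0.
Qed.

(** * Integrals of the partial fractions *)

Lemma atan_le_id (x : R) : 0 <= x -> 0 <= atan x <= x.
Proof.
  intros Hx. destruct (MVT_gen atan 0 x (fun t => / (1 + t ^ 2))) as [c [_ E]].
  - intros t _. auto_derive; auto. field. nra.
  - intros t _. apply (is_derive_continuity_pt _ t (/ (1 + t ^ 2))). auto_derive; auto. field. nra.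
  - rewrite atan_0, !Rminus_0_r in E.
    assert (H : 0 < / (1 + c ^ 2)) by (apply Rinv_0_lt_compat; nra).
    assert (H1 : / (1 + c ^ 2) <= 1).
    { rewrite <- Rinv_1. apply Rinv_le_contravar; [lra|]. assert (0 <= c ^ 2) by apply pow2_ge_0. lra. }
    nra.
Qed.

Lemma atan_infty_bound (x : R) : 0 < x -> Rabs (atan x - PI / 2) <= / x.
Proof.
  intros Hx. assert (H := atan_inv x Hx).
  assert (H0 : 0 < / x) by now apply Rinv_0_lt_compat.
  assert (H1 := atan_le_id (/ x) ltac:(lra)). apply Rabs_le. lra.
Qed.

Lemma ln_diff_bound (X Y m : R) : 0 < m -> m <= X -> m <= Y -> Rabs (ln X - ln Y) <= Rabs (X - Y) / m.
Proof.
  intros Hm HX HY.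
  assert (Hl : forall U V, m <= U -> m <= V -> ln U - ln V <= Rabs (U - V) / m).
  { intros U V HU HV. rewrite <- ln_div by lra.
    assert (Hp : 0 < U / V) by (apply Rdiv_lt_0_compat; lra).
    assert (H1 := exp_ineq1_le (ln (U / V))). rewrite exp_ln in H1 by exact Hp.
    assert (H2 : U / V - 1 = (U - V) / V) by (field; lra).
    assert (H3 : (U - V) / V <= Rabs (U - V) / m).
    { apply Rle_trans with (Rabs (U - V) / V).
      - apply Rmult_le_compat_r; [left; apply Rinv_0_lt_compat; lra|apply Rle_abs].
      - apply Rmult_le_compat_l; [apply Rabs_pos|]. apply Rinv_le_contravar; lra. }
    lra. }
  assert (H1 := Hl X Y HX HY). assert (H2 := Hl Y X HY HX).
  rewrite (Rabs_minus_sym Y X) in H2. apply Rabs_le. lra.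
Qed.

(** For [w = p + i q] of modulus 1, the fraction [w^2 / (t^2 + w^2)] has its poles at [i w] and
    [- i w], and [t^2 + 2 t q + 1], [t^2 - 2 t q + 1] are the squared distances of [t] from them.
    [pf_log] and [pf_atan] are the resulting real antiderivatives. *)
Definition pf_log (q t : R) : R := (ln (t ^ 2 + 2 * t * q + 1) - ln (t ^ 2 - 2 * t * q + 1)) / 2.
Definition pf_atan (p q t : R) : R := atan ((t + q) / p) + atan ((t - q) / p).

Lemma pf_quadratic_pos (q t : R) : Rabs q < 1 -> (1 - Rabs q) * t ^ 2 <= t ^ 2 + 2 * t * q + 1 /\ 0 < t ^ 2 + 2 * t * q + 1.
Proof.
  intros Hq.
  assert (H0 : 0 <= Rabs q * (t ^ 2 + 1) + 2 * t * q).
  { destruct (Rcase_abs q) as [Hn|Hp].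
    - rewrite (Rabs_left q) in * by lra. assert (0 <= (t - 1) ^ 2) by apply pow2_ge_0. nra.
    - rewrite (Rabs_right q) in * by lra. assert (0 <= (t + 1) ^ 2) by apply pow2_ge_0. nra. }
  split; nra.
Qed.

Lemma limoo_plus (f g : R -> R) (l l' : R) : limoo f l -> limoo g l' -> limoo (fun x => f x + g x) (l + l').
Proof.
  intros Hf Hg eps He. destruct (Hf (eps / 2)) as [X HX]; [lra|]. destruct (Hg (eps / 2)) as [Y HY]; [lra|].
  exists (Rmax X Y). intros v Hv Hv0. assert (H1 := Rmax_l X Y). assert (H2 := Rmax_r X Y).
  specialize (HX v ltac:(lra) Hv0). specialize (HY v ltac:(lra) Hv0).
  apply Rabs_def2 in HX. apply Rabs_def2 in HY. apply Rabs_def1; lra.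
Qed.

Lemma limoo_scal (c : R) (f : R -> R) (l : R) : limoo f l -> limoo (fun x => c * f x) (c * l).
Proof.
  intros Hf eps He. assert (Hc := Rabs_pos c).
  destruct (Hf (eps / (Rabs c + 1))) as [X HX]; [apply Rdiv_lt_0_compat; lra|].
  exists X. intros v Hv Hv0. specialize (HX v Hv Hv0).
  rewrite <- Rmult_minus_distr_l, Rabs_mult.
  apply Rle_lt_trans with ((Rabs c + 1) * Rabs (f v - l)).
  - apply Rmult_le_compat_r; [apply Rabs_pos|lra].
  - replace eps with ((Rabs c + 1) * (eps / (Rabs c + 1))) by (field; lra).
    apply Rmult_lt_compat_l; lra.
Qed.

Lemma limoo_pf_log (q : R) : Rabs q < 1 -> limoo (pf_log q) 0.
Proof.
  intros Hq.
  apply (limoo_Rpower _ _ (2 * Rabs q / (1 - Rabs q)) (Ropp 1)); [lra|]. intros t Ht.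
  rewrite Rminus_0_r, Rpower_Ropp, Rpower_1 by lra.
  destruct (pf_quadratic_pos q t Hq) as [H1 _].
  destruct (pf_quadratic_pos (- q) t) as [H2 _]; [now rewrite Rabs_Ropp|]. rewrite Rabs_Ropp in H2.
  replace (t ^ 2 + 2 * t * - q + 1) with (t ^ 2 - 2 * t * q + 1) in H2 by ring.
  assert (Hm : 0 < (1 - Rabs q) * t ^ 2) by (apply Rmult_lt_0_compat; [lra|apply pow_lt; lra]).
  assert (Hb := ln_diff_bound _ _ _ Hm H1 H2).
  unfold pf_log. unfold Rdiv at 1. rewrite Rabs_mult, (Rabs_right (/ 2)) by lra.
  replace (t ^ 2 + 2 * t * q + 1 - (t ^ 2 - 2 * t * q + 1)) with (4 * t * q) in Hb by ring.
  rewrite !Rabs_mult, (Rabs_right 4), (Rabs_right t) in Hb by lra.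
  replace (2 * Rabs q / (1 - Rabs q) * / t) with (4 * t * Rabs q / ((1 - Rabs q) * t ^ 2) * / 2) by (field; lra).
  apply Rmult_le_compat_r; lra.
Qed.

Lemma limoo_atan_affine (p q : R) : 0 < p -> Rabs q < 1 -> limoo (fun t => atan ((t + q) / p)) (PI / 2).
Proof.
  intros Hp Hq. assert (H := Rabs_pos q).
  apply (limoo_Rpower _ _ (p / (1 - Rabs q)) (Ropp 1)); [lra|]. intros t Ht.
  rewrite Rpower_Ropp, Rpower_1 by lra.
  assert (Hn := Rle_abs (- q)). rewrite Rabs_Ropp in Hn.
  assert (Htq : t * (1 - Rabs q) <= t + q) by nra.
  assert (H0 : 0 < t * (1 - Rabs q)) by (apply Rmult_lt_0_compat; lra).
  eapply Rle_trans; [apply atan_infty_bound; apply Rdiv_lt_0_compat; lra|].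
  replace (/ ((t + q) / p)) with (p * / (t + q)) by (field; lra).
  replace (p / (1 - Rabs q) * / t) with (p * / (t * (1 - Rabs q))) by (field; lra).
  apply Rmult_le_compat_l; [lra|]. apply Rinv_le_contravar; lra.
Qed.

Lemma limoo_pf_atan (p q : R) : 0 < p -> Rabs q < 1 -> limoo (pf_atan p q) PI.
Proof.
  intros Hp Hq. replace PI with (PI / 2 + PI / 2) by field.
  apply limoo_plus; [now apply limoo_atan_affine|].
  apply (limoo_atan_affine p (- q)); [exact Hp|now rewrite Rabs_Ropp].
Qed.

Lemma is_derive_pf_log (q t : R) : Rabs q < 1 ->
  is_derive (pf_log q) t ((t + q) / (t ^ 2 + 2 * t * q + 1) - (t - q) / (t ^ 2 - 2 * t * q + 1)).
Proof.
  intros Hq.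
  destruct (pf_quadratic_pos q t Hq) as [_ H1].
  destruct (pf_quadratic_pos (- q) t) as [_ H2]; [now rewrite Rabs_Ropp|].
  unfold pf_log. auto_derive.
  - repeat split; auto; nra.
  - field. split; nra.
Qed.

Lemma is_derive_pf_atan (p q t : R) : 0 < p -> p ^ 2 + q ^ 2 = 1 ->
  is_derive (pf_atan p q) t (p / (t ^ 2 + 2 * t * q + 1) + p / (t ^ 2 - 2 * t * q + 1)).
Proof.
  intros Hp Hpq. unfold pf_atan. auto_derive.
  - auto.
  - replace (t ^ 2 + 2 * t * q + 1) with ((t + q) ^ 2 + p ^ 2) by (rewrite <- Hpq; ring).
    replace (t ^ 2 - 2 * t * q + 1) with ((t - q) ^ 2 + p ^ 2) by (rewrite <- Hpq; ring).
    assert (0 < (t + q) ^ 2 + p ^ 2) by (assert (0 <= (t + q) ^ 2) by apply pow2_ge_0; nra).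
    assert (0 < (t - q) ^ 2 + p ^ 2) by (assert (0 <= (t - q) ^ 2) by apply pow2_ge_0; nra).
    field. repeat split; nra.
Qed.

Lemma lim0_continuous (f : R -> R) (l : R) : continuous f 0 -> f 0 = l -> lim0 f l.
Proof.
  intros Hf Hl eps He.
  destruct (Hf (fun y => Rabs (y - l) < eps)) as [d Hd].
  - exists (mkposreal eps He). intros y Hy. rewrite <- Hl. exact Hy.
  - exists d. split; [apply cond_pos|]. intros u Hu. apply Hd.
    unfold ball. simpl. unfold AbsRing_ball, abs, minus, plus, opp. simpl. apply Rabs_def1; lra.
Qed.

(** The logarithmic part vanishes at both ends, and the two arctangents cancel at 0 and add up to
    [PI] at infinity; so [A] leaves no trace in the value. *)
Lemma int0oo_pf_combination (p q A B : R) :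
  0 < p -> p ^ 2 + q ^ 2 = 1 ->
  int0oo (fun t => A * ((t + q) / (t ^ 2 + 2 * t * q + 1) - (t - q) / (t ^ 2 - 2 * t * q + 1))
                 + B * (p / (t ^ 2 + 2 * t * q + 1) + p / (t ^ 2 - 2 * t * q + 1))) (B * PI).
Proof.
  intros Hp Hpq.
  assert (Hq : Rabs q < 1).
  { apply Rabs_def1; nra. }
  assert (HD : forall t, is_derive (fun t => A * pf_log q t + B * pf_atan p q t) t
    (A * ((t + q) / (t ^ 2 + 2 * t * q + 1) - (t - q) / (t ^ 2 - 2 * t * q + 1))
                 + B * (p / (t ^ 2 + 2 * t * q + 1) + p / (t ^ 2 - 2 * t * q + 1)))).
  { intros t. apply (is_derive_plus (V := R_NormedModule)).
    - apply (is_derive_scal (pf_log q)). now apply is_derive_pf_log.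
    - apply (is_derive_scal (pf_atan p q)). now apply is_derive_pf_atan. }
  replace (B * PI) with ((A * 0 + B * PI) - 0) by ring.
  apply (int0oo_derive (fun t => A * pf_log q t + B * pf_atan p q t)).
  - intros t _. apply HD.
  - assert (Hi : forall s : R, Rabs s < 1 -> cont_pos (fun t => / (t ^ 2 + 2 * t * s + 1))).
    { intros s Hs. apply cont_pos_inv.
      - intros t _. apply (ex_derive_continuous (V := R_NormedModule)). auto_derive. auto.
      - intros t _. destruct (pf_quadratic_pos s t Hs). lra. }
    assert (H2 := Hi (- q) ltac:(now rewrite Rabs_Ropp)).
    assert (H3 : cont_pos (fun t => / (t ^ 2 - 2 * t * q + 1))).
    { intros t Ht. apply (continuous_ext (fun t => / (t ^ 2 + 2 * t * - q + 1))); [|now apply H2].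
      intros x. f_equal. ring. }
    apply cont_pos_plus; apply cont_pos_mult; try apply cont_pos_const.
    + apply cont_pos_minus; apply cont_pos_mult; auto.
      * apply cont_pos_plus; [apply cont_pos_id|apply cont_pos_const].
      * apply cont_pos_minus; [apply cont_pos_id|apply cont_pos_const].
    + apply cont_pos_plus; apply cont_pos_mult; auto; apply cont_pos_const.
  - apply lim0_continuous.
    + apply (ex_derive_continuous (V := R_NormedModule)). eexists. apply HD.
    + unfold pf_log, pf_atan. replace (0 ^ 2 + 2 * 0 * q + 1) with 1 by ring.
      replace (0 ^ 2 - 2 * 0 * q + 1) with 1 by ring.
      replace ((0 - q) / p) with (- ((0 + q) / p)) by (field; lra). rewrite atan_opp. field.
  - apply limoo_plus; apply limoo_scal; [now apply limoo_pf_log|now apply limoo_pf_atan].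
Qed.

Lemma pf_value (p q t : R) :
  0 < p -> p ^ 2 + q ^ 2 = 1 ->
  ((p, q) * (p, q) / (RtoC (t ^ 2) + (p, q) * (p, q)))%C =
    ((q * ((t + q) / (t ^ 2 + 2 * t * q + 1) - (t - q) / (t ^ 2 - 2 * t * q + 1))
       + p * (p / (t ^ 2 + 2 * t * q + 1) + p / (t ^ 2 - 2 * t * q + 1))) / 2,
     (- p * ((t + q) / (t ^ 2 + 2 * t * q + 1) - (t - q) / (t ^ 2 - 2 * t * q + 1))
       + q * (p / (t ^ 2 + 2 * t * q + 1) + p / (t ^ 2 - 2 * t * q + 1))) / 2).
Proof.
  intros Hp Hpq. assert (Hq : Rabs q < 1) by (apply Rabs_def1; nra).
  destruct (pf_quadratic_pos q t Hq) as [_ H1].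
  destruct (pf_quadratic_pos (- q) t) as [_ H2]; [now rewrite Rabs_Ropp|].
  set (U := t ^ 2 + 2 * t * q + 1) in *. set (V := t ^ 2 - 2 * t * q + 1).
  assert (HV : 0 < V) by (unfold V; lra).
  assert (HD : (t ^ 2 + (p * p - q * q)) ^ 2 + (0 + (p * q + q * p)) ^ 2 = U * V).
  { unfold U, V. rewrite <- Hpq. ring. }
  assert (HU : U = t ^ 2 + 2 * t * q + (p ^ 2 + q ^ 2)) by (unfold U; lra).
  assert (HVe : V = t ^ 2 - 2 * t * q + (p ^ 2 + q ^ 2)) by (unfold V; lra).
  apply injective_projections; unfold Cdiv, Cinv, Cmult, Cplus, RtoC, fst, snd; rewrite HD.
  - transitivity ((q * ((t + q) * V - (t - q) * U) + p * (p * V + p * U)) / 2 / (U * V)); [|field; lra].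
    transitivity (((p * p - q * q) * (t ^ 2 + (p * p - q * q)) + (p * q + q * p) * (p * q + q * p)) / (U * V)); [field; lra|].
    f_equal. rewrite HU, HVe. field.
  - transitivity ((- p * ((t + q) * V - (t - q) * U) + q * (p * V + p * U)) / 2 / (U * V)); [|field; lra].
    transitivity (((p * q + q * p) * (t ^ 2 + (p * p - q * q)) - (p * p - q * q) * (p * q + q * p)) / (U * V)); [field; lra|].
    f_equal. rewrite HU, HVe. field.
Qed.

Lemma int0oo_pf_term (M j : nat) :
  (j < M)%nat ->
  int0oo (fun t => Re (pf_term (2 * M) (t ^ 2) j)) (PI / 2 * Re (root (2 * M) j)) /\
  int0oo (fun t => Im (pf_term (2 * M) (t ^ 2) j)) (PI / 2 * Im (root (2 * M) j)).
Proof.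
  intros Hj. assert (Hp := root_Re_pos M j Hj).
  assert (Hpq : Re (root (2 * M) j) ^ 2 + Im (root (2 * M) j) ^ 2 = 1).
  { assert (H := sin2_cos2 (root_arg (2 * M) j)). unfold Rsqr in H.
    unfold root, cis, Re, Im, fst, snd. unfold Rsqr. lra. }
  set (w := root (2 * M) j) in *. set (p := Re w) in *. set (q := Im w) in *.
  assert (Hq : Rabs q < 1) by (apply Rabs_def1; nra).
  assert (Hpf : forall t : R, pf_term (2 * M) (t ^ 2) j = ((w * w) / (RtoC (t ^ 2) + w * w))%C).
  { intros t. unfold pf_term. now rewrite root_sqr_root. }
  assert (E : forall t, (w * w / (RtoC (t ^ 2) + w * w))%C =
    ((q * ((t + q) / (t ^ 2 + 2 * t * q + 1) - (t - q) / (t ^ 2 - 2 * t * q + 1))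
       + p * (p / (t ^ 2 + 2 * t * q + 1) + p / (t ^ 2 - 2 * t * q + 1))) / 2,
     (- p * ((t + q) / (t ^ 2 + 2 * t * q + 1) - (t - q) / (t ^ 2 - 2 * t * q + 1))
       + q * (p / (t ^ 2 + 2 * t * q + 1) + p / (t ^ 2 - 2 * t * q + 1))) / 2)).
  { intros t. now apply pf_value. }
  split.
  - assert (H := int0oo_scal (/ 2) _ _ (int0oo_pf_combination p q q p Hp Hpq)).
    eapply int0oo_eq; [|eapply int0oo_ext; [|exact H]]; [field|].
    intros t _. rewrite Hpf, E. simpl. field.
    destruct (pf_quadratic_pos q t Hq) as [_ H1].
    destruct (pf_quadratic_pos (- q) t) as [_ H2]; [now rewrite Rabs_Ropp|]. split; nra.
  - assert (H := int0oo_scal (/ 2) _ _ (int0oo_pf_combination p q (- p) q Hp Hpq)).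
    eapply int0oo_eq; [|eapply int0oo_ext; [|exact H]]; [field|].
    intros t _. rewrite Hpf, E. simpl. field.
    destruct (pf_quadratic_pos q t Hq) as [_ H1].
    destruct (pf_quadratic_pos (- q) t) as [_ H2]; [now rewrite Rabs_Ropp|]. split; nra.
Qed.

Lemma Rpower_root (b : R) (n : nat) : 0 < b -> (0 < n)%nat -> Rpower b (/ INR n) ^ n = b.
Proof.
  intros Hb Hn. assert (0 < INR n) by now apply lt_0_INR.
  rewrite <- Rpower_pow by apply Rpower_pos. rewrite Rpower_mult, Rinv_l, Rpower_1; lra.
Qed.

(** The integrals are left as sums over the roots. These are the same sums as in the linear part of
    [sums_lattice_sin] and [sums_lattice_cos], so the two can be matched directly. *)
Lemma int0oo_rational (M : nat) :
  (0 < M)%nat ->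
  int0oo (fun t => / ((t ^ 2) ^ (2 * M) + 1)) (PI / INR (2 * M) * lattice_sin M) /\
  int0oo (fun t => (t ^ 2) ^ M / ((t ^ 2) ^ (2 * M) + 1)) (PI / INR (2 * M) * lattice_cos M).
Proof.
  intros HM. assert (HN : 0 < INR (2 * M)) by (apply lt_0_INR; lia). split.
  - assert (H : int0oo (fun t => nsum M (fun j => Re (pf_term (2 * M) (t ^ 2) j)))
      (nsum M (fun j => PI / 2 * Re (root (2 * M) j)))).
    { apply (int0oo_nsum M (fun j t => Re (pf_term (2 * M) (t ^ 2) j))). intros j Hj. exact (proj1 (int0oo_pf_term M j Hj)). }
    apply (int0oo_scal (2 / INR (2 * M))) in H.
    eapply int0oo_eq; [|eapply int0oo_ext; [|exact H]].
    + rewrite nsum_scal. fold (lattice_sin M). field. lra.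
    + intros t _. symmetry. now apply partial_fraction_one.
  - assert (H : int0oo (fun t => nsum M (fun j => (-1) ^ (M + j + 1) * Im (pf_term (2 * M) (t ^ 2) j)))
      (nsum M (fun j => PI / 2 * ((-1) ^ (M + j + 1) * Im (root (2 * M) j))))).
    { apply (int0oo_nsum M (fun j t => (-1) ^ (M + j + 1) * Im (pf_term (2 * M) (t ^ 2) j))). intros j Hj.
      replace (PI / 2 * ((-1) ^ (M + j + 1) * Im (root (2 * M) j)))
        with ((-1) ^ (M + j + 1) * (PI / 2 * Im (root (2 * M) j))) by ring.
      apply int0oo_scal. exact (proj2 (int0oo_pf_term M j Hj)). }
    apply (int0oo_scal (2 / INR (2 * M))) in H.
    eapply int0oo_eq; [|eapply int0oo_ext; [|exact H]].
    + rewrite nsum_scal. fold (lattice_cos M). field. lra.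
    + intros t _. symmetry. now apply partial_fraction_pow.
Qed.

Lemma cont_pos_rational (M n : nat) : cont_pos (fun t => (t ^ 2) ^ n / ((t ^ 2) ^ (2 * M) + 1)).
Proof.
  assert (Hn : forall n, cont_pos (fun t => (t ^ 2) ^ n)).
  { intros k x Hx. apply (continuous_ext (fun t => t ^ (2 * k))); [intros; apply pow_mult|now apply cont_pos_pow]. }
  apply cont_pos_mult; [apply Hn|]. apply cont_pos_inv.
  - apply cont_pos_plus; [apply Hn|apply cont_pos_const].
  - intros x Hx. assert (0 <= (x ^ 2) ^ (2 * M)) by (apply pow_le, pow2_ge_0). lra.
Qed.

(** The substitution [t = x / Bs]. The coefficient agrees with the linear part of the lattice series
    at [c = 1]; a general [c] only contributes [c^(-1/N)], by [lattice_root_split]. *)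
Lemma int0oo_lattice (M : nat) (b Bs : R) :
  (0 < M)%nat -> 0 < b -> 0 < Bs -> Bs ^ (2 * M) = b ->
  int0oo (fun x => b / ((x ^ (2 * M)) ^ 2 + b ^ 2)) (PI * Bs / (b * INR (2 * M)) * lattice_sin M) /\
  int0oo (fun x => x ^ (2 * M) / ((x ^ (2 * M)) ^ 2 + b ^ 2)) (PI * Bs / (b * INR (2 * M)) * lattice_cos M).
Proof.
  intros HM Hb HB HBN. assert (HN : 0 < INR (2 * M)) by (apply lt_0_INR; lia).
  destruct (int0oo_rational M HM) as [H1 H2].
  assert (HiB : 0 < / Bs) by now apply Rinv_0_lt_compat.
  assert (Hx : forall x, ((/ Bs * x) ^ 2) ^ (2 * M) = (x ^ (2 * M)) ^ 2 / b ^ 2).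
  { intros x. rewrite <- HBN at 1. rewrite <- !pow_mult, Rpow_mult_distr, pow_inv.
    replace (2 * (2 * M))%nat with (2 * M * 2)%nat by lia. unfold Rdiv. ring. }
  assert (Hx2 : forall x, ((/ Bs * x) ^ 2) ^ M = x ^ (2 * M) / b).
  { intros x. rewrite <- HBN at 1. rewrite <- !pow_mult, Rpow_mult_distr, pow_inv. unfold Rdiv. ring. }
  split.
  - apply (int0oo_scale _ _ (/ Bs) HiB) in H1.
    + apply (int0oo_scal (Bs / b)) in H1.
      eapply int0oo_eq; [|eapply int0oo_ext; [|exact H1]]; [field; lra|].
      intros x _. cbv beta. rewrite Hx. field. repeat split; try lra. nra.
    + intros t Ht. apply (continuous_ext (fun t => (t ^ 2) ^ 0 / ((t ^ 2) ^ (2 * M) + 1))).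
      * intros y. apply Rmult_1_l.
      * now apply cont_pos_rational.
  - apply (int0oo_scale _ _ (/ Bs) HiB) in H2; [|apply cont_pos_rational].
    apply (int0oo_scal (Bs / b)) in H2.
    eapply int0oo_eq; [|eapply int0oo_ext; [|exact H2]]; [field; lra|].
    intros x _. cbv beta. rewrite Hx, Hx2. field. repeat split; try lra. nra.
Qed.

(** * Termwise integration of the Fourier expansion *)

Definition fourier_const (M p : nat) (a : R) (k : nat) : R :=
  2 * PI * Rpower (freq k) (/ INR (2 * M)) / (INR (2 * M) * freq k ^ (2 * p + 1)) *
  (cos (freq k * a) * lattice_cos M + sin (freq k * a) * lattice_sin M).

Lemma int0oo_fourier_term (M p k : nat) (a : R) :
  (0 < M)%nat -> (1 <= k)%nat ->
  int0oo (fun x => fourier_term p (x ^ (2 * M)) a k) (fourier_const M p a k).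
Proof.
  intros HM Hk. assert (Hb := freq_pos k Hk). assert (HN : 0 < INR (2 * M)) by (apply lt_0_INR; lia).
  assert (HB := Rpower_pos (freq k) (/ INR (2 * M))).
  destruct (int0oo_lattice M (freq k) (Rpower (freq k) (/ INR (2 * M))) HM Hb HB) as [H1 H2].
  { apply Rpower_root; [exact Hb|lia]. }
  assert (Hbp : freq k ^ (2 * p) <> 0) by (apply pow_nonzero; lra).
  assert (H := int0oo_scal (2 / freq k ^ (2 * p)) _ _
    (int0oo_plus _ _ _ _ (int0oo_scal (cos (freq k * a)) _ _ H2) (int0oo_scal (sin (freq k * a)) _ _ H1))).
  eapply int0oo_eq; [|eapply int0oo_ext; [|exact H]].
  - unfold fourier_const. rewrite pow_add, pow_1. field. repeat split; auto; lra.
  - intros x Hx. unfold fourier_term.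
    field. split; [nra|exact Hbp].
Qed.

(** As for double series: the integral of the tail of the series is at most the tail of [B] times
    the integral of [h]. *)
Lemma int0oo_series (g : nat -> R -> R) (G h : R -> R) (B l : nat -> R) (sB H lG : R) :
  (forall x, 0 < x -> sums (fun k => g k x) (G x)) ->
  (forall k x, (1 <= k)%nat -> 0 < x -> Rabs (g k x) <= B k * h x) ->
  sums B sB -> int0oo h H -> (forall x, 0 < x -> 0 <= h x) ->
  (forall k, (1 <= k)%nat -> int0oo (g k) (l k)) -> int0oo G lG -> sums l lG.
Proof.
  intros HG Hb HB Hh Hh0 Hg HlG.
  assert (Hr : forall K, Rabs (lG - nsum K (fun k => l (S k))) <= (sB - nsum K (fun k => B (S k))) * H).
  { intros K.
    apply (int0oo_Rabs_le (fun x => G x - nsum K (fun k => g (S k) x)) (fun x => (sB - nsum K (fun k => B (S k))) * h x)).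
    - intros x Hx.
      apply (sums_Rabs_le (fun k => g (K + k)%nat x) (fun k => h x * B (K + k)%nat)).
      + intros k Hk. rewrite Rmult_comm. apply Hb; [lia|exact Hx].
      + apply (nsum_sums_rest (fun k => g k x)). auto.
      + rewrite Rmult_comm. apply sums_scal. now apply nsum_sums_rest.
    - apply int0oo_minus; [exact HlG|].
      apply (int0oo_nsum K (fun k x => g (S k) x)). intros; apply Hg; lia.
    - apply (int0oo_scal _ _ _ Hh). }
  apply is_lim_seq_ext with (fun K => lG - (lG - nsum K (fun k => l (S k)))); [intros; ring|].
  replace (Finite lG) with (Finite (lG - 0)) by (f_equal; ring).
  apply is_lim_seq_minus'; [apply is_lim_seq_const|].
  apply is_lim_seq_abs_0.
  apply (is_lim_seq_le_le (fun _ => 0) _ (fun K => (sB - nsum K (fun k => B (S k))) * H)).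
  - intros K. split; [apply Rabs_pos|apply Hr].
  - apply is_lim_seq_const.
  - replace 0 with ((sB - sB) * H) by ring.
    apply is_lim_seq_mult'; [|apply is_lim_seq_const].
    apply is_lim_seq_minus'; [apply is_lim_seq_const|exact HB].
Qed.

(** * The Mellin kernel in the variable [x^N] *)

(** For [m < 0] truncation gives order 0: the factor [y^(-2m)] already removes the pole of the
    kernel at 0, so no Laurent term is subtracted. *)
Definition ker_order (m : Z) : nat := Z.to_nat (2 * m + 1).
Definition ker (m : Z) (y a : R) : R := powerRZ y (- (2 * m)) * laurent_rem (ker_order m) y a.
Definition zeta_arg (M : nat) (m : Z) : R := / INR (2 * M) - 2 * IZR m.
Definition ker_mellin (M : nat) (m : Z) (a : R) : R :=
  Gamma (zeta_arg M m) * hurwitz_zeta (zeta_arg M m) a / INR (2 * M).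

(** Since [0 < 1/N <= 1/2], the number [1/N - 2 m] lies strictly between [- 2 m] and [1 - 2 m], the
    strip of order [2 m + 1]; for [m < 0] it exceeds 1. *)
Lemma zeta_arg_strip (M : nat) (m : Z) :
  (0 < M)%nat -> mellin_strip (zeta_arg M m) (ker_order m).
Proof.
  intros HM. assert (HN : 2 <= INR (2 * M)).
  { replace 2 with (INR 2) by reflexivity. apply le_INR. lia. }
  assert (Hi : 0 < / INR (2 * M)) by (apply Rinv_0_lt_compat; lra).
  assert (Hi2 : / INR (2 * M) <= / 2) by (apply Rinv_le_contravar; lra).
  unfold zeta_arg, ker_order.
  destruct (Z_lt_le_dec m 0) as [Hm|Hm].
  - left. split; [lia|]. assert (Hm' : (m <= -1)%Z) by lia. apply IZR_le in Hm'. lra.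
  - right. split; [lia|]. rewrite INR_IZR_INZ, Z2Nat.id by lia.
    rewrite plus_IZR, mult_IZR. lra.
Qed.

(** The substitution [y = x^N] in [zeta_mellin]. With [s = 1/N - 2 m] the exponent
    [N (s - 1) + N - 1] equals [- 2 m N], the power of [x] in [ker m (x^N) a]. *)
Lemma int0oo_ker (M : nat) (m : Z) (a : R) :
  (0 < M)%nat -> 0 < a <= 1 -> int0oo (fun x => ker m (x ^ (2 * M)) a) (ker_mellin M m a).
Proof.
  intros HM Ha. assert (HN : 2 <= INR (2 * M)).
  { replace 2 with (INR 2) by reflexivity. apply le_INR. lia. }
  assert (H := zeta_mellin _ a _ (zeta_arg_strip M m HM) Ha).
  set (s := zeta_arg M m) in *.
  set (dphi := fun x => INR (2 * M) * x ^ (2 * M - 1)).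
  apply (int0oo_comp _ (fun x => x ^ (2 * M)) dphi) in H.
  - apply (int0oo_scal (/ INR (2 * M))) in H.
    eapply int0oo_eq; [|eapply int0oo_ext; [|exact H]].
    + unfold ker_mellin. fold s. field. lra.
    + intros x Hx. unfold ker, dphi.
      assert (Hxp : 0 < x ^ (2 * M)) by now apply pow_lt.
      rewrite (powerRZ_Rpower (x ^ (2 * M))) by exact Hxp.
      rewrite <- (Rpower_pow (2 * M)), <- (Rpower_pow (2 * M - 1)) by exact Hx.
      rewrite !Rpower_mult.
      transitivity (/ INR (2 * M) * INR (2 * M) * (Rpower x (INR (2 * M - 1)) * Rpower x (INR (2 * M) * (s - 1)))
         * laurent_rem (ker_order m) (Rpower x (INR (2 * M))) a); [ring|].
      rewrite <- Rpower_plus, Rinv_l, Rmult_1_l by lra. f_equal. f_equal.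
      rewrite minus_INR by lia. unfold s, zeta_arg.
      rewrite opp_IZR, mult_IZR. simpl (INR 1). field. lra.
  - apply cont_pos_mult; [apply cont_pos_Rpower|apply cont_pos_laurent].
  - intros x Hx. now apply pow_lt.
  - intros x Hx. unfold dphi.
    replace (INR (2 * M) * x ^ (2 * M - 1)) with (INR (2 * M) * 1 * x ^ pred (2 * M))
      by (replace (pred (2 * M)) with (2 * M - 1)%nat by lia; ring).
    apply (is_derive_pow (fun t => t) (2 * M) x 1), (is_derive_id (K := R_AbsRing)).
  - apply cont_pos_mult; [apply cont_pos_const|apply cont_pos_pow].
  - apply (lim0_Rpower _ _ 1 1); [lra|]. intros x Hx.
    rewrite Rminus_0_r, Rpower_1, Rmult_1_l, Rabs_right by (try lra; apply Rle_ge, pow_le; lra).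
    replace (x ^ (2 * M)) with (x * x ^ (2 * M - 1)) by (rewrite tech_pow_Rmult; f_equal; lia).
    assert (x ^ (2 * M - 1) <= 1) by (rewrite <- (pow1 (2 * M - 1)); apply pow_incr; lra). nra.
  - intros A0. exists (Rmax 1 A0). intros x Hx _. assert (H1 := Rmax_l 1 A0). assert (H2 := Rmax_r 1 A0).
    apply Rlt_le_trans with x; [lra|]. rewrite <- (pow_1 x) at 1. apply Rle_pow; [lra|lia].
Qed.

Lemma ker_of_nat (p : nat) (y a : R) :
  0 < y -> ker (Z.of_nat p) y a = laurent_rem (2 * p + 1) y a / y ^ (2 * p).
Proof.
  intros Hy. unfold ker, ker_order.
  replace (Z.to_nat (2 * Z.of_nat p + 1)) with (2 * p + 1)%nat by lia.
  replace (- (2 * Z.of_nat p))%Z with (- Z.of_nat (2 * p))%Z by lia.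
  rewrite powerRZ_neg', <- pow_powerRZ. unfold Rdiv. ring.
Qed.

Lemma sums_fourier_ker (p : nat) (y a : R) :
  (1 <= p)%nat -> 0 < y -> 0 <= a <= 1 ->
  sums (fun k => (-1) ^ p * fourier_term p y a k) (ker (Z.of_nat p) y a).
Proof.
  intros Hp Hy Ha. rewrite ker_of_nat by exact Hy.
  eapply sums_eq; [|exact (sums_scal ((-1) ^ p) _ _ (sums_fourier p y a Hp Hy Ha))].
  assert (E := pow_m1_sqr p).
  transitivity ((-1) ^ p * (-1) ^ p * (laurent_rem (2 * p + 1) y a / y ^ (2 * p))); [unfold Rdiv; ring|].
  rewrite E. ring.
Qed.

Lemma int0oo_inv_1_sqr : int0oo (fun x => / (1 + x ^ 2)) (PI / 2).
Proof.
  replace (PI / 2) with (PI / 2 - 0) by ring.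
  apply (int0oo_derive atan).
  - intros x _. auto_derive; auto. field. nra.
  - apply cont_pos_inv.
    + apply cont_pos_plus; [apply cont_pos_const|apply cont_pos_pow].
    + intros x _. assert (0 <= x ^ 2) by apply pow2_ge_0. lra.
  - apply (lim0_Rpower _ _ 1 1); [lra|]. intros x Hx. rewrite Rpower_1, Rminus_0_r by lra.
    assert (H := atan_le_id x ltac:(lra)). rewrite Rabs_right; lra.
  - apply (limoo_Rpower _ _ 1 (Ropp 1)); [lra|]. intros x Hx.
    rewrite Rpower_Ropp, Rpower_1, Rmult_1_l by lra. apply atan_infty_bound. lra.
Qed.

Lemma inv_1_pow_le (N : nat) (x : R) : (2 <= N)%nat -> 0 < x -> / (1 + x ^ N) <= 2 * / (1 + x ^ 2).
Proof.
  intros HN Hx. assert (Hp : 0 < x ^ N) by now apply pow_lt. assert (H2 : 0 < x ^ 2) by now apply pow_lt.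
  apply (Rmult_le_reg_r ((1 + x ^ N) * (1 + x ^ 2))); [apply Rmult_lt_0_compat; lra|].
  replace (/ (1 + x ^ N) * ((1 + x ^ N) * (1 + x ^ 2))) with (1 + x ^ 2) by (field; lra).
  replace (2 * / (1 + x ^ 2) * ((1 + x ^ N) * (1 + x ^ 2))) with (2 * (1 + x ^ N)) by (field; lra).
  destruct (Rle_dec x 1) as [Hle|Hgt]; [nra|].
  assert (x ^ 2 <= x ^ N) by (apply Rle_pow; [lra|exact HN]). lra.
Qed.

(** The linear terms of the lattice sums, collected over all frequencies, are the Mellin integral of
    the kernel. In the majorant, 8 is the 4 of [fourier_term_bound] times the 2 of
    [inv_1_pow_le]. *)
Lemma sums_fourier_const (M p : nat) (a : R) :
  (0 < M)%nat -> (1 <= p)%nat -> 0 < a <= 1 ->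
  sums (fun k => (-1) ^ p * fourier_const M p a k) (ker_mellin M (Z.of_nat p) a).
Proof.
  intros HM Hp Ha. destruct sums_inv_sqr as [S2 HS2].
  apply (int0oo_series (fun k x => (-1) ^ p * fourier_term p (x ^ (2 * M)) a k)
    (fun x => ker (Z.of_nat p) (x ^ (2 * M)) a) (fun x => 8 * / (1 + x ^ 2)) (fun k => / INR k ^ 2)
    _ S2 (8 * (PI / 2)) _); auto.
  - intros x Hx. apply sums_fourier_ker; [exact Hp|now apply pow_lt|lra].
  - intros k x Hk Hx. rewrite Rabs_mult, pow_1_abs, Rmult_1_l.
    assert (Hxp : 0 < x ^ (2 * M)) by now apply pow_lt.
    eapply Rle_trans; [apply fourier_term_bound; auto|].
    assert (H1 := inv_freq_pow_le (2 * p) k Hk ltac:(lia)).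
    assert (H2 := inv_1_pow_le (2 * M) x ltac:(lia) Hx).
    assert (0 < / freq k ^ (2 * p)) by (apply Rinv_0_lt_compat, pow_lt, freq_pos; exact Hk).
    assert (0 < / (1 + x ^ (2 * M))) by (apply Rinv_0_lt_compat; lra).
    replace (4 * / freq k ^ (2 * p) * / (1 + x ^ (2 * M))) with (4 * (/ freq k ^ (2 * p) * / (1 + x ^ (2 * M)))) by ring.
    replace (/ INR k ^ 2 * (8 * / (1 + x ^ 2))) with (4 * (/ INR k ^ 2 * (2 * / (1 + x ^ 2)))) by ring.
    apply Rmult_le_compat_l; [lra|]. apply Rmult_le_compat; lra.
  - apply int0oo_scal, int0oo_inv_1_sqr.
  - intros x Hx. apply Rmult_le_pos; [lra|]. left. apply Rinv_0_lt_compat.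
    assert (0 <= x ^ 2) by apply pow2_ge_0. lra.
  - intros k Hk. apply int0oo_scal. now apply int0oo_fourier_term.
  - now apply int0oo_ker.
Qed.

(** * The transformation formula in terms of the kernel *)

Definition lattice_root (M : nat) (c : R) (k : nat) : R := Rpower (freq k / c) (/ INR (2 * M)).

Definition exp_term (M : nat) (m : Z) (c a : R) (k : nat) : R :=
  powerRZ (-1) m * powerRZ (freq k) (- (2 * m + 1)) * (4 * PI * lattice_root M c k / INR (2 * M)) *
  (cos (freq k * a) * lattice_exp_cos M (lattice_root M c k)
   + sin (freq k * a) * lattice_exp_sin M (lattice_root M c k)).

(** The contribution of [n = 0]: minus half the term there, summed over the frequencies by
    [sums_sin_bern]. It is absent for [m < 0]. *)
Definition bern_part (m : Z) (a : R) : R := if (0 <=? m)%Z then bern (ker_order m) a / 2 else 0.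

Definition ker_transform (M : nat) (m : Z) (c a : R) : Prop :=
  exists e, sums (exp_term M m c a) e /\
    sums (fun n => ker m (c * INR n ^ (2 * M)) a)
         (bern_part m a + Rpower c (- / INR (2 * M)) * ker_mellin M m a + e).

Lemma freq_div_pos (c : R) (k : nat) : 0 < c -> (1 <= k)%nat -> 0 < freq k / c.
Proof. intros Hc Hk. apply Rdiv_lt_0_compat; [now apply freq_pos|exact Hc]. Qed.

Lemma lattice_root_split (M : nat) (c : R) (k : nat) :
  0 < c -> (1 <= k)%nat ->
  lattice_root M c k = Rpower c (- / INR (2 * M)) * Rpower (freq k) (/ INR (2 * M)).
Proof.
  intros Hc Hk. assert (Hb := freq_pos k Hk). unfold lattice_root.
  unfold Rpower. rewrite ln_div by assumption. rewrite <- exp_plus. f_equal. ring.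
Qed.

Lemma sums_fourier_lattice (M p k : nat) (c a : R) :
  (0 < M)%nat -> 0 < c -> (1 <= k)%nat ->
  sums (fun n => (-1) ^ p * fourier_term p (c * INR n ^ (2 * M)) a k)
    (- (-1) ^ p * (sin (freq k * a) / freq k ^ (2 * p + 1))
     + Rpower c (- / INR (2 * M)) * ((-1) ^ p * fourier_const M p a k)
     + exp_term M (Z.of_nat p) c a k).
Proof.
  intros HM Hc Hk. assert (Hb := freq_pos k Hk).
  assert (HN : 0 < INR (2 * M)) by (apply lt_0_INR; lia).
  assert (HB : 0 < lattice_root M c k) by apply Rpower_pos.
  assert (HBN : lattice_root M c k ^ (2 * M) = freq k / c).
  { apply Rpower_root; [now apply freq_div_pos|lia]. }
  assert (H1 := sums_lattice_cos M c (freq k) (lattice_root M c k) HM Hc Hb HB HBN).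
  assert (H2 := sums_lattice_sin M c (freq k) (lattice_root M c k) HM Hc Hb HB HBN).
  assert (H := sums_scal ((-1) ^ p * 2 / freq k ^ (2 * p)) _ _
    (sums_plus _ _ _ _ (sums_scal (cos (freq k * a)) _ _ H1) (sums_scal (sin (freq k * a)) _ _ H2))).
  assert (Hbp : freq k ^ (2 * p) <> 0) by (apply pow_nonzero; lra).
  eapply sums_eq; [|eapply sums_ext; [|exact H]].
  - unfold exp_term, fourier_const.
    replace (- (2 * Z.of_nat p + 1))%Z with (- Z.of_nat (2 * p + 1))%Z by lia.
    rewrite powerRZ_neg', <- !pow_powerRZ.
    rewrite (lattice_root_split M c k Hc Hk).
    rewrite pow_add, pow_1. field. repeat split; auto; lra.
  - intros n Hn. unfold fourier_term.
    field. split; [nra|exact Hbp].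
Qed.

(** The double series of Fourier terms is dominated by [(4 / c) / (n^2 k^2)]. Summed over [k] first
    it gives the kernel, summed over [n] first the three parts in [sums_fourier_lattice]. *)
Lemma ker_transform_pos (M p : nat) (c a : R) :
  (0 < M)%nat -> (1 <= p)%nat -> 0 < c -> 0 < a <= 1 -> ker_transform M (Z.of_nat p) c a.
Proof.
  intros HM Hp Hc Ha. destruct sums_inv_sqr as [S2 HS2].
  assert (Hy : forall n, (1 <= n)%nat -> 0 < c * INR n ^ (2 * M)).
  { intros n Hn. apply Rmult_lt_0_compat; [exact Hc|]. apply pow_lt. assert (H := INR_pos n Hn). lra. }
  destruct (sums_exchange (fun n k => (-1) ^ p * fourier_term p (c * INR n ^ (2 * M)) a k)
    (fun n => 4 / c * / INR n ^ 2) (fun k => / INR k ^ 2)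
    (fun n => ker (Z.of_nat p) (c * INR n ^ (2 * M)) a)
    (fun k => - (-1) ^ p * (sin (freq k * a) / freq k ^ (2 * p + 1))
     + Rpower c (- / INR (2 * M)) * ((-1) ^ p * fourier_const M p a k)
     + exp_term M (Z.of_nat p) c a k) (4 / c * S2) S2) as [l [Hl1 Hl2]]; auto.
  - intros n k Hn Hk. rewrite Rabs_mult, pow_1_abs, Rmult_1_l.
    specialize (Hy n Hn). assert (Hn1 := INR_pos n Hn).
    eapply Rle_trans; [apply fourier_term_bound; auto|].
    assert (H1 := inv_freq_pow_le (2 * p) k Hk ltac:(lia)).
    assert (H2 : / (1 + c * INR n ^ (2 * M)) <= / c * / INR n ^ 2).
    { rewrite <- Rinv_mult. apply Rinv_le_contravar.
      - apply Rmult_lt_0_compat; [exact Hc|apply pow_lt; lra].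
      - assert (INR n ^ 2 <= INR n ^ (2 * M)) by (apply Rle_pow; [lra|lia]). nra. }
    assert (0 < / freq k ^ (2 * p)) by (apply Rinv_0_lt_compat, pow_lt, freq_pos; exact Hk).
    assert (0 < / (1 + c * INR n ^ (2 * M))) by (apply Rinv_0_lt_compat; lra).
    replace (4 * / freq k ^ (2 * p) * / (1 + c * INR n ^ (2 * M))) with (4 * (/ (1 + c * INR n ^ (2 * M)) * / freq k ^ (2 * p))) by ring.
    replace (4 / c * / INR n ^ 2 * / INR k ^ 2) with (4 * (/ c * / INR n ^ 2 * / INR k ^ 2)) by (unfold Rdiv; ring).
    apply Rmult_le_compat_l; [lra|]. apply Rmult_le_compat; lra.
  - now apply sums_scal.
  - intros n Hn. apply sums_fourier_ker; [exact Hp|now apply Hy|lra].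
  - intros k Hk. now apply sums_fourier_lattice.
  - assert (Hs := sums_sin_bern p a Hp ltac:(lra)).
    assert (Hf := sums_fourier_const M p a HM Hp Ha).
    (* Convergence of the exponential terms comes for free here, as the difference of the total and
       the two series already summed. *)
    assert (He := sums_minus _ _ _ _ Hl2 (sums_plus _ _ _ _ (sums_scal (- (-1) ^ p) _ _ Hs)
       (sums_scal (Rpower c (- / INR (2 * M))) _ _ Hf))).
    eexists. split.
    + eapply sums_ext; [|exact He]. intros k _. cbv beta. ring.
    + eapply sums_eq; [|exact Hl1].
      assert (Eb : bern_part (Z.of_nat p) a = bern (2 * p + 1) a / 2).
      { unfold bern_part, ker_order. rewrite (proj2 (Z.leb_le 0 (Z.of_nat p))) by lia.
        now replace (Z.to_nat (2 * Z.of_nat p + 1)) with (2 * p + 1)%nat by lia. }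
      rewrite Eb. assert (E := pow_m1_sqr p).
      replace (- (-1) ^ p * (- (-1) ^ p * bern (2 * p + 1) a / 2))
        with ((-1) ^ p * (-1) ^ p * (bern (2 * p + 1) a / 2)) by (unfold Rdiv; ring).
      rewrite E. ring.
Qed.

(** * Second differences in [a] *)

(** Backward, so that for [0 < a <= 1] and small [h] all three points stay in the interval where the
    identity is known. *)
Definition second_diff (f : R -> R) (a h : R) : R := f a - 2 * f (a - h) + f (a - 2 * h).

(** Three uses of the mean value theorem bound the Taylor remainder at [a - t] by [B t^3]. The point
    [a - h] has weight 2 and [a - 2 h] contributes [8 B h^3], together 10. *)
Lemma second_diff_bound (f f1 f2 f3 : R -> R) (a h B : R) :
  0 < h ->
  (forall t, is_derive f t (f1 t)) -> (forall t, is_derive f1 t (f2 t)) -> (forall t, is_derive f2 t (f3 t)) ->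
  (forall t, a - 2 * h <= t <= a -> Rabs (f3 t) <= B) ->
  Rabs (second_diff f a h - h ^ 2 * f2 a) <= 10 * B * h ^ 3.
Proof.
  intros Hh D0 D1 D2 HB.
  assert (HB0 : 0 <= B) by (eapply Rle_trans; [apply Rabs_pos|apply (HB a); lra]).
  assert (Hmvt : forall (g dg : R -> R) (K t : R), 0 <= t <= 2 * h -> g 0 = 0 ->
     (forall s, is_derive g s (dg s)) -> (forall s, 0 <= s <= t -> Rabs (dg s) <= K) -> Rabs (g t) <= K * t).
  { intros g dg K t Ht Hg0 Hg HK. destruct (MVT_gen g 0 t dg) as [x [Hx E]].
    - intros s _. apply Hg.
    - intros s _. exact (is_derive_continuity_pt _ s _ (Hg s)).
    - rewrite Rmin_left, Rmax_right in Hx by lra. rewrite Hg0, !Rminus_0_r in E.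
      rewrite E, Rabs_mult, (Rabs_right t) by lra. apply Rmult_le_compat_r; [lra|]. now apply HK. }
  assert (Hcomp : forall (g dg : R -> R), (forall t, is_derive g t (dg t)) ->
     forall s, is_derive (fun s => g (a - s)) s (-1 * dg (a - s))).
  { intros g dg Hg s. apply (is_derive_comp g (fun s => a - s)); [apply Hg|]. auto_derive; auto; ring. }
  assert (R2 : forall t, 0 <= t <= 2 * h -> Rabs (f2 (a - t) - f2 a) <= B * t).
  { intros t Ht. apply (Hmvt (fun s => f2 (a - s) - f2 a) (fun s => -1 * f3 (a - s) - 0)); auto.
    - rewrite Rminus_0_r. ring.
    - intros s. apply (is_derive_minus (V := R_NormedModule)); [now apply Hcomp|apply (is_derive_const (V := R_NormedModule))].
    - intros s Hs. replace (-1 * f3 (a - s) - 0) with (- f3 (a - s)) by ring. rewrite Rabs_Ropp. apply HB. lra. }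
  assert (R1 : forall t, 0 <= t <= 2 * h -> Rabs (f1 (a - t) - f1 a + t * f2 a) <= B * t * t).
  { intros t Ht. apply (Hmvt (fun s => f1 (a - s) - f1 a + s * f2 a) (fun s => -1 * f2 (a - s) - 0 + f2 a)); auto.
    - rewrite Rminus_0_r. ring.
    - intros s. apply (is_derive_plus (V := R_NormedModule)).
      + apply (is_derive_minus (V := R_NormedModule)); [now apply Hcomp|apply (is_derive_const (V := R_NormedModule))].
      + auto_derive; auto; ring.
    - intros s Hs. replace (-1 * f2 (a - s) - 0 + f2 a) with (- (f2 (a - s) - f2 a)) by ring. rewrite Rabs_Ropp.
      eapply Rle_trans; [apply R2; lra|]. apply Rmult_le_compat_l; lra. }
  assert (R0 : forall t, 0 <= t <= 2 * h -> Rabs (f (a - t) - f a + t * f1 a - t ^ 2 / 2 * f2 a) <= B * t * t * t).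
  { intros t Ht.
    apply (Hmvt (fun s => f (a - s) - f a + s * f1 a - s ^ 2 / 2 * f2 a) (fun s => -1 * f1 (a - s) - 0 + f1 a - s * f2 a)); auto.
    - rewrite Rminus_0_r. field.
    - intros s. apply (is_derive_minus (V := R_NormedModule)); [apply (is_derive_plus (V := R_NormedModule))|].
      + apply (is_derive_minus (V := R_NormedModule)); [now apply Hcomp|apply (is_derive_const (V := R_NormedModule))].
      + auto_derive; auto; ring.
      + auto_derive; auto; field.
    - intros s Hs. replace (-1 * f1 (a - s) - 0 + f1 a - s * f2 a) with (- (f1 (a - s) - f1 a + s * f2 a)) by ring.
      rewrite Rabs_Ropp. eapply Rle_trans; [apply R1; lra|]. rewrite !Rmult_assoc. apply Rmult_le_compat_l; [lra|]. nra. }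
  assert (E1 := R0 h ltac:(lra)). assert (E2 := R0 (2 * h) ltac:(lra)).
  unfold second_diff.
  replace (f a - 2 * f (a - h) + f (a - 2 * h) - h ^ 2 * f2 a) with
    (-2 * (f (a - h) - f a + h * f1 a - h ^ 2 / 2 * f2 a) + (f (a - 2 * h) - f a + 2 * h * f1 a - (2 * h) ^ 2 / 2 * f2 a)) by field.
  eapply Rle_trans; [apply Rabs_triang|]. rewrite Rabs_mult.
  replace (Rabs (-2)) with 2 by (rewrite Rabs_left; lra).
  lra.
Qed.

(** ** The kernel *)

Lemma ker_order_pred (m : Z) : ker_order m = pred (pred (ker_order (m + 1))).
Proof. unfold ker_order. lia. Qed.

(** Two derivatives in [a] multiply by [y^2] and lower the order by two, which turns [ker (m + 1)]
    into [ker m]. For [m <= 0] a third one reaches order 0, the bare kernel, which is positive and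
    decreasing in [a], hence bounded by its value at [d]. *)
Lemma ker_second_diff (m : Z) (y a h d : R) :
  (m <= 0)%Z -> 0 < y -> 0 < h -> d <= a - 2 * h ->
  Rabs (second_diff (ker (m + 1) y) a h - h ^ 2 * ker m y a)
  <= 10 * (y ^ (Z.to_nat (1 - 2 * m)) * geom_kernel y d) * h ^ 3.
Proof.
  intros Hm Hy Hh Hd.
  set (P := powerRZ y (- (2 * (m + 1)))).
  assert (EP : powerRZ y (- (2 * m)) = P * (y * y)).
  { unfold P. replace (- (2 * m))%Z with (- (2 * (m + 1)) + 2)%Z by lia. rewrite powerRZ_add by lra.
    simpl. ring. }
  assert (EP3 : P * (y * y) * y = y ^ (Z.to_nat (1 - 2 * m))).
  { rewrite <- EP, pow_powerRZ. replace (Z.of_nat (Z.to_nat (1 - 2 * m))) with (- (2 * m) + 1)%Z by lia.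
    rewrite powerRZ_add by lra. simpl. ring. }
  set (L := ker_order (m + 1)).
  assert (EL : pred (pred (pred L)) = 0%nat) by (unfold L, ker_order; lia).
  assert (Hs : forall (k : R) (Q : nat) t, is_derive (fun t => k * laurent_rem Q y t) t (k * (- y * laurent_rem (pred Q) y t))).
  { intros k Q t. apply (is_derive_scal (laurent_rem Q y)), is_derive_laurent_rem. }
  replace (ker m y a) with (P * (y * y) * laurent_rem (pred (pred L)) y a)
    by (unfold ker; rewrite EP, ker_order_pred; reflexivity).
  apply (second_diff_bound (ker (m + 1) y) (fun t => P * - y * laurent_rem (pred L) y t)
    (fun t => P * (y * y) * laurent_rem (pred (pred L)) y t)
    (fun t => P * (y * y) * - y * laurent_rem (pred (pred (pred L))) y t) a h); auto.
  - intros t. replace (P * - y * laurent_rem (pred L) y t) with (P * (- y * laurent_rem (pred L) y t)) by ring. apply Hs.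
  - intros t. replace (P * (y * y) * laurent_rem (pred (pred L)) y t) with (P * - y * (- y * laurent_rem (pred (pred L)) y t)) by ring. apply Hs.
  - intros t. replace (P * (y * y) * - y * laurent_rem (pred (pred (pred L))) y t)
      with (P * (y * y) * (- y * laurent_rem (pred (pred (pred L))) y t)) by ring. apply Hs.
  - intros t Ht. rewrite EL. replace (P * (y * y) * - y) with (- y ^ (Z.to_nat (1 - 2 * m))) by (rewrite <- EP3; ring).
    rewrite Rabs_mult, Rabs_Ropp, Rabs_right by (apply Rle_ge, pow_le; lra).
    apply Rmult_le_compat_l; [apply pow_le; lra|].
    unfold laurent_rem, bern_sum. unfold Rdiv. rewrite Rmult_0_l, Rminus_0_r.
    rewrite Rabs_right by (left; now apply geom_kernel_pos).
    apply Rmult_le_compat_r; [left; apply Rinv_0_lt_compat, one_minus_exp_pos; exact Hy|].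
    destruct (Req_dec t d) as [->|Hn]; [lra|]. left. apply exp_increasing. nra.
Qed.

Lemma pow_exp_decay (r : nat) (d : R) :
  0 < d -> exists C0, 0 <= C0 /\ forall y, 0 < y -> y ^ r * exp (- (d * y)) <= C0 / (1 + y).
Proof.
  intros Hd.
  assert (Hb : forall n y, 0 < y -> y ^ n * exp (- (d * y)) <= INR (fact n) / d ^ n).
  { intros n y Hy. assert (Hdn : 0 < d ^ n) by now apply pow_lt.
    assert (H := pow_le_fact_exp n (d * y) ltac:(nra)). rewrite Rpow_mult_distr in H.
    assert (He : exp (d * y) * exp (- (d * y)) = 1) by (rewrite <- exp_plus, Rplus_opp_r; apply exp_0).
    assert (Hep := exp_pos (- (d * y))).
    apply (Rmult_le_reg_l (d ^ n)); [exact Hdn|].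
    replace (d ^ n * (INR (fact n) / d ^ n)) with (INR (fact n)) by (field; lra).
    rewrite <- Rmult_assoc.
    apply Rle_trans with (INR (fact n) * exp (d * y) * exp (- (d * y))); [apply Rmult_le_compat_r; lra|].
    rewrite Rmult_assoc, He. lra. }
  exists (INR (fact r) / d ^ r + INR (fact (S r)) / d ^ S r).
  assert (Hf := fun n => INR_fact_pos n). assert (Hdp := fun n => pow_lt d n Hd).
  split.
  - apply Rplus_le_le_0_compat; left; apply Rdiv_lt_0_compat; auto.
  - intros y Hy. apply (Rmult_le_reg_r (1 + y)); [lra|].
    replace ((INR (fact r) / d ^ r + INR (fact (S r)) / d ^ S r) / (1 + y) * (1 + y))
      with (INR (fact r) / d ^ r + INR (fact (S r)) / d ^ S r) by (field; repeat split; try apply pow_nonzero; lra).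
    assert (H1 := Hb r y Hy). assert (H2 := Hb (S r) y Hy).
    replace (y ^ r * exp (- (d * y)) * (1 + y)) with (y ^ r * exp (- (d * y)) + y ^ S r * exp (- (d * y))) by (simpl; ring).
    lra.
Qed.

(** One of the [r + 1] powers of [y] absorbs the pole at 0; the exponential supplies the decay at
    infinity. *)
Lemma geom_kernel_decay (r : nat) (d : R) :
  0 < d -> exists C0, 0 <= C0 /\ forall y, 0 < y -> y ^ S r * geom_kernel y d <= C0 / (1 + y).
Proof.
  intros Hd. destruct (pow_exp_decay r d Hd) as [C1 [HC1 H1]]. destruct (pow_exp_decay (S r) d Hd) as [C2 [HC2 H2]].
  exists (C1 + C2). split; [lra|]. intros y Hy. specialize (H1 y Hy). specialize (H2 y Hy).
  assert (Hg := geom_kernel_le y d Hy).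
  assert (Hp : 0 < y ^ S r) by now apply pow_lt.
  apply Rle_trans with (y ^ S r * (exp (- (d * y)) * (1 + / y))); [apply Rmult_le_compat_l; lra|].
  replace (y ^ S r * (exp (- (d * y)) * (1 + / y))) with (y ^ S r * exp (- (d * y)) + y ^ r * exp (- (d * y)))
    by (simpl; field; lra).
  unfold Rdiv in *. rewrite Rmult_plus_distr_r. lra.
Qed.

(** ** The exponentially small terms *)

Lemma exp_minus_1_lower (r : nat) (x : R) : 0 < x -> (x / 2) ^ S r <= INR (fact r) * (exp x - 1).
Proof.
  intros Hx. assert (H := pow_le_fact_exp r (x / 2) ltac:(lra)).
  assert (E : exp x = exp (x / 2) * exp (x / 2)) by (rewrite <- exp_plus; f_equal; field).
  assert (H1 := exp_ineq1_le (x / 2)). assert (Hf := INR_fact_pos r).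
  simpl ((x / 2) ^ S r).
  apply Rle_trans with (x / 2 * (INR (fact r) * exp (x / 2))); [apply Rmult_le_compat_l; lra|].
  replace (x / 2 * (INR (fact r) * exp (x / 2))) with (INR (fact r) * (x / 2 * exp (x / 2))) by ring.
  apply Rmult_le_compat_l; [lra|].
  nra.
Qed.

Lemma Cmod_cis (t : R) : Cmod (cis t) = 1.
Proof.
  assert (H : Cmod (cis t) ^ 2 = 1).
  { rewrite Cmod_sqr. unfold cis, Re, Im, fst, snd. assert (H := sin2_cos2 t). unfold Rsqr in H. lra. }
  assert (H0 := Cmod_ge_0 (cis t)). nra.
Qed.

(** [|exp z - 1| >= exp (Re z) - 1], which exceeds any power of [Re z] up to a constant, and [Re z]
    is a positive multiple of [(freq k / c)^(1/N)]. *)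
Lemma lattice_exp_decay (M j r : nat) (c : R) :
  (j < M)%nat -> 0 < c ->
  exists C0, forall k, (1 <= k)%nat -> Cmod (lattice_exp M (lattice_root M c k) j) <= C0 / freq k ^ r.
Proof.
  intros Hj Hc. assert (Hp := root_Re_pos M j Hj). set (p := Re (root (2 * M) j)) in *.
  assert (HPI := PI_RGT_0).
  (* Of the [n + 1] factors [lattice_root], [2 M r] give [(freq k / c)^r]; the spare one is at least
     [(1/c)^(1/(2M))] because [freq k >= 1]. *)
  set (n := (2 * M * r)%nat).
  set (D := ((PI * p) ^ (S n)) / c ^ r).
  assert (HD0 : 0 < PI * p) by (apply Rmult_lt_0_compat; lra).
  assert (Hlow : forall k, (1 <= k)%nat ->
     freq k ^ r * Rmin 1 (Rpower (/ c) (/ INR (2 * M))) * D <= ((2 * PI * lattice_root M c k * p) / 2) ^ S n).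
  { intros k Hk. assert (Hb := freq_ge_1 k Hk).
    assert (HBN : lattice_root M c k ^ (2 * M) = freq k / c).
    { apply Rpower_root; [now apply freq_div_pos|lia]. }
    replace (2 * PI * lattice_root M c k * p / 2) with (lattice_root M c k * (PI * p)) by field.
    rewrite Rpow_mult_distr. unfold D, n.
    replace (lattice_root M c k ^ S (2 * M * r)) with (lattice_root M c k * (freq k / c) ^ r)
      by (rewrite <- HBN, <- pow_mult; reflexivity).
    assert (HBl : Rmin 1 (Rpower (/ c) (/ INR (2 * M))) <= lattice_root M c k).
    { eapply Rle_trans; [apply Rmin_r|]. apply Rle_Rpower_l.
      - left. apply Rinv_0_lt_compat. apply lt_0_INR. lia.
      - split; [now apply Rinv_0_lt_compat|]. rewrite <- (Rmult_1_l (/ c)) at 1.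
        apply Rmult_le_compat_r; [left; now apply Rinv_0_lt_compat|exact Hb]. }
    assert (Hcr : 0 < c ^ r) by now apply pow_lt.
    replace ((freq k / c) ^ r) with (freq k ^ r * / c ^ r) by (unfold Rdiv; rewrite Rpow_mult_distr, pow_inv; reflexivity).
    unfold Rdiv.
    assert (HX : 0 <= freq k ^ r * / c ^ r * (PI * p) ^ S (2 * M * r)).
    { apply Rmult_le_pos; [apply Rmult_le_pos; [apply pow_le; lra|left; now apply Rinv_0_lt_compat]|apply pow_le; lra]. }
    replace (freq k ^ r * Rmin 1 (Rpower (/ c) (/ INR (2 * M))) * ((PI * p) ^ S (2 * M * r) * / c ^ r))
      with (Rmin 1 (Rpower (/ c) (/ INR (2 * M))) * (freq k ^ r * / c ^ r * (PI * p) ^ S (2 * M * r))) by ring.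
    replace (lattice_root M c k * (freq k ^ r * / c ^ r) * (PI * p) ^ S (2 * M * r))
      with (lattice_root M c k * (freq k ^ r * / c ^ r * (PI * p) ^ S (2 * M * r))) by ring.
    now apply Rmult_le_compat_r. }
  set (rho := Rmin 1 (Rpower (/ c) (/ INR (2 * M)))) in *.
  assert (Hrho : 0 < rho) by (apply Rmin_glb_lt; [lra|apply Rpower_pos]).
  assert (HD : 0 < D) by (apply Rdiv_lt_0_compat; apply pow_lt; lra).
  exists (INR (fact n) / (rho * D)). intros k Hk. specialize (Hlow k Hk).
  assert (Hb := freq_ge_1 k Hk). assert (HB : 0 < lattice_root M c k) by apply Rpower_pos.
  unfold lattice_exp. set (z := (RtoC (2 * PI * lattice_root M c k) * root (2 * M) j)%C).
  assert (Hz : Re z = 2 * PI * lattice_root M c k * p) by (unfold z, p; apply re_scal_l).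
  assert (HzP : 0 < Re z) by (rewrite Hz; apply Rmult_lt_0_compat; [apply Rmult_lt_0_compat|]; lra).
  unfold Cdiv. rewrite Cmod_mult, Cmod_inv by now apply Cexp_neq_1.
  unfold root. rewrite Cmod_cis, Rmult_1_l.
  assert (He := exp_minus_1_lower n (Re z) HzP). rewrite Hz in He at 1.
  assert (Hm : exp (Re z) - 1 <= Cmod (Cexp z - 1)).
  { assert (H := Cmod_triangle (Cexp z - 1) 1). replace (Cexp z - 1 + 1)%C with (Cexp z) in H by ring.
    rewrite Cmod_Cexp, Cmod_1 in H. lra. }
  assert (Hfr : 0 < freq k ^ r) by (apply pow_lt; lra). assert (Hf := INR_fact_pos n).
  assert (HX : 0 < freq k ^ r * rho * D) by (apply Rmult_lt_0_compat; [apply Rmult_lt_0_compat|]; lra).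
  replace (INR (fact n) / (rho * D) / freq k ^ r) with (/ ((freq k ^ r * rho * D) / INR (fact n))) by (field; lra).
  apply Rinv_le_contravar; [apply Rdiv_lt_0_compat; lra|].
  apply (Rmult_le_reg_l (INR (fact n))); [exact Hf|].
  replace (INR (fact n) * (freq k ^ r * rho * D / INR (fact n))) with (freq k ^ r * rho * D) by (field; lra).
  apply Rle_trans with (INR (fact n) * (exp (Re z) - 1)); [lra|]. apply Rmult_le_compat_l; lra.
Qed.

Lemma nsum_uniform_bound (n : nat) (f : nat -> nat -> R) (g : nat -> R) :
  (forall k, (1 <= k)%nat -> 0 <= g k) ->
  (forall j, (j < n)%nat -> exists C0, forall k, (1 <= k)%nat -> Rabs (f j k) <= C0 * g k) ->
  exists C0, forall k, (1 <= k)%nat -> Rabs (nsum n (fun j => f j k)) <= C0 * g k.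
Proof.
  intros Hg. induction n as [|n IH]; intros H.
  - exists 0. intros k _. rewrite nsum_0, Rabs_R0. lra.
  - destruct IH as [C1 H1]; [intros; apply H; lia|]. destruct (H n ltac:(lia)) as [C2 H2].
    exists (C1 + C2). intros k Hk. rewrite nsum_S. specialize (H1 k Hk). specialize (H2 k Hk).
    eapply Rle_trans; [apply Rabs_triang|]. lra.
Qed.

Lemma lattice_exp_sums_decay (M r : nat) (c : R) :
  0 < c -> exists C0, 0 <= C0 /\ forall k, (1 <= k)%nat ->
    Rabs (lattice_exp_cos M (lattice_root M c k)) + Rabs (lattice_exp_sin M (lattice_root M c k)) <= C0 * / freq k ^ r.
Proof.
  intros Hc.
  assert (Hg : forall k, (1 <= k)%nat -> 0 <= / freq k ^ r).
  { intros k Hk. left. apply Rinv_0_lt_compat, pow_lt, freq_pos. exact Hk. }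
  destruct (nsum_uniform_bound M (fun j k => (-1) ^ (M + j + 1) * Im (lattice_exp M (lattice_root M c k) j))
    (fun k => / freq k ^ r) Hg) as [C1 H1].
  { intros j Hj. destruct (lattice_exp_decay M j r c Hj Hc) as [C0 HC0]. exists C0. intros k Hk.
    rewrite Rabs_mult, pow_1_abs, Rmult_1_l. eapply Rle_trans; [apply im_le_Cmod|now apply HC0]. }
  destruct (nsum_uniform_bound M (fun j k => Re (lattice_exp M (lattice_root M c k) j))
    (fun k => / freq k ^ r) Hg) as [C2 H2].
  { intros j Hj. destruct (lattice_exp_decay M j r c Hj Hc) as [C0 HC0]. exists C0. intros k Hk.
    eapply Rle_trans; [apply re_le_Cmod|now apply HC0]. }
  exists (Rabs (C1 + C2)). split; [apply Rabs_pos|]. intros k Hk. specialize (H1 k Hk). specialize (H2 k Hk).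
  apply Rle_trans with ((C1 + C2) * / freq k ^ r).
  - unfold lattice_exp_cos, lattice_exp_sin. lra.
  - apply Rmult_le_compat_r; [now apply Hg|apply Rle_abs].
Qed.

(** The part of [exp_term] that does not depend on [a]. A derivative in [a] costs one factor
    [freq k], which is the purpose of the extra power [q] in [exp_weight_decay]; it is used with
    [q = 3]. *)
Definition exp_weight (M : nat) (m : Z) (c : R) (k : nat) : R :=
  powerRZ (-1) m * powerRZ (freq k) (- (2 * m + 1)) * (4 * PI * lattice_root M c k / INR (2 * M)).

Lemma powerRZ_le_pow (b : R) (z : Z) : 1 <= b -> powerRZ b z <= b ^ Z.to_nat (Z.abs z).
Proof.
  intros Hb. rewrite powerRZ_Rpower by lra. rewrite <- Rpower_pow by lra. apply Rle_Rpower; [exact Hb|].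
  rewrite INR_IZR_INZ. apply IZR_le. lia.
Qed.

Lemma exp_weight_decay (M q : nat) (m : Z) (c : R) :
  (0 < M)%nat -> 0 < c -> exists C0, forall k, (1 <= k)%nat ->
    Rabs (exp_weight M m c k) * freq k ^ q *
      (Rabs (lattice_exp_cos M (lattice_root M c k)) + Rabs (lattice_exp_sin M (lattice_root M c k)))
    <= C0 * / INR k ^ 2.
Proof.
  intros HM Hc. assert (HPI := PI_RGT_0). assert (HN : 0 < INR (2 * M)) by (apply lt_0_INR; lia).
  set (e := Z.to_nat (Z.abs (- (2 * m + 1)))).
  (* The exponent is a budget: [e] for the integer power of [freq k], 1 for [lattice_root], which is
     at most [(1 + 1/c) freq k], [q] for the given power, and 2 for summability. *)
  destruct (lattice_exp_sums_decay M (e + 1 + q + 2) c Hc) as [C1 [HC1 H1]].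
  set (D := 4 * PI / INR (2 * M) * (1 + / c)).
  exists (D * C1). intros k Hk. specialize (H1 k Hk). assert (Hb := freq_ge_1 k Hk).
  assert (Hic : 0 < / c) by now apply Rinv_0_lt_compat.
  assert (Hl : lattice_root M c k <= (1 + / c) * freq k).
  { assert (HBN : lattice_root M c k ^ (2 * M) = freq k / c).
    { apply Rpower_root; [now apply freq_div_pos|lia]. }
    destruct (Rle_dec (lattice_root M c k) 1) as [Hle|Hgt]; [nra|].
    apply Rle_trans with (freq k / c); [|unfold Rdiv; nra].
    rewrite <- HBN. rewrite <- (pow_1 (lattice_root M c k)) at 1. apply Rle_pow; [lra|lia]. }
  assert (HB : 0 < lattice_root M c k) by apply Rpower_pos.
  assert (Hw : Rabs (exp_weight M m c k) <= D * freq k ^ (e + 1)).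
  { unfold exp_weight. rewrite !Rabs_mult.
    assert (E1 : Rabs (powerRZ (-1) m) = 1).
    { destruct m as [|n|n]; unfold powerRZ; [apply Rabs_R1|apply pow_1_abs|].
      rewrite Rabs_inv, pow_1_abs. apply Rinv_1. }
    rewrite E1, Rmult_1_l.
    assert (Hz : 0 < powerRZ (freq k) (- (2 * m + 1))) by (apply powerRZ_lt; lra).
    rewrite (Rabs_right (powerRZ _ _)) by lra.
    assert (Hp : 0 < 4 * PI * lattice_root M c k / INR (2 * M)).
    { apply Rdiv_lt_0_compat; [apply Rmult_lt_0_compat; [apply Rmult_lt_0_compat|]|]; lra. }
    rewrite (Rabs_right (4 * PI * lattice_root M c k / INR (2 * M))) by lra.
    rewrite pow_add, pow_1.
    replace (D * (freq k ^ e * freq k)) with (freq k ^ e * (4 * PI / INR (2 * M) * ((1 + / c) * freq k))) by (unfold D; ring).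
    apply Rmult_le_compat; try lra; [now apply powerRZ_le_pow|].
    replace (4 * PI * lattice_root M c k / INR (2 * M)) with (4 * PI / INR (2 * M) * lattice_root M c k) by (field; lra).
    apply Rmult_le_compat_l; [left; apply Rdiv_lt_0_compat; lra|exact Hl]. }
  assert (HD : 0 <= D).
  { apply Rmult_le_pos; [left; apply Rdiv_lt_0_compat; lra|lra]. }
  assert (Hq : 0 < freq k ^ q) by (apply pow_lt; lra).
  set (X := Rabs _ + Rabs _) in *.
  assert (HX : 0 <= X) by (apply Rplus_le_le_0_compat; apply Rabs_pos).
  apply Rle_trans with (D * freq k ^ (e + 1) * freq k ^ q * (C1 * / freq k ^ (e + 1 + q + 2))).
  - apply Rmult_le_compat; [apply Rmult_le_pos; [apply Rabs_pos|lra]|exact HX| |exact H1].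
    apply Rmult_le_compat_r; lra.
  - rewrite !(pow_add (freq k) _ 2), !(pow_add (freq k) _ q).
    assert (Hp : 0 < freq k ^ (e + 1)) by (apply pow_lt; lra).
    replace (D * freq k ^ (e + 1) * freq k ^ q * (C1 * / (freq k ^ (e + 1) * freq k ^ q * freq k ^ 2)))
      with (D * C1 * / freq k ^ 2) by (field; repeat split; lra).
    apply Rmult_le_compat_l; [now apply Rmult_le_pos|]. apply inv_freq_pow_le; lia.
Qed.

(** Two derivatives of the sine and cosine multiply by [- b^2]. That is the passage from [m + 1] to
    [m], in the sign [(-1)^m] as well as in the power of [freq k]. *)
Lemma exp_term_second_diff (M : nat) (m : Z) (c a h : R) (k : nat) :
  (1 <= k)%nat -> 0 < h ->
  Rabs (second_diff (fun t => exp_term M (m + 1) c t k) a h - h ^ 2 * exp_term M m c a k)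
  <= 10 * (Rabs (exp_weight M (m + 1) c k) * freq k ^ 3 *
      (Rabs (lattice_exp_cos M (lattice_root M c k)) + Rabs (lattice_exp_sin M (lattice_root M c k)))) * h ^ 3.
Proof.
  intros Hk Hh. assert (Hb := freq_pos k Hk).
  set (w := exp_weight M (m + 1) c k). set (A := lattice_exp_cos M (lattice_root M c k)).
  set (B := lattice_exp_sin M (lattice_root M c k)). set (b := freq k) in *.
  assert (E : exp_term M m c a k = - w * b ^ 2 * (cos (b * a) * A + sin (b * a) * B)).
  { unfold exp_term. fold A B b. unfold w, exp_weight. fold b.
    replace (- (2 * m + 1))%Z with (- (2 * (m + 1) + 1) + 2)%Z by lia.
    rewrite (powerRZ_add b) by lra. rewrite (powerRZ_add (-1)) by lra. simpl. ring. }
  rewrite E.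
  apply (second_diff_bound (fun t => exp_term M (m + 1) c t k)
    (fun t => w * b * (- sin (b * t) * A + cos (b * t) * B))
    (fun t => - w * b ^ 2 * (cos (b * t) * A + sin (b * t) * B))
    (fun t => - w * b ^ 3 * (- sin (b * t) * A + cos (b * t) * B))); auto.
  - intros t. apply (is_derive_ext (fun t => w * (cos (b * t) * A + sin (b * t) * B))); [reflexivity|].
    auto_derive; auto. ring.
  - intros t. auto_derive; auto. ring.
  - intros t. auto_derive; auto. ring.
  - intros t _. rewrite Rabs_mult, Rabs_mult, Rabs_Ropp, (Rabs_right (b ^ 3)) by (apply Rle_ge, pow_le; lra).
    apply Rmult_le_compat_l; [apply Rmult_le_pos; [apply Rabs_pos|apply pow_le; lra]|].
    eapply Rle_trans; [apply Rabs_triang|]. rewrite !Rabs_mult, Rabs_Ropp.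
    assert (H1 : Rabs (sin (b * t)) <= 1) by apply Rabs_le, SIN_bound.
    assert (H2 : Rabs (cos (b * t)) <= 1) by apply Rabs_le, COS_bound.
    assert (HA := Rabs_pos A). assert (HB := Rabs_pos B). nra.
Qed.

(** For [m = 0] the second derivative of [bern 3 / 2] is [bern 1 / 2], with third derivative [1/2];
    for [m = -1] the function [bern 1 / 2] is affine; below that everything is 0. The case
    distinction in [bern_part] is thus compatible with the descent. *)
Lemma bern_part_second_diff (m : Z) (a h : R) :
  (m <= 0)%Z -> 0 < h -> Rabs (second_diff (bern_part (m + 1)) a h - h ^ 2 * bern_part m a) <= 10 * 1 * h ^ 3.
Proof.
  intros Hm Hh.
  destruct (Z.eq_dec m 0) as [->|H0]; [|destruct (Z.eq_dec m (-1)) as [->|H1]].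
  - assert (Hd : forall n t, is_derive (fun t => bern (S n) t / 2) t (bern n t / 2)).
    { intros n t. apply (is_derive_ext (fun t => / 2 * bern (S n) t)); [intros; apply Rmult_comm|].
      unfold Rdiv. rewrite Rmult_comm. apply (is_derive_scal (bern (S n))), is_derive_bern. }
    apply (second_diff_bound (fun a => bern 3 a / 2) (fun a => bern 2 a / 2) (fun a => bern 1 a / 2) (fun a => bern 0 a / 2)); auto.
    intros t _. rewrite bern_0, Rabs_right; lra.
  - change (bern_part (-1 + 1)) with (fun a => bern 1 a / 2). change (bern_part (-1) a) with 0.
    unfold second_diff. rewrite !bern_1. match goal with |- Rabs ?x <= _ => replace x with 0 by field end.
    rewrite Rabs_R0. assert (0 < h ^ 3) by now apply pow_lt. lra.
  - unfold second_diff, bern_part.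
    rewrite (proj2 (Z.leb_gt 0 (m + 1))) by lia.
    rewrite (proj2 (Z.leb_gt 0 m)) by lia.
    match goal with |- Rabs ?x <= _ => replace x with 0 by ring end.
    rewrite Rabs_R0. assert (0 < h ^ 3) by now apply pow_lt. lra.
Qed.

(** * Second differences of series and integrals, and the descent in [m] *)

(** Convergence of the series of [v] is a conclusion: [h^2 v] is the second difference, summable by
    hypothesis, minus an error dominated by [beta]. *)
Lemma sums_second_diff (u : nat -> R -> R) (v beta : nat -> R) (a h s0 s1 s2 sb : R) :
  0 < h -> (forall n, (1 <= n)%nat -> Rabs (second_diff (u n) a h - h ^ 2 * v n) <= 10 * beta n * h ^ 3) ->
  sums beta sb -> sums (fun n => u n a) s0 -> sums (fun n => u n (a - h)) s1 -> sums (fun n => u n (a - 2 * h)) s2 ->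
  exists sv, sums v sv /\ Rabs (s0 - 2 * s1 + s2 - h ^ 2 * sv) <= 10 * sb * h ^ 3.
Proof.
  intros Hh Hb Hsb H0 H1 H2.
  assert (HD : sums (fun n => second_diff (u n) a h) (s0 - 2 * s1 + s2)).
  { eapply sums_ext; [|exact (sums_plus _ _ _ _ (sums_minus _ _ _ _ H0 (sums_scal 2 _ _ H1)) H2)]. reflexivity. }
  destruct (sums_dom (fun n => second_diff (u n) a h - h ^ 2 * v n) (fun n => (10 * h ^ 3) * beta n) ((10 * h ^ 3) * sb))
    as [d [Hd1 Hd2]].
  - intros n Hn. specialize (Hb n Hn). lra.
  - now apply sums_scal.
  - assert (Hv := sums_scal (/ h ^ 2) _ _ (sums_minus _ _ _ _ HD Hd1)).
    exists (/ h ^ 2 * (s0 - 2 * s1 + s2 - d)). split.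
    + eapply sums_ext; [|exact Hv]. intros n _. cbv beta. field. lra.
    + replace (s0 - 2 * s1 + s2 - h ^ 2 * (/ h ^ 2 * (s0 - 2 * s1 + s2 - d))) with d by (field; lra). lra.
Qed.

Lemma int0oo_second_diff (u : R -> R -> R) (v beta : R -> R) (a h s0 s1 s2 sv sb : R) :
  0 < h -> (forall x, 0 < x -> Rabs (second_diff (u x) a h - h ^ 2 * v x) <= 10 * beta x * h ^ 3) ->
  int0oo beta sb -> int0oo (fun x => u x a) s0 -> int0oo (fun x => u x (a - h)) s1 ->
  int0oo (fun x => u x (a - 2 * h)) s2 -> int0oo v sv ->
  Rabs (s0 - 2 * s1 + s2 - h ^ 2 * sv) <= 10 * sb * h ^ 3.
Proof.
  intros Hh Hb Hsb H0 H1 H2 Hv.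
  assert (HD : int0oo (fun x => second_diff (u x) a h) (s0 - 2 * s1 + s2)).
  { eapply int0oo_ext; [|exact (int0oo_plus _ _ _ _ (int0oo_minus _ _ _ _ H0 (int0oo_scal 2 _ _ H1)) H2)]. reflexivity. }
  replace (10 * sb * h ^ 3) with ((10 * h ^ 3) * sb) by ring.
  apply (int0oo_Rabs_le (fun x => second_diff (u x) a h - h ^ 2 * v x) (fun x => (10 * h ^ 3) * beta x)).
  - intros x Hx. specialize (Hb x Hx). lra.
  - apply int0oo_minus; [exact HD|now apply int0oo_scal].
  - now apply int0oo_scal.
Qed.

(** Let [X] be the defect of the identity for [m]. The second difference of the identity for [m + 1]
    holds exactly, so [h^2 X] is a combination of four approximation errors, each [O(h^3)] with a
    constant independent of [h]; thus [|X| <= Kt * h] for all small [h]. *)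
Lemma ker_transform_step (M : nat) (m : Z) (c : R) :
  (0 < M)%nat -> 0 < c -> (m <= 0)%Z ->
  (forall a, 0 < a <= 1 -> ker_transform M (m + 1) c a) ->
  forall a, 0 < a <= 1 -> ker_transform M m c a.
Proof.
  intros HM Hc Hm IH a Ha.
  set (q := Z.to_nat (1 - 2 * m)).
  assert (Hq : exists r, q = S r) by (exists (pred q); unfold q; lia). destruct Hq as [r Hq].
  (* For [h <= a / 4] all points used are at least [a / 2], so one bound on the kernel serves for
     every [h]. *)
  destruct (geom_kernel_decay r (a / 2) ltac:(lra)) as [C0 [HC0 Hdec]]. rewrite <- Hq in Hdec.
  destruct sums_inv_sqr as [S2 HS2].
  destruct (exp_weight_decay M 3 (m + 1) c HM Hc) as [C1 HC1].
  set (Cc := Rpower c (- / INR (2 * M))).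
  assert (Hy : forall n, (1 <= n)%nat -> 0 < c * INR n ^ (2 * M)).
  { intros n Hn. apply Rmult_lt_0_compat; [exact Hc|]. apply pow_lt. assert (H := INR_pos n Hn). lra. }
  assert (Hker : forall h, 0 < h <= a / 4 -> forall s0 s1 s2,
    sums (fun n => ker (m + 1) (c * INR n ^ (2 * M)) a) s0 ->
    sums (fun n => ker (m + 1) (c * INR n ^ (2 * M)) (a - h)) s1 ->
    sums (fun n => ker (m + 1) (c * INR n ^ (2 * M)) (a - 2 * h)) s2 ->
    exists sv, sums (fun n => ker m (c * INR n ^ (2 * M)) a) sv /\
      Rabs (s0 - 2 * s1 + s2 - h ^ 2 * sv) <= 10 * (C0 / c * S2) * h ^ 3).
  { intros h Hh s0 s1 s2 H0 H1 H2.
    apply (sums_second_diff (fun n => ker (m + 1) (c * INR n ^ (2 * M))) _ (fun n => C0 / c * / INR n ^ 2) a h s0 s1 s2); auto; [lra| |now apply sums_scal].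
    intros n Hn. specialize (Hy n Hn).
    eapply Rle_trans; [apply (ker_second_diff m _ a h (a / 2)); auto; lra|].
    apply Rmult_le_compat_r; [apply pow_le; lra|]. apply Rmult_le_compat_l; [lra|].
    eapply Rle_trans; [now apply Hdec|].
    assert (Hn1 := INR_pos n Hn).
    unfold Rdiv. rewrite Rmult_assoc. apply Rmult_le_compat_l; [exact HC0|].
    rewrite <- Rinv_mult. apply Rinv_le_contravar.
    - apply Rmult_lt_0_compat; [exact Hc|apply pow_lt; lra].
    - assert (INR n ^ 2 <= INR n ^ (2 * M)) by (apply Rle_pow; [lra|lia]). nra. }
  assert (Hexp : forall h, 0 < h <= a / 4 -> forall s0 s1 s2,
    sums (exp_term M (m + 1) c a) s0 -> sums (exp_term M (m + 1) c (a - h)) s1 ->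
    sums (exp_term M (m + 1) c (a - 2 * h)) s2 ->
    exists sv, sums (exp_term M m c a) sv /\ Rabs (s0 - 2 * s1 + s2 - h ^ 2 * sv) <= 10 * (C1 * S2) * h ^ 3).
  { intros h Hh s0 s1 s2 H0 H1 H2.
    apply (sums_second_diff (fun k t => exp_term M (m + 1) c t k) _ (fun n => C1 * / INR n ^ 2) a h s0 s1 s2); auto; [lra| |now apply sums_scal].
    intros k Hk. eapply Rle_trans; [apply exp_term_second_diff; auto; lra|].
    apply Rmult_le_compat_r; [apply pow_le; lra|]. apply Rmult_le_compat_l; [lra|]. now apply HC1. }
  assert (Hint : forall h, 0 < h <= a / 4 ->
    Rabs (ker_mellin M (m + 1) a - 2 * ker_mellin M (m + 1) (a - h) + ker_mellin M (m + 1) (a - 2 * h)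
          - h ^ 2 * ker_mellin M m a) <= 10 * (2 * C0 * (PI / 2)) * h ^ 3).
  { intros h Hh.
    assert (K0 := int0oo_ker M (m + 1) a HM Ha).
    assert (K1 := int0oo_ker M (m + 1) (a - h) HM ltac:(lra)).
    assert (K2 := int0oo_ker M (m + 1) (a - 2 * h) HM ltac:(lra)).
    assert (KB := int0oo_scal (2 * C0) _ _ int0oo_inv_1_sqr).
    refine (int0oo_second_diff (fun x => ker (m + 1) (x ^ (2 * M))) (fun x => ker m (x ^ (2 * M)) a)
      (fun x => 2 * C0 * / (1 + x ^ 2)) a h _ _ _ _ _ (proj1 Hh) _ KB K0 K1 K2 (int0oo_ker M m a HM Ha)).
    intros x Hx. assert (Hxp : 0 < x ^ (2 * M)) by now apply pow_lt.
    eapply Rle_trans; [apply (ker_second_diff m _ a h (a / 2)); auto; lra|].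
    apply Rmult_le_compat_r; [apply pow_le; lra|]. apply Rmult_le_compat_l; [lra|].
    eapply Rle_trans; [now apply Hdec|].
    rewrite (Rmult_comm 2), Rmult_assoc. apply Rmult_le_compat_l; [exact HC0|].
    apply inv_1_pow_le; [lia|exact Hx]. }
  destruct (IH a Ha) as [e0 [He0 Hs0]].
  (* A single step size, [h = a / 4], already yields convergence of both series for [m]; the sums
     are then fixed before [h] varies. *)
  assert (Hlow : exists sv ev, sums (fun n => ker m (c * INR n ^ (2 * M)) a) sv /\ sums (exp_term M m c a) ev).
  { destruct (IH (a - a / 4) ltac:(lra)) as [e1 [He1 Hs1]].
    destruct (IH (a - 2 * (a / 4)) ltac:(lra)) as [e2 [He2 Hs2]].
    destruct (Hker (a / 4) ltac:(lra) _ _ _ Hs0 Hs1 Hs2) as [sv [Hsv _]].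
    destruct (Hexp (a / 4) ltac:(lra) _ _ _ He0 He1 He2) as [ev [Hev _]].
    now exists sv, ev. }
  destruct Hlow as [sv [ev [Hsv Hev]]].
  set (X := sv - bern_part m a - Cc * ker_mellin M m a - ev).
  set (Kt := 10 * (C0 / c * S2) + 10 * 1 + Rabs Cc * (10 * (2 * C0 * (PI / 2))) + 10 * (C1 * S2)).
  assert (HX : forall h, 0 < h <= a / 4 -> Rabs X <= Kt * h).
  { intros h Hh.
    destruct (IH (a - h) ltac:(lra)) as [e1 [He1 Hs1]].
    destruct (IH (a - 2 * h) ltac:(lra)) as [e2 [He2 Hs2]].
    destruct (Hker h Hh _ _ _ Hs0 Hs1 Hs2) as [sv' [Hsv' B1]].
    rewrite (sums_unique _ _ _ Hsv' Hsv) in B1.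
    destruct (Hexp h Hh _ _ _ He0 He1 He2) as [ev' [Hev' B2]].
    rewrite (sums_unique _ _ _ Hev' Hev) in B2.
    assert (B3 := Hint h Hh).
    assert (B4 := bern_part_second_diff m a h Hm (proj1 Hh)). unfold second_diff in B4.
    fold Cc in B1.
    set (u1 := _ - h ^ 2 * sv) in B1. set (u2 := _ - h ^ 2 * ev) in B2.
    set (u3 := _ - h ^ 2 * ker_mellin M m a) in B3. set (u4 := _ - h ^ 2 * bern_part m a) in B4.
    (* The values at [a], [a - h] and [a - 2 h] cancel here, because each sum for [m + 1] was
       written out through its own identity. *)
    assert (EX : h ^ 2 * X = - u1 + (u4 + Cc * u3 + u2)) by (unfold X, u1, u2, u3, u4; ring).
    assert (HB : Rabs (h ^ 2 * X) <= Kt * h * h ^ 2).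
    { rewrite EX. eapply Rle_trans; [apply Rabs_triang|]. rewrite Rabs_Ropp.
      assert (T1 := Rabs_triang (u4 + Cc * u3) u2). assert (T2 := Rabs_triang u4 (Cc * u3)).
      rewrite (Rabs_mult Cc u3) in T2.
      assert (B5 : Rabs Cc * Rabs u3 <= Rabs Cc * (10 * (2 * C0 * (PI / 2)) * h ^ 3)).
      { apply Rmult_le_compat_l; [apply Rabs_pos|exact B3]. }
      unfold Kt. lra. }
    rewrite Rabs_mult, (Rabs_right (h ^ 2)) in HB by (apply Rle_ge, pow2_ge_0).
    apply (Rmult_le_reg_l (h ^ 2)); [apply pow_lt; lra|]. lra. }
  assert (HX0 : X = 0).
  { destruct (Req_dec X 0) as [|Hn]; auto. exfalso.
    assert (Hp : 0 < Rabs X) by now apply Rabs_pos_lt.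
    assert (HK : 0 < Kt).
    { specialize (HX (a / 4) ltac:(lra)). apply Rnot_le_lt. intros Hle. nra. }
    set (h := Rmin (a / 4) (Rabs X / (2 * Kt))).
    assert (Hh : 0 < h) by (apply Rmin_glb_lt; [lra|apply Rdiv_lt_0_compat; lra]).
    assert (H1 := Rmin_l (a / 4) (Rabs X / (2 * Kt))). assert (H2 := Rmin_r (a / 4) (Rabs X / (2 * Kt))). fold h in H1, H2.
    specialize (HX h ltac:(lra)).
    assert (Kt * h <= Kt * (Rabs X / (2 * Kt))) by (apply Rmult_le_compat_l; lra).
    replace (Kt * (Rabs X / (2 * Kt))) with (Rabs X / 2) in H by (field; lra). lra. }
  exists ev. split; [exact Hev|]. fold Cc.
  replace (bern_part m a + Cc * ker_mellin M m a + ev) with sv by (unfold X in HX0; lra). exact Hsv.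
Qed.

(** For [m <= 0] the descent starts from [m = 1] and is an induction on [n = 1 - m]. *)
Lemma ker_transform_all (M : nat) (m : Z) (c a : R) :
  (0 < M)%nat -> 0 < c -> 0 < a <= 1 -> ker_transform M m c a.
Proof.
  intros HM Hc Ha.
  destruct (Z_lt_le_dec 0 m) as [Hm|Hm].
  - rewrite <- (Z2Nat.id m) by lia. apply ker_transform_pos; auto. lia.
  - replace m with (1 - Z.of_nat (Z.to_nat (1 - m)))%Z by lia.
    assert (Hn : (1 <= Z.to_nat (1 - m))%nat) by lia. revert Hn a Ha.
    induction (Z.to_nat (1 - m)) as [|n IH]; [lia|]. intros _.
    apply ker_transform_step; auto; [lia|].
    replace (1 - Z.of_nat (S n) + 1)%Z with (1 - Z.of_nat n)%Z by lia.
    destruct n as [|n]; [|apply IH; lia].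
    intros a Ha. apply (ker_transform_pos M 1); auto.
Qed.

(** * Special values of the zeta function *)

Lemma Rpower_inv_sqr_le (s x : R) : 2 <= s -> 1 <= x -> Rpower x (- s) <= / x ^ 2.
Proof.
  intros Hs Hx. rewrite Rpower_Ropp. apply Rinv_le_contravar; [apply pow_lt; lra|].
  rewrite <- Rpower_pow by lra. apply Rle_Rpower; [exact Hx|simpl; lra].
Qed.

Lemma is_lim_seq_nsum (n : nat) (f : nat -> nat -> R) (l : nat -> R) :
  (forall i, (i < n)%nat -> is_lim_seq (f i) (l i)) ->
  is_lim_seq (fun M => nsum n (fun i => f i M)) (nsum n l).
Proof.
  induction n as [|n IH]; intros H; [apply is_lim_seq_const|].
  rewrite nsum_S. apply (is_lim_seq_ext (fun M => nsum n (fun i => f i M) + f n M)); [intros; now rewrite nsum_S|].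
  apply is_lim_seq_plus'; [apply IH; intros|]; apply H; lia.
Qed.

Lemma riemann_zeta_series (s : R) : 2 <= s -> sums (fun n => Rpower (INR n) (- s)) (riemann_zeta s).
Proof.
  intros Hs.
  destruct (sums_dom_inv_sqr (fun n => Rpower (INR n) (- s)) 1) as [l Hl].
  { intros n Hn. rewrite Rabs_right by (left; apply Rpower_pos). rewrite Rmult_1_l.
    apply Rpower_inv_sqr_le; [exact Hs|now apply INR_pos]. }
  unfold riemann_zeta, hurwitz_zeta. set (K := (_ + 1)%nat).
  assert (HL : is_lim_seq (hurwitz_EM s 1 K) l); [|now rewrite (is_lim_seq_unique _ _ HL)].
  unfold hurwitz_EM.
  replace l with (l + 0 / (s - 1) + 0 / 2 + nsum K (fun _ => 0)).
  2:{ rewrite nsum_zero by reflexivity. field. lra. }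
  apply is_lim_seq_plus'; [apply is_lim_seq_plus'; [apply is_lim_seq_plus'|]|].
  - eapply is_lim_seq_ext; [|exact Hl]. intros M. apply nsum_ext. intros i _. now rewrite S_INR.
  - apply is_lim_seq_mult'; [|apply is_lim_seq_const].
    apply (is_lim_seq_ext (fun M => Rpower (INR M + 1) (- (s - 1)))); [intros; f_equal; ring|].
    apply is_lim_seq_shift_Rpower; lra.
  - apply is_lim_seq_mult'; [|apply is_lim_seq_const]. apply is_lim_seq_shift_Rpower; lra.
  - apply (is_lim_seq_nsum K (fun k M => bernnum (2 * S k) / INR (fact (2 * S k)) * rising s (2 * S k - 1) *
      Rpower (INR M + 1) (1 - s - 2 * INR (S k))) (fun _ => 0)).
    intros k _. assert (Hk := pos_INR k).
    replace 0 with (bernnum (2 * S k) / INR (fact (2 * S k)) * rising s (2 * S k - 1) * 0) by ring.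
    apply is_lim_seq_mult'; [apply is_lim_seq_const|].
    apply (is_lim_seq_ext (fun M => Rpower (INR M + 1) (- (s - 1 + 2 * INR (S k))))); [intros; f_equal; ring|].
    apply is_lim_seq_shift_Rpower; [lra|]. rewrite S_INR. lra.
Qed.

Lemma riemann_zeta_even (q : nat) :
  (1 <= q)%nat ->
  riemann_zeta (INR (2 * q)) = (2 * PI) ^ (2 * q) * ((-1) ^ (q - 1) * bern (2 * q) 1 / 2).
Proof.
  intros Hq. assert (HPI := PI_RGT_0).
  assert (Hs : 2 <= INR (2 * q)).
  { replace 2 with (INR 2) by reflexivity. apply le_INR. lia. }
  apply (sums_unique _ _ _ (riemann_zeta_series _ Hs)).
  assert (H := sums_scal ((2 * PI) ^ (2 * q)) _ _ (sums_cos_bern (q - 1) 1 ltac:(lra))).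
  replace (2 * (q - 1) + 2)%nat with (2 * q)%nat in H by lia.
  eapply sums_ext; [|exact H]. intros n Hn. cbv beta. assert (Hn1 := INR_pos n Hn).
  replace (freq n * 1) with (0 + 2 * INR n * PI) by (unfold freq; ring). rewrite cos_period, cos_0.
  rewrite Rpower_Ropp, Rpower_pow by lra. rewrite (Rpow_mult_distr (2 * PI) (INR n)).
  field. split; apply pow_nonzero; lra.
Qed.

Lemma rising_last (s : R) (r : nat) : rising s (S r) = rising s r * (s + INR r).
Proof.
  revert s. induction r as [|r IH]; intros s.
  - unfold rising. simpl. ring.
  - rewrite rising_S, IH, (rising_S s r), S_INR. ring.
Qed.

(** At [s = 0] every rising factorial contains the factor 0, so the Euler-Maclaurin expression is
    [M - (M + 1) + 1/2], independent of [M]. *)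
Lemma riemann_zeta_0 : riemann_zeta 0 = - (1 / 2).
Proof.
  unfold riemann_zeta, hurwitz_zeta. set (K := (_ + 1)%nat).
  rewrite (Lim_seq_ext _ (fun _ => - (1 / 2))); [now rewrite Lim_seq_const|].
  intros M. unfold hurwitz_EM. assert (HM := pos_INR M).
  rewrite (nsum_ext M _ (fun _ => 1)).
  2:{ intros n _. assert (Hn := pos_INR n). rewrite Ropp_0. apply Rpower_O. lra. }
  rewrite nsum_const, (nsum_zero K).
  - rewrite Ropp_0, Rpower_O, Rminus_0_r, Rpower_1 by lra. field.
  - intros k _. replace (2 * S k - 1)%nat with (S (2 * k)) by lia. rewrite rising_S. ring.
Qed.

Lemma derive_eq_of_value (f g df : R -> R) (x0 x : R) :
  (forall t, is_derive f t (df t)) -> (forall t, is_derive g t (df t)) -> f x0 = g x0 -> f x = g x.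
Proof.
  intros Hf Hg H0.
  assert (E : (fun t => f t - g t) x = (fun t => f t - g t) x0).
  { apply (zero_derivative_const (fun t => f t - g t)). intros t. replace 0 with (df t - df t) by ring.
    apply (is_derive_minus (V := R_NormedModule)); auto. }
  lra.
Qed.

Lemma bern_difference (n : nat) (x : R) : bern (S n) (x + 1) - bern (S n) x = x ^ n / INR (fact n).
Proof.
  revert x. induction n as [|n IH]; intros x.
  - rewrite !bern_1. simpl. field.
  - apply (derive_eq_of_value (fun x => bern (S (S n)) (x + 1) - bern (S (S n)) x)
      (fun x => x ^ S n / INR (fact (S n))) (fun x => x ^ n / INR (fact n)) 0).
    + intros t. rewrite <- IH. apply (is_derive_minus (V := R_NormedModule)).
      * replace (bern (S n) (t + 1)) with (1 * bern (S n) (t + 1)) by ring.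
        apply (is_derive_comp (bern (S (S n))) (fun t => t + 1)); [apply is_derive_bern|].
        auto_derive; auto; ring.
      * apply is_derive_bern.
    + intros t. apply (is_derive_ext (fun t => / INR (fact (S n)) * t ^ S n)); [intros; apply Rmult_comm|].
      replace (t ^ n / INR (fact n)) with (/ INR (fact (S n)) * (INR (S n) * 1 * t ^ n)).
      * apply (is_derive_scal (fun t => t ^ S n)), (is_derive_pow (fun t => t) (S n) t 1), (is_derive_id (K := R_AbsRing)).
      * rewrite fact_simpl, mult_INR. assert (H := INR_fact_pos n).
        assert (INR (S n) <> 0) by (apply not_0_INR; lia). field. lra.
    + rewrite Rplus_0_l, bern_1_0, pow_ne_zero by lia. simpl. unfold Rdiv. ring.
Qed.

Lemma bern_power_sum (n M : nat) :
  nsum M (fun i => (INR i + 1) ^ n) = INR (fact n) * (bern (S n) (INR M + 1) - bern (S n) 1).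
Proof.
  assert (H := INR_fact_pos n). induction M as [|M IH].
  - rewrite nsum_0. rewrite Rplus_0_l. ring.
  - rewrite nsum_S, IH, S_INR. assert (E := bern_difference n (INR M + 1)).
    assert (E2 : (INR M + 1) ^ n = INR (fact n) * (bern (S n) (INR M + 1 + 1) - bern (S n) (INR M + 1))).
    { rewrite E. field. lra. }
    rewrite E2. ring.
Qed.

Definition fact_pow (n j : nat) (b : R) : R := if Nat.leb j n then b ^ (n - j) / INR (fact (n - j)) else 0.

Lemma bern_taylor (n : nat) (b : R) : bern n b = nsum (S n) (fun j => bern j 0 * fact_pow n j b).
Proof.
  revert b. induction n as [|n IH]; intros b.
  - rewrite nsum_S, nsum_0, !bern_0. unfold fact_pow. simpl. field.
  - apply (derive_eq_of_value (bern (S n)) (fun b => nsum (S (S n)) (fun j => bern j 0 * fact_pow (S n) j b)) (bern n) 0).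
    + intros t. apply is_derive_bern.
    + intros t. rewrite IH.
      apply (is_derive_ext (fun b => nsum (S n) (fun j => bern j 0 * fact_pow (S n) j b) + bern (S n) 0)).
      { intros x. rewrite (nsum_S (S n)). eqR. f_equal. unfold fact_pow. rewrite Nat.leb_refl, Nat.sub_diag. simpl. field. }
      rewrite <- (Rplus_0_r (nsum (S n) _)).
      apply (is_derive_plus (V := R_NormedModule)); [|apply (is_derive_const (V := R_NormedModule))].
      apply (is_derive_nsum (S n) (fun j b => bern j 0 * fact_pow (S n) j b) (fun j b => bern j 0 * fact_pow n j b)).
      intros j Hj. apply (is_derive_scal (fact_pow (S n) j)). unfold fact_pow.
      rewrite (proj2 (Nat.leb_le j (S n))) by lia.
      rewrite (proj2 (Nat.leb_le j n)) by lia.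
      replace (S n - j)%nat with (S (n - j)) by lia.
      apply (is_derive_ext (fun x => / INR (fact (S (n - j))) * x ^ S (n - j))); [intros; apply Rmult_comm|].
      replace (t ^ (n - j) / INR (fact (n - j))) with (/ INR (fact (S (n - j))) * (INR (S (n - j)) * 1 * t ^ (n - j))).
      * apply (is_derive_scal (fun t => t ^ S (n - j))), (is_derive_pow (fun t => t) (S (n - j)) t 1), (is_derive_id (K := R_AbsRing)).
      * rewrite fact_simpl, mult_INR. assert (H := INR_fact_pos (n - j)).
        assert (INR (S (n - j)) <> 0) by (apply not_0_INR; lia). field. lra.
    + rewrite (nsum_S (S n)), nsum_zero.
      * unfold fact_pow. rewrite Nat.leb_refl, Nat.sub_diag. simpl. field.
      * intros j Hj. unfold fact_pow. rewrite (proj2 (Nat.leb_le j (S n))) by lia.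
        rewrite pow_ne_zero by lia. unfold Rdiv. ring.
Qed.

(** The values at 0 and 1 differ only at index 1, where [bern 1 0 = - 1/2], and those of odd index
    at least 3 vanish. This rewrites a Taylor sum into the shape of the Euler-Maclaurin
    corrections. *)
Lemma bern_even_sum (K : nat) (g : nat -> R) :
  nsum (2 * K + 2) (fun j => bern j 0 * g j) = g 0%nat - g 1%nat / 2 + nsum K (fun k => bern (2 * S k) 1 * g (2 * S k)%nat).
Proof.
  induction K as [|K IH].
  - simpl (2 * 0 + 2)%nat. rewrite !nsum_S, !nsum_0, bern_0, bern_1. field.
  - replace (2 * S K + 2)%nat with (S (S (2 * K + 2))) by lia.
    rewrite (nsum_S (S (2 * K + 2))), (nsum_S (2 * K + 2)), IH, nsum_S.
    assert (H1 := bern_1_0 (2 * K + 2)). assert (H2 := bern_1_0 (2 * K + 3)).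
    rewrite (proj2 (Nat.eqb_neq (2 * K + 2) 1)) in H1 by lia.
    rewrite (proj2 (Nat.eqb_neq (2 * K + 3) 1)) in H2 by lia.
    rewrite bern_odd_1 in H2.
    replace (S (2 * K + 2)) with (2 * K + 3)%nat by lia.
    replace (2 * S K)%nat with (2 * K + 2)%nat by lia.
    replace (bern (2 * K + 3) 0) with 0 by lra. replace (bern (2 * K + 2) 0) with (bern (2 * K + 2) 1) by lra. ring.
Qed.

Lemma rising_neg (n r : nat) :
  rising (- INR n) r = if Nat.leb r n then (-1) ^ r * INR (fact n) / INR (fact (n - r)) else 0.
Proof.
  induction r as [|r IH].
  - unfold rising. simpl. rewrite Nat.sub_0_r. assert (H := INR_fact_pos n). field. lra.
  - rewrite rising_last, IH.
    destruct (le_lt_dec (S r) n) as [Hl|Hl].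
    + rewrite (proj2 (Nat.leb_le r n)) by lia.
      rewrite (proj2 (Nat.leb_le (S r) n)) by lia.
      replace (n - r)%nat with (S (n - S r)) by lia. rewrite fact_simpl, mult_INR.
      assert (H := INR_fact_pos (n - S r)).
      assert (E : INR (S (n - S r)) = INR n - INR r).
      { replace (S (n - S r)) with (n - r)%nat by lia. apply minus_INR. lia. }
      assert (INR (S (n - S r)) <> 0) by (apply not_0_INR; lia). rewrite E in *. simpl ((-1) ^ S r). field. lra.
    + rewrite (proj2 (Nat.leb_gt (S r) n)) by lia.
      destruct (Nat.eq_dec r n) as [->|Hn].
      * ring.
      * rewrite (proj2 (Nat.leb_gt r n)) by lia. ring.
Qed.

(* For [s = - 2 q] the Euler-Maclaurin expression is Faulhaber's formula, so it
   equals a multiple of B_{2q+1}(1) = 0 for every M. *)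
Lemma riemann_zeta_neg_even (q : nat) : (1 <= q)%nat -> riemann_zeta (- INR (2 * q)) = 0.
Proof.
  intros Hq. set (n := (2 * q)%nat). unfold riemann_zeta, hurwitz_zeta.
  set (K := (Z.to_nat (up (Rabs (- INR n))) + 1)%nat).
  assert (HK : (n < K)%nat).
  { apply INR_lt. unfold K. rewrite plus_INR, Rabs_Ropp, (Rabs_right (INR n)) by (apply Rle_ge, pos_INR).
    destruct (archimed (INR n)) as [H _]. assert (H2 := pos_INR n).
    rewrite (INR_IZR_INZ (Z.to_nat _)), Z2Nat.id; [simpl; lra|]. apply le_IZR. lra. }
  rewrite (Lim_seq_ext _ (fun _ => 0)); [now rewrite Lim_seq_const|].
  intros M. unfold hurwitz_EM. assert (HM := pos_INR M). set (b := INR M + 1). assert (Hb : 0 < b) by (unfold b; lra).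
  assert (Hfn := INR_fact_pos n).
  rewrite Ropp_involutive.
  rewrite (nsum_ext M _ (fun i => (INR i + 1) ^ n)).
  2:{ intros i _. assert (Hi := pos_INR i). now rewrite Rpower_pow by lra. }
  rewrite bern_power_sum. fold b.
  assert (Hodd : bern (S n) 1 = 0).
  { replace (S n) with (2 * (q - 1) + 3)%nat by (unfold n; lia). apply bern_odd_1. }
  rewrite Hodd, bern_taylor.
  (* [fact_pow] is 0 beyond index [n + 1], so the range may be extended to the one matching the [K]
     corrections. *)
  assert (Hext : nsum (S (S n)) (fun j => bern j 0 * fact_pow (S n) j b) = nsum (2 * K + 2) (fun j => bern j 0 * fact_pow (S n) j b)).
  { replace (2 * K + 2)%nat with (S (S n) + (2 * K - n))%nat by lia.
    rewrite (nsum_add (S (S n))), (nsum_zero (2 * K - n)); [ring|].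
    intros i _. unfold fact_pow. rewrite (proj2 (Nat.leb_gt (S (S n) + i) (S n))) by lia. ring. }
  rewrite Hext, bern_even_sum.
  rewrite (nsum_ext K (fun k => bernnum (2 * S k) / INR (fact (2 * S k)) * rising (- INR n) (2 * S k - 1) *
    Rpower b (1 - - INR n - 2 * INR (S k))) (fun k => - INR (fact n) * (bern (2 * S k) 1 * fact_pow (S n) (2 * S k) b))).
  - rewrite nsum_scal. unfold fact_pow. simpl (Nat.leb 0 (S n)). simpl (Nat.leb 1 (S n)).
    replace (S n - 0)%nat with (S n) by lia. replace (S n - 1)%nat with n by lia.
    replace (1 - - INR n) with (INR (S n)) by (rewrite S_INR; ring).
    rewrite !Rpower_pow by exact Hb. rewrite fact_simpl, mult_INR, S_INR.
    assert (H0 := pos_INR n). field. lra.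
  - intros k _. rewrite rising_neg. unfold fact_pow.
    change (bernnum (2 * S k) / INR (fact (2 * S k))) with (bern (2 * S k) 1).
    destruct (le_lt_dec (2 * S k) (S n)) as [Hl|Hl].
    + rewrite (proj2 (Nat.leb_le (2 * S k - 1) n)) by lia.
      rewrite (proj2 (Nat.leb_le (2 * S k) (S n))) by lia.
      replace (1 - - INR n - 2 * INR (S k)) with (INR (S n - 2 * S k)).
      2:{ rewrite minus_INR, mult_INR, (S_INR n) by lia. simpl (INR 2). ring. }
      rewrite Rpower_pow by exact Hb. replace (n - (2 * S k - 1))%nat with (S n - 2 * S k)%nat by lia.
      replace (2 * S k - 1)%nat with (S (2 * k)) by lia. rewrite pow_1_odd. unfold Rdiv. ring.
    + rewrite (proj2 (Nat.leb_gt (2 * S k - 1) n)) by lia.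
      rewrite (proj2 (Nat.leb_gt (2 * S k) (S n))) by lia. ring.
Qed.

(** * The left-hand side in terms of the kernel *)

Lemma zsum_nsum (lo hi : Z) (f : Z -> R) :
  zsum lo hi f = nsum (Z.to_nat (hi - lo + 1)) (fun k => f (lo + Z.of_nat k)%Z).
Proof. reflexivity. Qed.

Lemma zsum_neg (lo hi : Z) (f : Z -> R) : (hi < lo)%Z -> zsum lo hi f = 0.
Proof. intros H. rewrite zsum_nsum. replace (Z.to_nat (hi - lo + 1)) with 0%nat by lia. reflexivity. Qed.

(** The two halves go to different sides of the theorem: after summation over [n], odd indices give
    the zeta values on the left and even indices those that become Bernoulli numbers on the
    right. *)
Lemma bern_sum_parity (p : nat) (y a : R) :
  bern_sum (2 * p + 1) y a =
  nsum (S p) (fun i => bern (2 * i) a * y ^ (2 * i)) - nsum p (fun i => bern (2 * i + 1) a * y ^ (2 * i + 1)).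
Proof.
  unfold bern_sum. induction p as [|p IH].
  - change (2 * 0 + 1)%nat with 1%nat. rewrite !nsum_S, !nsum_0, bern_0.
    change (2 * 0)%nat with 0%nat. rewrite bern_0. ring.
  - replace (2 * S p + 1)%nat with (S (S (2 * p + 1))) by lia.
    rewrite (nsum_S (S (2 * p + 1))), (nsum_S (2 * p + 1)), IH, (nsum_S (S p)), (nsum_S p (fun i => bern (2 * i + 1) a * _)).
    replace (S (2 * p + 1)) with (2 * S p)%nat by lia. rewrite pow_1_even.
    replace ((-1) ^ (2 * p + 1)) with (-1); [ring|].
    replace (2 * p + 1)%nat with (S (2 * p)) by lia. symmetry. apply pow_1_odd.
Qed.

Lemma powerRZ_exp (x : R) (z : Z) : 0 < x -> powerRZ x z = exp (IZR z * ln x).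
Proof. intros Hx. now rewrite powerRZ_Rpower. Qed.

Lemma pow_exp (x : R) (n : nat) : 0 < x -> x ^ n = exp (INR n * ln x).
Proof. intros Hx. now rewrite <- Rpower_pow. Qed.

Lemma lattice_scale (m : Z) (N n : nat) (c : R) :
  0 < c -> (1 <= n)%nat ->
  powerRZ c (2 * m) * powerRZ (c * INR n ^ N) (- (2 * m)) = powerRZ (INR n) (- (2 * Z.of_nat N * m)).
Proof.
  intros Hc Hn. assert (Hn1 := INR_pos n Hn). assert (Hnp : 0 < INR n ^ N) by (apply pow_lt; lra).
  rewrite !powerRZ_exp by (try apply Rmult_lt_0_compat; lra).
  rewrite ln_mult by lra. rewrite ln_pow by lra. rewrite <- exp_plus. f_equal.
  rewrite !opp_IZR, !mult_IZR, <- INR_IZR_INZ. ring.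
Qed.

Definition left_term (N : nat) (m : Z) (a alpha : R) (n : nat) : R :=
  powerRZ (INR n) (- (2 * Z.of_nat N * m)) * exp (- a * (2 * INR n) ^ N * alpha)
        / (1 - exp (- (2 * INR n) ^ N * alpha)).

Lemma left_term_kernel (N : nat) (m : Z) (a alpha : R) (n : nat) :
  left_term N m a alpha n =
  powerRZ (INR n) (- (2 * Z.of_nat N * m)) * geom_kernel (2 ^ N * alpha * INR n ^ N) a.
Proof.
  unfold left_term, geom_kernel. rewrite Rpow_mult_distr.
  replace (- a * (2 ^ N * INR n ^ N) * alpha) with (- (a * (2 ^ N * alpha * INR n ^ N))) by ring.
  replace (- (2 ^ N * INR n ^ N) * alpha) with (- (2 ^ N * alpha * INR n ^ N)) by ring.
  unfold Rdiv. ring.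
Qed.

(** No Laurent term is removed when [m < 0], and the zeta value is taken at a negative even integer,
    where it vanishes. *)
Lemma left_bracket_neg (M : nat) (m : Z) (a alpha S0 : R) :
  (0 < M)%nat -> 0 < alpha -> (m < 0)%Z ->
  sums (fun n => ker m (2 ^ (2 * M) * alpha * INR n ^ (2 * M)) a) S0 ->
  riemann_zeta (IZR (2 * Z.of_nat (2 * M) * m)) = 0 /\
  series1 (left_term (2 * M) m a alpha) = powerRZ (2 ^ (2 * M) * alpha) (2 * m) * S0.
Proof.
  intros HM Hal Hm HS. set (c := 2 ^ (2 * M) * alpha) in *.
  assert (Hc : 0 < c) by (apply Rmult_lt_0_compat; [apply pow_lt; lra|exact Hal]).
  split.
  - replace (IZR (2 * Z.of_nat (2 * M) * m)) with (- INR (2 * (2 * M * Z.to_nat (- m)))).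
    + apply riemann_zeta_neg_even. nia.
    + rewrite INR_IZR_INZ, <- opp_IZR. f_equal. nia.
  - apply sums_series1. eapply sums_ext; [|exact (sums_scal (powerRZ c (2 * m)) _ _ HS)].
    intros n Hn. rewrite left_term_kernel. fold c.
    rewrite <- (lattice_scale m (2 * M) n c Hc Hn). unfold ker.
    replace (ker_order m) with 0%nat by (unfold ker_order; lia).
    unfold laurent_rem, bern_sum. rewrite nsum_0. unfold Rdiv. ring.
Qed.

Lemma sums_zeta_term (K : R) (s : Z) :
  (2 <= s)%Z -> sums (fun n => K * powerRZ (INR n) (- s)) (K * riemann_zeta (IZR s)).
Proof.
  intros Hs. apply sums_scal.
  eapply sums_ext; [|apply riemann_zeta_series; apply (IZR_le 2), Hs].
  intros n Hn. assert (Hn1 := INR_pos n Hn). rewrite powerRZ_Rpower, opp_IZR by lra. reflexivity.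
Qed.

(** Adding back the removed Laurent terms, each sums over [n] to a convergent zeta value. The odd
    index [2 p + 1], which would call for [zeta(0)], is not among the removed terms. *)
Lemma left_bracket_pos (M p : nat) (a alpha S0 : R) :
  (0 < M)%nat -> 0 < alpha ->
  sums (fun n => ker (Z.of_nat p) (2 ^ (2 * M) * alpha * INR n ^ (2 * M)) a) S0 ->
  series1 (left_term (2 * M) (Z.of_nat p) a alpha) =
  (2 ^ (2 * M) * alpha) ^ (2 * p) * S0
  + nsum (S p) (fun i => bern (2 * i) a * powerRZ (2 ^ (2 * M) * alpha) (2 * Z.of_nat i - 1)
      * riemann_zeta (IZR ((2 * Z.of_nat p + 1 - 2 * Z.of_nat i) * Z.of_nat (2 * M))))
  - nsum p (fun i => bern (2 * i + 1) a * (2 ^ (2 * M) * alpha) ^ (2 * i)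
      * riemann_zeta (IZR (2 * Z.of_nat (2 * M) * (Z.of_nat p - Z.of_nat i)))).
Proof.
  intros HM Hal HS. set (c := 2 ^ (2 * M) * alpha) in *.
  assert (Hc : 0 < c) by (apply Rmult_lt_0_compat; [apply pow_lt; lra|exact Hal]).
  set (m := Z.of_nat p) in *. set (N := Z.of_nat (2 * M)).
  apply sums_series1.
  assert (H1 := sums_scal (c ^ (2 * p)) _ _ HS).
  assert (H2 : sums (fun n => nsum (S p) (fun i => bern (2 * i) a * powerRZ c (2 * Z.of_nat i - 1) *
      powerRZ (INR n) (- ((2 * m + 1 - 2 * Z.of_nat i) * N))))
    (nsum (S p) (fun i => bern (2 * i) a * powerRZ c (2 * Z.of_nat i - 1) *
      riemann_zeta (IZR ((2 * m + 1 - 2 * Z.of_nat i) * N))))).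
  { apply (sums_nsum (S p) (fun i n => bern (2 * i) a * powerRZ c (2 * Z.of_nat i - 1) *
      powerRZ (INR n) (- ((2 * m + 1 - 2 * Z.of_nat i) * N)))).
    intros i Hi. apply sums_zeta_term. unfold m, N. nia. }
  assert (H3 : sums (fun n => nsum p (fun i => bern (2 * i + 1) a * c ^ (2 * i) *
      powerRZ (INR n) (- (2 * N * (m - Z.of_nat i)))))
    (nsum p (fun i => bern (2 * i + 1) a * c ^ (2 * i) * riemann_zeta (IZR (2 * N * (m - Z.of_nat i)))))).
  { apply (sums_nsum p (fun i n => bern (2 * i + 1) a * c ^ (2 * i) * powerRZ (INR n) (- (2 * N * (m - Z.of_nat i))))).
    intros i Hi. apply sums_zeta_term. unfold m, N. nia. }
  eapply sums_ext; [|exact (sums_minus _ _ _ _ (sums_plus _ _ _ _ H1 H2) H3)].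
  intros n Hn. cbv beta. rewrite left_term_kernel. fold c m N.
  assert (Hn1 := INR_pos n Hn). assert (Hnp : 0 < INR n ^ (2 * M)) by (apply pow_lt; lra).
  assert (Hy : 0 < c * INR n ^ (2 * M)) by now apply Rmult_lt_0_compat.
  assert (Hsc := lattice_scale m (2 * M) n c Hc Hn). fold N in Hsc.
  assert (Ec : c ^ (2 * p) = powerRZ c (2 * m)).
  { rewrite pow_powerRZ. f_equal. unfold m. lia. }
  rewrite Ec. unfold ker. replace (ker_order m) with (2 * p + 1)%nat by (unfold ker_order, m; lia).
  rewrite <- Rmult_assoc, Hsc. unfold laurent_rem. rewrite bern_sum_parity.
  set (y := c * INR n ^ (2 * M)) in *. set (W := powerRZ (INR n) (- (2 * N * m))) in *.
  rewrite (nsum_ext (S p) (fun i => bern (2 * i) a * powerRZ c (2 * Z.of_nat i - 1) *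
      powerRZ (INR n) (- ((2 * m + 1 - 2 * Z.of_nat i) * N))) (fun i => (W / y) * (bern (2 * i) a * y ^ (2 * i)))).
  2:{ intros i _. transitivity (bern (2 * i) a * (W / y * y ^ (2 * i))); [|ring].
      rewrite Rmult_assoc. f_equal. unfold W, Rdiv. rewrite (pow_exp y) by exact Hy.
      rewrite !powerRZ_exp by lra. rewrite <- (exp_ln y) at 1 by exact Hy. rewrite <- exp_Ropp.
      rewrite <- !exp_plus. f_equal. unfold y. rewrite ln_mult, ln_pow by lra.
      rewrite !opp_IZR, !mult_IZR, !minus_IZR, !plus_IZR, !mult_IZR. unfold N. rewrite <- !INR_IZR_INZ.
      rewrite !mult_INR. simpl (INR 2). ring. }
  rewrite (nsum_ext p (fun i => bern (2 * i + 1) a * c ^ (2 * i) * powerRZ (INR n) (- (2 * N * (m - Z.of_nat i))))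
     (fun i => (W / y) * (bern (2 * i + 1) a * y ^ (2 * i + 1)))).
  2:{ intros i _. transitivity (bern (2 * i + 1) a * (W / y * y ^ (2 * i + 1))); [|ring].
      rewrite Rmult_assoc. f_equal. unfold W, Rdiv. rewrite (pow_exp y), (pow_exp c) by assumption.
      rewrite !powerRZ_exp by lra. rewrite <- (exp_ln y) at 1 by exact Hy. rewrite <- exp_Ropp.
      rewrite <- !exp_plus. f_equal. unfold y. rewrite ln_mult, ln_pow by lra.
      rewrite !opp_IZR, !mult_IZR, !minus_IZR. unfold N. rewrite <- !INR_IZR_INZ.
      rewrite plus_INR, !mult_INR. simpl (INR 2). simpl (INR 1). ring. }
  rewrite !nsum_scal. field. lra.
Qed.

(** The zeta terms of the bracket are [g 0], ..., [g p], while the Laurent terms subtracted in the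
    series supply only [g 0], ..., [g (p - 1)]; the surplus [g p] is what appears as [bern_part]. *)
Lemma left_bracket (M : nat) (m : Z) (a alpha S0 : R) :
  (0 < M)%nat -> 0 < alpha ->
  sums (fun n => ker m (2 ^ (2 * M) * alpha * INR n ^ (2 * M)) a) S0 ->
  (a - 1 / 2) * riemann_zeta (IZR (2 * Z.of_nat (2 * M) * m))
    + zsum 1 m (fun j =>
        bernpoly (Z.to_nat (2 * j + 1)) a / INR (fact (Z.to_nat (2 * j + 1)))
        * riemann_zeta (IZR (2 * Z.of_nat (2 * M) * (m - j)))
        * (2 ^ (2 * M) * alpha) ^ (Z.to_nat (2 * j)))
    + series1 (left_term (2 * M) m a alpha)
  = powerRZ (2 ^ (2 * M) * alpha) (2 * m) * (S0 - bern_part m a)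
    + zsum 0 m (fun j => bern (Z.to_nat (2 * j)) a * powerRZ (2 ^ (2 * M) * alpha) (2 * j - 1)
        * riemann_zeta (IZR ((2 * m + 1 - 2 * j) * Z.of_nat (2 * M)))).
Proof.
  intros HM Hal HS.
  destruct (Z_lt_le_dec m 0) as [Hm|Hm].
  - destruct (left_bracket_neg M m a alpha S0 HM Hal Hm HS) as [E1 E2].
    rewrite E1, E2, !zsum_neg by lia.
    unfold bern_part. rewrite (proj2 (Z.leb_gt 0 m)) by lia. ring.
  - destruct (Z_of_nat_complete m Hm) as [p ->].
    rewrite (left_bracket_pos M p a alpha S0 HM Hal HS).
    set (c := 2 ^ (2 * M) * alpha) in *.
    rewrite !zsum_nsum. replace (Z.to_nat (Z.of_nat p - 1 + 1)) with p by lia.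
    replace (Z.to_nat (Z.of_nat p - 0 + 1)) with (S p) by lia.
    set (g := fun i => bern (2 * i + 1) a * c ^ (2 * i) * riemann_zeta (IZR (2 * Z.of_nat (2 * M) * (Z.of_nat p - Z.of_nat i)))).
    rewrite (nsum_ext p (fun k => bernpoly _ a / _ * _ * _) (fun i => g (S i))).
    2:{ intros i _. unfold g, bern.
        replace (Z.to_nat (2 * (1 + Z.of_nat i) + 1)) with (2 * S i + 1)%nat by lia.
        replace (Z.to_nat (2 * (1 + Z.of_nat i))) with (2 * S i)%nat by lia.
        replace (1 + Z.of_nat i)%Z with (Z.of_nat (S i)) by lia. ring. }
    assert (E0 : (a - 1 / 2) * riemann_zeta (IZR (2 * Z.of_nat (2 * M) * Z.of_nat p)) = g 0%nat).
    { unfold g. rewrite bern_1. simpl (c ^ (2 * 0)).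
      replace (Z.of_nat p - Z.of_nat 0)%Z with (Z.of_nat p) by lia. ring. }
    rewrite E0.
    assert (Eg : g 0%nat + nsum p (fun i => g (S i)) = nsum p g + g p).
    { rewrite <- nsum_first. apply nsum_S. }
    (* Here [zeta(0) = - 1/2] produces the half in [bern_part]. *)
    assert (Ep : g p = - (c ^ (2 * p) * bern_part (Z.of_nat p) a)).
    { unfold g. rewrite Z.sub_diag, Z.mul_0_r, riemann_zeta_0. unfold bern_part, ker_order.
      rewrite (proj2 (Z.leb_le 0 (Z.of_nat p))) by lia.
      replace (Z.to_nat (2 * Z.of_nat p + 1)) with (2 * p + 1)%nat by lia. field. }
    rewrite (nsum_ext (S p) (fun k => bern (Z.to_nat (2 * (0 + Z.of_nat k))) a * _ * _)
      (fun i => bern (2 * i) a * powerRZ c (2 * Z.of_nat i - 1)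
      * riemann_zeta (IZR ((2 * Z.of_nat p + 1 - 2 * Z.of_nat i) * Z.of_nat (2 * M))))).
    2:{ intros i _. rewrite Z.add_0_l. replace (Z.to_nat (2 * Z.of_nat i)) with (2 * i)%nat by lia. reflexivity. }
    replace (powerRZ c (2 * Z.of_nat p)) with (c ^ (2 * p)).
    2:{ rewrite pow_powerRZ. f_equal. lia. }
    rewrite Eg, Ep. ring.
Qed.

(** * Comparison of constants under [alpha * beta^N = PI^(N+1)] *)

(** The constants to be compared are built from real powers. After logarithms this relation
    eliminates [alpha], and each comparison is a linear identity in [ln 2], [ln PI], [ln beta] and,
    for the series, [ln k]. *)
Lemma ln_relation (N : nat) (alpha beta : R) :
  0 < alpha -> 0 < beta -> alpha * beta ^ N = PI ^ (N + 1) ->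
  ln alpha = (INR N + 1) * ln PI - INR N * ln beta.
Proof.
  intros Ha Hb H. assert (HPI := PI_RGT_0). apply (f_equal ln) in H.
  rewrite ln_mult, !ln_pow, plus_INR in H by (try apply pow_lt; lra). simpl (INR 1) in H. lra.
Qed.

Lemma ln_lattice_scale (N : nat) (alpha : R) : 0 < alpha -> ln (2 ^ N * alpha) = INR N * ln 2 + ln alpha.
Proof. intros H. rewrite ln_mult, ln_pow by (try apply pow_lt; lra). reflexivity. Qed.

Lemma constant_zeta (N : nat) (m : Z) (alpha beta s : R) :
  (0 < N)%nat -> 0 < alpha -> 0 < beta -> alpha * beta ^ N = PI ^ (N + 1) ->
  s = (1 - 2 * INR N * IZR m) / INR N ->
  Rpower alpha (- ((2 * INR N * IZR m - 1) / (INR N + 1))) * powerRZ (2 ^ N * alpha) (2 * m)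
    * Rpower (2 ^ N * alpha) (- / INR N) =
  Rpower beta (- ((2 * INR N * IZR m - 1) / (INR N + 1))) * powerRZ 2 (2 * Z.of_nat N * m - 1) * Rpower PI (- s).
Proof.
  intros HN Ha Hb H Hs. assert (HNr : 0 < INR N) by now apply lt_0_INR.
  assert (Hc : 0 < 2 ^ N * alpha) by (apply Rmult_lt_0_compat; [apply pow_lt|]; lra).
  rewrite !powerRZ_exp by lra. unfold Rpower. rewrite <- !exp_plus. f_equal.
  rewrite ln_lattice_scale, (ln_relation N alpha beta Ha Hb H), Hs by exact Ha.
  rewrite minus_IZR, !mult_IZR, <- INR_IZR_INZ. field. lra.
Qed.

Lemma constant_exp (N : nat) (m : Z) (alpha beta s : R) (k : nat) :
  (0 < N)%nat -> 0 < alpha -> 0 < beta -> alpha * beta ^ N = PI ^ (N + 1) ->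
  s = (1 - 2 * INR N * IZR m) / INR N -> (1 <= k)%nat ->
  Rpower alpha (- ((2 * INR N * IZR m - 1) / (INR N + 1))) * powerRZ (2 ^ N * alpha) (2 * m)
    * (powerRZ (freq k) (- (2 * m + 1)) * (4 * PI * Rpower (freq k / (2 ^ N * alpha)) (/ INR N) / INR N)) =
  Rpower beta (- ((2 * INR N * IZR m - 1) / (INR N + 1))) * powerRZ 2 (2 * Z.of_nat N * m - 1) / INR N
    * (2 * Rpower 2 s) * / Rpower (INR k) (2 * IZR m + 1 - 1 / INR N).
Proof.
  intros HN Ha Hb H Hs Hk. assert (HNr : 0 < INR N) by now apply lt_0_INR. assert (HPI := PI_RGT_0).
  assert (Hk1 := INR_pos k Hk). assert (Hf := freq_pos k Hk).
  assert (Hc : 0 < 2 ^ N * alpha) by (apply Rmult_lt_0_compat; [apply pow_lt|]; lra).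
  assert (Elf : ln (freq k) = ln 2 + ln PI + ln (INR k)).
  { unfold freq. rewrite (ln_mult (2 * PI)), (ln_mult 2) by lra. reflexivity. }
  rewrite <- Rpower_Ropp.
  (* The factor [2 PI] joins the exponents, and the other 2 is the factor 2 in front of the double
     sum of the theorem. *)
  assert (E4 : 4 * PI = 2 * exp (ln 2 + ln PI)) by (rewrite exp_plus, !exp_ln by lra; ring).
  rewrite E4, !powerRZ_exp by lra. unfold Rpower. rewrite ln_div, Elf by lra.
  rewrite ln_lattice_scale, (ln_relation N alpha beta Ha Hb H), Hs by exact Ha.
  set (X := exp (- _ * ln beta)).
  transitivity (2 / INR N * (exp (- ((2 * INR N * IZR m - 1) / (INR N + 1)) * ((INR N + 1) * ln PI - INR N * ln beta))
    * exp (IZR (2 * m) * (INR N * ln 2 + ((INR N + 1) * ln PI - INR N * ln beta)))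
    * exp (IZR (- (2 * m + 1)) * (ln 2 + ln PI + ln (INR k))) * exp (ln 2 + ln PI)
    * exp (/ INR N * (ln 2 + ln PI + ln (INR k) - (INR N * ln 2 + ((INR N + 1) * ln PI - INR N * ln beta)))))).
  { unfold Rdiv. ring. }
  transitivity (2 / INR N * (X * exp (IZR (2 * Z.of_nat N * m - 1) * ln 2)
    * exp ((1 - 2 * INR N * IZR m) / INR N * ln 2) * exp (- (2 * IZR m + 1 - 1 / INR N) * ln (INR k)))).
  2:{ unfold Rdiv. ring. }
  f_equal. unfold X. rewrite <- !exp_plus. f_equal.
  rewrite opp_IZR, plus_IZR, minus_IZR, !mult_IZR, <- INR_IZR_INZ. field. lra.
Qed.

Lemma lattice_root_beta (N : nat) (alpha beta : R) (k : nat) :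
  (0 < N)%nat -> 0 < alpha -> 0 < beta -> alpha * beta ^ N = PI ^ (N + 1) -> (1 <= k)%nat ->
  2 * PI * Rpower (freq k / (2 ^ N * alpha)) (/ INR N) = Rpower (2 * INR k) (1 / INR N) * beta.
Proof.
  intros HN Ha Hb H Hk. assert (HNr : 0 < INR N) by now apply lt_0_INR. assert (HPI := PI_RGT_0).
  assert (Hk1 := INR_pos k Hk). assert (Hf := freq_pos k Hk).
  assert (Hc : 0 < 2 ^ N * alpha) by (apply Rmult_lt_0_compat; [apply pow_lt|]; lra).
  assert (Elf : ln (freq k) = ln 2 + ln PI + ln (INR k)).
  { unfold freq. rewrite (ln_mult (2 * PI)), (ln_mult 2) by lra. reflexivity. }
  rewrite <- (exp_ln beta) by exact Hb.
  rewrite <- (exp_ln (2 * PI)) at 1 by lra.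
  unfold Rpower. rewrite ln_div, Elf by lra.
  rewrite ln_lattice_scale, (ln_mult 2 (INR k)), (ln_mult 2 PI), (ln_relation N alpha beta Ha Hb H) by lra.
  rewrite <- !exp_plus. f_equal. field. lra.
Qed.

Lemma constant_bern (N q : nat) (m j : Z) (alpha beta : R) :
  (0 < N)%nat -> 0 < alpha -> 0 < beta -> alpha * beta ^ N = PI ^ (N + 1) ->
  INR (2 * q) = (2 * IZR m + 1 - 2 * IZR j) * INR N ->
  Rpower alpha (- ((2 * INR N * IZR m - 1) / (INR N + 1))) * powerRZ (2 ^ N * alpha) (2 * j - 1) * (2 * PI) ^ (2 * q) / 2 =
  powerRZ 2 (2 * Z.of_nat N * m - 1) * Rpower alpha (2 * IZR j / (INR N + 1))
    * Rpower beta (INR N + (2 * INR N ^ 2 * (IZR m - IZR j) - INR N) / (INR N + 1)).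
Proof.
  intros HN Ha Hb H Hq. assert (HNr : 0 < INR N) by now apply lt_0_INR. assert (HPI := PI_RGT_0).
  assert (Hc : 0 < 2 ^ N * alpha) by (apply Rmult_lt_0_compat; [apply pow_lt|]; lra).
  rewrite (pow_exp (2 * PI)), !powerRZ_exp, Hq by lra. unfold Rpower.
  rewrite ln_lattice_scale, (ln_mult 2 PI), (ln_relation N alpha beta Ha Hb H) by lra.
  rewrite <- !exp_plus.
  transitivity (exp (- ((2 * INR N * IZR m - 1) / (INR N + 1)) * ((INR N + 1) * ln PI - INR N * ln beta) +
     IZR (2 * j - 1) * (INR N * ln 2 + ((INR N + 1) * ln PI - INR N * ln beta)) +
     (2 * IZR m + 1 - 2 * IZR j) * INR N * (ln 2 + ln PI)) * exp (- ln 2)).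
  { rewrite exp_Ropp, exp_ln by lra. reflexivity. }
  rewrite <- !exp_plus. f_equal.
  rewrite !minus_IZR, !mult_IZR, <- INR_IZR_INZ. field. lra.
Qed.

(** Spelled as in the theorem, so that its series are recognised by conversion;
    [exp_quotient_lattice] translates it to the scale [lattice_root]. *)
Definition exp_quotient (M : nat) (beta : R) (j n : nat) : C :=
  (Cexp (0, (PI * (2 * INR j + 1) / (2 * INR (2 * M)))%R) /
   (Cexp (RtoC (Rpower (2 * INR n) (1 / INR (2 * M)) * beta) * Cexp (0, (PI * (2 * INR j + 1) / (2 * INR (2 * M)))%R)) - RtoC 1))%C.

Lemma Cexp_imaginary (t : R) : Cexp (0, t) = cis t.
Proof. unfold Cexp, cis. simpl. now rewrite exp_0, !Rmult_1_l. Qed.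

Lemma exp_quotient_lattice (M : nat) (alpha beta : R) (j n : nat) :
  (0 < M)%nat -> 0 < alpha -> 0 < beta -> alpha * beta ^ (2 * M) = PI ^ (2 * M + 1) -> (1 <= n)%nat ->
  exp_quotient M beta j n = lattice_exp M (lattice_root M (2 ^ (2 * M) * alpha) n) j.
Proof.
  intros HM Ha Hb H Hn. unfold exp_quotient, lattice_exp, lattice_root.
  rewrite !Cexp_imaginary, <- (lattice_root_beta (2 * M) alpha beta n) by (auto; lia). reflexivity.
Qed.

Definition cos_term (M : nat) (m : Z) (a beta : R) (j n : nat) : R :=
  cos (2 * PI * INR n * a) / Rpower (INR n) (2 * IZR m + 1 - 1 / INR (2 * M)) * Im (exp_quotient M beta j n).
Definition sin_term (M : nat) (m : Z) (a beta : R) (j n : nat) : R :=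
  sin (2 * PI * INR n * a) / Rpower (INR n) (2 * IZR m + 1 - 1 / INR (2 * M)) * Re (exp_quotient M beta j n).

Lemma Rpower_neg_le_pow (s : R) : exists r, forall n, (1 <= n)%nat -> / Rpower (INR n) s <= INR n ^ r.
Proof.
  exists (Z.to_nat (up (Rabs s))). intros n Hn. assert (Hn1 := INR_pos n Hn).
  rewrite <- Rpower_Ropp, <- Rpower_pow by lra. apply Rle_Rpower; [exact Hn1|].
  destruct (archimed (Rabs s)) as [H _]. assert (H1 := Rle_abs (- s)). rewrite Rabs_Ropp in H1.
  assert (H2 := Rabs_pos s). rewrite INR_IZR_INZ, Z2Nat.id; [lra|]. apply le_IZR. lra.
Qed.

(** The theorem has a separate series for each [j] and for cosine and sine, so each must converge on
    its own. The parameters [t] and [part] treat cosine with [Im] and sine with [Re] at once. *)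
Lemma quotient_term_sums (M : nat) (alpha beta s : R) (j : nat) (t : nat -> R) (part : C -> R) :
  (j < M)%nat -> 0 < alpha -> 0 < beta -> alpha * beta ^ (2 * M) = PI ^ (2 * M + 1) ->
  (forall n, Rabs (t n) <= 1) -> (forall z, Rabs (part z) <= Cmod z) ->
  exists l, sums (fun n => t n / Rpower (INR n) s * part (exp_quotient M beta j n)) l.
Proof.
  intros Hj Ha Hb H Ht Hpart.
  assert (Hc : 0 < 2 ^ (2 * M) * alpha) by (apply Rmult_lt_0_compat; [apply pow_lt|]; lra).
  destruct (Rpower_neg_le_pow s) as [r Hr].
  destruct (lattice_exp_decay M j (r + 2) _ Hj Hc) as [C0 HC0].
  apply (sums_dom_inv_sqr _ C0). intros n Hn. assert (Hn1 := INR_pos n Hn).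
  rewrite (exp_quotient_lattice M alpha beta j n) by (auto; lia).
  specialize (HC0 n Hn). specialize (Hr n Hn). specialize (Ht n).
  set (z := lattice_exp _ _ _) in *. specialize (Hpart z). assert (Hz := Cmod_ge_0 z).
  assert (Hf := freq_pos n Hn). assert (Hfr : 0 < freq n ^ (r + 2)) by now apply pow_lt.
  assert (HC : 0 <= C0).
  { apply Rnot_lt_le. intros Hlt.
    assert (0 < / freq n ^ (r + 2)) by now apply Rinv_0_lt_compat. nra. }
  assert (Hi : 0 < / Rpower (INR n) s) by (apply Rinv_0_lt_compat, Rpower_pos).
  unfold Rdiv. rewrite !Rabs_mult, (Rabs_right (/ Rpower _ _)) by lra.
  apply Rle_trans with (INR n ^ r * (C0 / freq n ^ (r + 2))).
  - apply Rmult_le_compat; [apply Rmult_le_pos; [apply Rabs_pos|lra]|apply Rabs_pos| |lra].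
    nra.
  - assert (Hle : INR n ^ (r + 2) <= freq n ^ (r + 2)).
    { apply pow_incr. split; [lra|apply INR_le_freq]. }
    assert (Hnr2 : 0 < INR n ^ (r + 2)) by (apply pow_lt; lra).
    apply Rle_trans with (INR n ^ r * (C0 / INR n ^ (r + 2))).
    + apply Rmult_le_compat_l; [lra|]. apply Rmult_le_compat_l; [exact HC|]. now apply Rinv_le_contravar.
    + right. rewrite pow_add. field. split; [lra|apply pow_nonzero; lra].
Qed.

(** Both sides are sums of convergent series over [n] whose terms agree by [constant_exp] and
    [exp_quotient_lattice]; the finite sum over [j] is then moved outside. *)
Lemma exp_part_match (M : nat) (m : Z) (a alpha beta s e : R) :
  (0 < M)%nat -> 0 < alpha -> 0 < beta -> alpha * beta ^ (2 * M) = PI ^ (2 * M + 1) ->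
  s = (1 - 2 * INR (2 * M) * IZR m) / INR (2 * M) ->
  sums (exp_term M m (2 ^ (2 * M) * alpha) a) e ->
  Rpower alpha (- ((2 * INR (2 * M) * IZR m - 1) / (INR (2 * M) + 1))) * powerRZ (2 ^ (2 * M) * alpha) (2 * m) * e =
  Rpower beta (- ((2 * INR (2 * M) * IZR m - 1) / (INR (2 * M) + 1))) * powerRZ 2 (2 * Z.of_nat (2 * M) * m - 1) / INR (2 * M)
  * (- (2 * powerRZ (-1) (Z.of_nat M + m) * Rpower 2 s *
     nsum M (fun j => (-1) ^ j * (series1 (cos_term M m a beta j) + (-1) ^ (j + M + 1) * series1 (sin_term M m a beta j))))).
Proof.
  intros HM Ha Hb H Hs He.
  assert (HU : forall j, (j < M)%nat -> sums (cos_term M m a beta j) (series1 (cos_term M m a beta j))).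
  { intros j Hj.
    destruct (quotient_term_sums M alpha beta (2 * IZR m + 1 - 1 / INR (2 * M)) j (fun n => cos (2 * PI * INR n * a)) Im)
      as [l Hl]; auto.
    - intros n. apply Rabs_le, COS_bound.
    - apply im_le_Cmod.
    - fold (cos_term M m a beta j) in Hl.
      now rewrite (sums_series1 _ _ Hl). }
  assert (HV : forall j, (j < M)%nat -> sums (sin_term M m a beta j) (series1 (sin_term M m a beta j))).
  { intros j Hj.
    destruct (quotient_term_sums M alpha beta (2 * IZR m + 1 - 1 / INR (2 * M)) j (fun n => sin (2 * PI * INR n * a)) Re)
      as [l Hl]; auto.
    - intros n. apply Rabs_le, SIN_bound.
    - apply re_le_Cmod.
    - change (sums (sin_term M m a beta j) l) in Hl. now rewrite (sums_series1 _ _ Hl). }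
  set (A := Rpower alpha _). set (Bq := Rpower beta _).
  set (P2 := powerRZ 2 (2 * Z.of_nat (2 * M) * m - 1)).
  assert (HS : sums (fun n => nsum M (fun j => (-1) ^ (M + j + 1) * cos_term M m a beta j n + sin_term M m a beta j n))
    (nsum M (fun j => (-1) ^ (M + j + 1) * series1 (cos_term M m a beta j) + series1 (sin_term M m a beta j)))).
  { apply (sums_nsum M (fun j n => (-1) ^ (M + j + 1) * cos_term M m a beta j n + sin_term M m a beta j n)).
    intros j Hj. apply sums_plus; [apply sums_scal|]; auto. }
  assert (HL := sums_scal (A * powerRZ (2 ^ (2 * M) * alpha) (2 * m)) _ _ He).
  assert (HR := sums_scal (powerRZ (-1) m * (Bq * P2 / INR (2 * M) * (2 * Rpower 2 s))) _ _ HS).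
  assert (E : A * powerRZ (2 ^ (2 * M) * alpha) (2 * m) * e =
    powerRZ (-1) m * (Bq * P2 / INR (2 * M) * (2 * Rpower 2 s)) *
    nsum M (fun j => (-1) ^ (M + j + 1) * series1 (cos_term M m a beta j) + series1 (sin_term M m a beta j))).
  { apply (sums_unique _ _ _ HL). eapply sums_ext; [|exact HR]. intros n Hn.
    assert (HK := constant_exp (2 * M) m alpha beta s n ltac:(lia) Ha Hb H Hs Hn).
    fold A Bq P2 in HK. unfold exp_term.
    set (c := 2 ^ (2 * M) * alpha) in *. fold (lattice_root M c n) in HK.
    assert (Ee : nsum M (fun j => (-1) ^ (M + j + 1) * cos_term M m a beta j n + sin_term M m a beta j n) =
      / Rpower (INR n) (2 * IZR m + 1 - 1 / INR (2 * M)) *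
      (cos (freq n * a) * lattice_exp_cos M (lattice_root M c n) + sin (freq n * a) * lattice_exp_sin M (lattice_root M c n))).
    { unfold lattice_exp_cos, lattice_exp_sin. rewrite <- !nsum_scal, <- nsum_plus, <- nsum_scal.
      apply nsum_ext. intros j Hj. unfold cos_term, sin_term.
      rewrite (exp_quotient_lattice M alpha beta j n) by (auto; lia). fold c. fold (freq n). unfold Rdiv. ring. }
    rewrite Ee.
    set (T := cos (freq n * a) * _ + _).
    transitivity (powerRZ (-1) m * (Bq * P2 / INR (2 * M) * (2 * Rpower 2 s) * / Rpower (INR n) (2 * IZR m + 1 - 1 / INR (2 * M))) * T); [ring|].
    rewrite <- HK. ring. }
  rewrite E.
  (* Pulling out [(-1)^(M+1)] puts the sign [(-1)^(j+M+1)] on the sine part and accounts for the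
     minus sign in front of the double sum. *)
  rewrite (nsum_ext M (fun j => (-1) ^ (M + j + 1) * series1 (cos_term M m a beta j) + series1 (sin_term M m a beta j))
    (fun j => (-1) ^ (M + 1) * ((-1) ^ j * (series1 (cos_term M m a beta j) + (-1) ^ (j + M + 1) * series1 (sin_term M m a beta j))))).
  - rewrite nsum_scal. rewrite powerRZ_add, <- pow_powerRZ, pow_add, pow_1 by lra.
    ring.
  - intros j _. rewrite !pow_add, !pow_1.
    assert (E1 := pow_m1_sqr M). assert (E2 := pow_m1_sqr j).
    transitivity ((-1) ^ M * (-1) ^ j * -1 * series1 (cos_term M m a beta j)
      + ((-1) ^ M * (-1) ^ M) * ((-1) ^ j * (-1) ^ j) * series1 (sin_term M m a beta j)); [rewrite E1, E2|]; ring.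
Qed.

Lemma bern_part_match (M : nat) (m : Z) (a alpha beta : R) :
  (0 < M)%nat -> 0 < alpha -> 0 < beta -> alpha * beta ^ (2 * M) = PI ^ (2 * M + 1) ->
  Rpower alpha (- ((2 * INR (2 * M) * IZR m - 1) / (INR (2 * M) + 1))) *
  zsum 0 m (fun j => bern (Z.to_nat (2 * j)) a * powerRZ (2 ^ (2 * M) * alpha) (2 * j - 1)
        * riemann_zeta (IZR ((2 * m + 1 - 2 * j) * Z.of_nat (2 * M)))) =
  powerRZ (-1) (Z.of_nat M + 1) * powerRZ 2 (2 * Z.of_nat (2 * M) * m - 1) *
    zsum 0 m (fun j =>
      bernpoly (Z.to_nat (2 * j)) a * bernnum (Z.to_nat ((2 * m + 1 - 2 * j) * Z.of_nat (2 * M)))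
      / (INR (fact (Z.to_nat (2 * j))) * INR (fact (Z.to_nat ((2 * m + 1 - 2 * j) * Z.of_nat (2 * M)))))
      * Rpower alpha (2 * IZR j / (INR (2 * M) + 1))
      * Rpower beta (INR (2 * M) + (2 * INR (2 * M) ^ 2 * (IZR m - IZR j) - INR (2 * M)) / (INR (2 * M) + 1))).
Proof.
  intros HM Ha Hb H. rewrite !zsum_nsum, <- !nsum_scal. apply nsum_ext. intros i Hi.
  set (j := (0 + Z.of_nat i)%Z).
  set (q := (Z.to_nat (2 * m + 1 - 2 * j) * M)%nat).
  assert (Hq1 : (1 <= q)%nat) by (unfold q; nia).
  assert (EZ : ((2 * m + 1 - 2 * j) * Z.of_nat (2 * M))%Z = Z.of_nat (2 * q)) by (unfold q; nia).
  rewrite EZ, Nat2Z.id, <- INR_IZR_INZ, riemann_zeta_even by exact Hq1.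
  assert (Eq : INR (2 * q) = (2 * IZR m + 1 - 2 * IZR j) * INR (2 * M)).
  { rewrite (INR_IZR_INZ (2 * q)), <- EZ, !mult_IZR, minus_IZR, plus_IZR, !mult_IZR, <- INR_IZR_INZ. reflexivity. }
  assert (HK := constant_bern (2 * M) q m j alpha beta ltac:(lia) Ha Hb H Eq).
  (* [q] is an odd multiple of [M], hence has the parity of [M]; so the sign of the zeta value does
     not depend on [j]. *)
  assert (Es : (-1) ^ (q - 1) = powerRZ (-1) (Z.of_nat M + 1)).
  { replace (Z.of_nat M + 1)%Z with (Z.of_nat (M + 1)) by lia. rewrite <- pow_powerRZ.
    assert (E1 : (-1) ^ (q - 1) * (-1) ^ (M + 1) = 1).
    { rewrite <- pow_add. replace (q - 1 + (M + 1))%nat with (2 * (Z.to_nat (m - j + 1) * M))%nat by (unfold q; nia).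
      apply pow_1_even. }
    assert (E2 := pow_m1_sqr (M + 1)).
    transitivity ((-1) ^ (q - 1) * ((-1) ^ (M + 1) * (-1) ^ (M + 1))); [rewrite E2; ring|].
    rewrite <- Rmult_assoc, E1. ring. }
  rewrite Es. unfold bern, bernnum.
  set (A := Rpower alpha _) in *. set (sg := powerRZ (-1) _).
  set (F1 := INR (fact (Z.to_nat (2 * j)))). set (F2 := INR (fact (2 * q))).
  assert (HF1 : 0 < F1) by apply INR_fact_pos. assert (HF2 : 0 < F2) by apply INR_fact_pos.
  transitivity (sg * (bernpoly (Z.to_nat (2 * j)) a / F1) * (bernpoly (2 * q) 1 / F2) *
    (A * powerRZ (2 ^ (2 * M) * alpha) (2 * j - 1) * (2 * PI) ^ (2 * q) / 2)); [field; lra|].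
  rewrite HK. field. lra.
Qed.

Theorem theorem1p20 (N : nat) (m : Z) (a alpha beta : R)
  (HNpos : (0 < N)%nat) (HNeven : Nat.Even N)
  (Ha0 : 0 < a) (Ha1 : a <= 1)
  (Halpha : 0 < alpha) (Hbeta : 0 < beta)
  (Hab : alpha * beta ^ N = PI ^ (N + 1)) :
  let Nr := INR N in
  let mr := IZR m in
  let Nz := Z.of_nat N in
  let s0 := (1 - 2 * Nr * mr) / Nr in
  let w (j : nat) : C := Cexp (0, PI * (2 * INR j + 1) / (2 * Nr)) in
  Rpower alpha (- ((2 * Nr * mr - 1) / (Nr + 1))) *
    ( (a - 1 / 2) * riemann_zeta (IZR (2 * Nz * m))
    + zsum 1 m (fun j =>
        bernpoly (Z.to_nat (2 * j + 1)) a / INR (fact (Z.to_nat (2 * j + 1)))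
        * riemann_zeta (IZR (2 * Nz * (m - j)))
        * (2 ^ N * alpha) ^ (Z.to_nat (2 * j)))
    + series1 (fun n =>
        powerRZ (INR n) (- (2 * Nz * m)) * exp (- a * (2 * INR n) ^ N * alpha)
        / (1 - exp (- (2 * INR n) ^ N * alpha))) )
  =
  Rpower beta (- ((2 * Nr * mr - 1) / (Nr + 1))) * powerRZ 2 (2 * Nz * m - 1) / Nr *
    ( Rpower PI (- s0) * Gamma s0 * hurwitz_zeta s0 a
    - 2 * powerRZ (-1) (Z.of_nat (N / 2) + m) * Rpower 2 s0 *
      nsum (N / 2) (fun j =>
        (-1) ^ j *
        ( series1 (fun n =>
            cos (2 * PI * INR n * a) / Rpower (INR n) (2 * mr + 1 - 1 / Nr)
            * Im (Cdiv (w j)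
                   (Cminus (Cexp (Cmult (RtoC (Rpower (2 * INR n) (1 / Nr) * beta)) (w j)))
                           (RtoC 1))))
        + (-1) ^ (j + N / 2 + 1) *
          series1 (fun n =>
            sin (2 * PI * INR n * a) / Rpower (INR n) (2 * mr + 1 - 1 / Nr)
            * Re (Cdiv (w j)
                   (Cminus (Cexp (Cmult (RtoC (Rpower (2 * INR n) (1 / Nr) * beta)) (w j)))
                           (RtoC 1)))))) )
  + powerRZ (-1) (Z.of_nat (N / 2) + 1) * powerRZ 2 (2 * Nz * m - 1) *
    zsum 0 m (fun j =>
      bernpoly (Z.to_nat (2 * j)) a * bernnum (Z.to_nat ((2 * m + 1 - 2 * j) * Nz))
      / (INR (fact (Z.to_nat (2 * j))) * INR (fact (Z.to_nat ((2 * m + 1 - 2 * j) * Nz))))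
      * Rpower alpha (2 * IZR j / (Nr + 1))
      * Rpower beta (Nr + (2 * Nr ^ 2 * (mr - IZR j) - Nr) / (Nr + 1))).
Proof.
  destruct HNeven as [M ->]. assert (HM : (0 < M)%nat) by lia.
  assert (E2 : (2 * M / 2)%nat = M) by (rewrite Nat.mul_comm; apply Nat.div_mul; lia).
  rewrite E2. intros Nr mr Nz s0 w.
  assert (HN : 0 < INR (2 * M)) by (apply lt_0_INR; lia).
  set (c := 2 ^ (2 * M) * alpha).
  assert (Hc : 0 < c) by (apply Rmult_lt_0_compat; [apply pow_lt|]; lra).
  destruct (ker_transform_all M m c a HM Hc (conj Ha0 Ha1)) as [e [He HS]].
  set (A := Rpower alpha (- ((2 * Nr * mr - 1) / (Nr + 1)))).
  (* The [bern_part] subtracted in [left_bracket] cancels the one in [HS], leaving the Mellin term,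
     the exponential terms and the Bernoulli sum. *)
  etransitivity; [exact (f_equal (Rmult A) (left_bracket M m a alpha _ HM Halpha HS))|].
  fold c.
  assert (Es : zeta_arg M m = s0) by (unfold zeta_arg, s0, Nr, mr; field; lra).
  unfold ker_mellin. rewrite Es.
  (* [K1], [K2] and [K3] rewrite these three parts in terms of [beta]. *)
  assert (K1 := constant_zeta (2 * M) m alpha beta s0 ltac:(lia) Halpha Hbeta Hab eq_refl).
  assert (K2 := exp_part_match M m a alpha beta s0 e HM Halpha Hbeta Hab eq_refl He).
  assert (K3 := bern_part_match M m a alpha beta HM Halpha Hbeta Hab).
  fold c in K1, K2, K3. fold Nr mr in K1, K2, K3. fold A in K1, K2, K3.
  match goal with |- A * (_ + ?Z) = _ => set (ZB := Z) in * end.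
  match type of K2 with _ = _ * (- (_ * ?T)) => set (SUM := T) in * end.
  match type of K3 with _ = _ * ?T => set (ZR := T) in * end.
  set (Bq := Rpower beta (- ((2 * Nr * mr - 1) / (Nr + 1)))) in *.
  set (P2 := powerRZ 2 (2 * Nz * m - 1)) in *.
  set (HZ := hurwitz_zeta s0 a) in *. set (G := Gamma s0) in *.
  transitivity ((A * powerRZ c (2 * m) * Rpower c (- / Nr)) * (G * HZ / Nr) + A * powerRZ c (2 * m) * e + A * ZB).
  { fold Nr. ring. }
  assert (K3' : A * ZB = powerRZ (-1) (Z.of_nat M + 1) * P2 * ZR) by exact K3.
  rewrite K1, K2, K3'.
  change (Bq * P2 * Rpower PI (- s0) * (G * HZ / Nr)
     + Bq * P2 / Nr * - (2 * powerRZ (-1) (Z.of_nat M + m) * Rpower 2 s0 * SUM)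
     + powerRZ (-1) (Z.of_nat M + 1) * P2 * ZR =
   Bq * P2 / Nr * (Rpower PI (- s0) * G * HZ - 2 * powerRZ (-1) (Z.of_nat M + m) * Rpower 2 s0 * SUM)
     + powerRZ (-1) (Z.of_nat M + 1) * P2 * ZR).
  unfold Rdiv. ring.
Qed.
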